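(* There is an algorithm that, given as input a finite quiver $Q$ and two $\mathbb Z$-representations of $Q$, decides whether the representations are isomorphic.
   Context: A finite quiver $Q=(Q_0,Q_1)$ is a finite directed graph with vertex set $Q_0$ and edge set $Q_1$; $\boldsymbol s(e)$ and $\boldsymbol r(e)$ denote the source and target of an edge $e$. A $\mathbb Z$-representation $(A,\phi)$ of $Q$ is an assignment of a finitely generated abelian group $A_v$ to each $v\in Q_0$ and of a homomorphism $\phi_e\colon A_{\boldsymbol s(e)}\to A_{\boldsymbol r(e)}$ to each $e\in Q_1$. A morphism $f\colon(A,\phi)\to(B,\rho)$ is a collection of homomorphisms $f_v\colon A_v\to B_v$, one for each $v\in Q_0$, such that $f_{\boldsymbol r(e)}\circ\phi_e=\rho_e\circ f_{\boldsymbol s(e)}$ for all $e\in Q_1$; isomorphism of representations is isomorphism in the resulting category. As algorithmic input, a $\mathbb Z$-representation $(A,\phi)$ is given by a finite presentation of each group $A_v$ together with the image under $\phi_e$ of each generator of $A_{\boldsymbol s(e)}$, for each $e\in Q_1$. *)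

(* Defs.v *)
From HB Require Import structures.
From mathcomp Require Import all_boot all_order all_algebra.

Set Implicit Arguments.
Unset Strict Implicit.
Unset Printing Implicit Defensive.

Import GRing.Theory.
Local Open Scope ring_scope.

(* Codes of partial (mu-)recursive functions, indexed by their arity; in RComp,
   g is the list of the m inner functions. *)
Inductive recfun : nat -> Type :=
| RZero k : recfun k
| RSucc : recfun 1
| RProj k (i : 'I_k) : recfun k
| RComp k m (f : recfun m) (g : 'I_m -> recfun k) : recfun k
| RPrec k (f : recfun k) (g : recfun k.+2) : recfun k.+1
| RMin k (f : recfun k.+1) : recfun k.

(* Graph of the function defined from F and G by recursion on n:
   h 0 = F and h (i + 1) = G (i, h i). *)
Fixpoint prec_graph (F : nat -> Prop) (G : nat -> nat -> nat -> Prop)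
    (n : nat) : nat -> Prop :=
  if n is i.+1 then fun y => exists2 z, prec_graph F G i z & G i z y else F.

(* [computes f a y]: on the arguments a, f is defined and has value y. *)
Fixpoint computes k (f : recfun k) : k.-tuple nat -> nat -> Prop :=
  match f in recfun k return k.-tuple nat -> nat -> Prop with
  | RZero _ => fun _ y => y = 0%N
  | RSucc => fun a y => y = (thead a).+1
  | RProj _ i => fun a y => y = tnth a i
  | RComp _ m f g => fun a y =>
      exists2 b : m.-tuple nat, (forall i, computes (g i) a (tnth b i)) &
                                computes f b y
  | RPrec k f g => fun a y =>
      let x : k.-tuple nat := [tuple of behead a] in
      prec_graph (computes f x) (fun i z => computes g [tuple of i :: z :: x])
                 (thead a) y
  | RMin _ f => fun a y =>
      computes f [tuple of y :: a] 0%N /\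
      forall i, (i < y)%N -> exists z, computes f [tuple of i :: a] z.+1
  end.

(* On the input a, the algorithm f halts and answers whether P holds. *)
Definition decides k (f : recfun k) (a : k.-tuple nat) (P : Prop) : Prop :=
  (P -> computes f a 1%N) /\ (~ P -> computes f a 0%N).

Record quiver := Quiver {
  vertex : finType;
  arrow : finType;
  src : arrow -> vertex;
  tgt : arrow -> vertex }.

Definition finitely_generated (A : zmodType) : Prop :=
  exists n (x : 'I_n -> A), forall a, exists c : 'I_n -> int,
    a = \sum_i x i *~ c i.

Record zrep (Q : quiver) := ZRep {
  zgrp : vertex Q -> zmodType;
  zgrp_fg : forall v, finitely_generated (zgrp v);
  zmap : forall e : arrow Q, {additive zgrp (src e) -> zgrp (tgt e)} }.

Record zrep_hom (Q : quiver) (A B : zrep Q) := ZRepHom {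
  hom_at : forall v, {additive zgrp A v -> zgrp B v};
  hom_comm : forall e x, hom_at (tgt e) (zmap A e x) =
                         zmap B e (hom_at (src e) x) }.

Definition zrep_iso (Q : quiver) (A B : zrep Q) : Prop :=
  exists (f : zrep_hom A B) (g : zrep_hom B A), forall v,
    cancel (hom_at f v) (hom_at g v) /\ cancel (hom_at g v) (hom_at f v).

(* The group at v has ngen v generators, subject to the relations given by the
   nrel v rows of rels v; row i of img e expresses the image of generator i of
   the source group as an integer combination of generators of the target. *)
Record zdata (Q : quiver) := ZData {
  ngen : vertex Q -> nat;
  nrel : vertex Q -> nat;
  rels : forall v, 'M[int]_(nrel v, ngen v);
  img : forall e : arrow Q, 'M[int]_(ngen (src e), ngen (tgt e)) }.

Definition lincomb (A : zmodType) n (x : 'I_n -> A) (c : 'rV[int]_n) : A :=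
  \sum_i x i *~ c 0 i.

(* x exhibits A as the quotient of Z^n by the subgroup spanned by the rows
   of R. *)
Definition presents_group (A : zmodType) m n (R : 'M[int]_(m, n))
    (x : 'I_n -> A) : Prop :=
  (forall a, exists c, a = lincomb x c) /\
  (forall c, lincomb x c = 0 <-> exists d : 'rV[int]_m, c = d *m R).

Definition presents (Q : quiver) (p : zdata Q) (A : zrep Q) : Prop :=
  exists x : forall v, 'I_(ngen p v) -> zgrp A v,
    (forall v, presents_group (rels p v) (x v)) /\
    (forall e i, zmap A e (x (src e) i) = lincomb (x (tgt e)) (row i (img p e))).

Definition code_int (z : int) : nat :=
  match z with Posz n => n.*2 | Negz n => n.*2.+1 end.

(* The dimensions are recorded, so that matrices without rows or columns are
   encoded faithfully. *)
Definition code_mx m n (M : 'M[int]_(m, n)) : nat :=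
  CodeSeq.code
    [:: m, n & [seq code_int (M i j) | i <- enum 'I_m, j <- enum 'I_n]].

(* Vertices are numbered by their rank in the enumeration of the finite type. *)
Definition code_quiver (Q : quiver) : nat :=
  CodeSeq.code
    (#|vertex Q| ::
     [seq CodeSeq.code [:: nat_of_ord (enum_rank (src e));
                           nat_of_ord (enum_rank (tgt e))]
     | e <- enum (arrow Q)]).

Definition code_zdata (Q : quiver) (p : zdata Q) : nat :=
  CodeSeq.code
    [:: CodeSeq.code [seq code_mx (rels p v) | v <- enum (vertex Q)];
        CodeSeq.code [seq code_mx (img p e) | e <- enum (arrow Q)]].

(* Main.v *)
(* Two representations are isomorphic iff there are integer matrices satisfying
   the finitely many equations of [qcert].  These equations can be checked
   mechanically, so it suffices to bound the smallest solution by a recursive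
   function of the input; a bounded search then decides.  Summing over the
   vertices, a representation becomes one finitely generated abelian group with
   operators, among them the projections on the vertices.

   Let A and B be such groups with operators and F an isomorphism.  The lattices
   End(A) and Hom(A, B) have bounded generators.  Modulo the radicals of the
   trace pairings they become lattices over an order in a semisimple algebra,
   and F induces an isomorphism of them.  It is enough to replace that one by a
   bounded isomorphism congruent to it modulo the exponent of the torsion, since
   a lift is then again an isomorphism: elements of the radical are nilpotent.

   For an isomorphism g of semisimple lattices, join the standard quadratic form
   to its pull-back under g by a path of positive definite forms.  Along the path
   reduced bases factor g into steps; semisimplicity allows one to
   adjust them by unitriangular matrices so that both the steps and the
   representations met on the way are bounded.  As there are finitely many
   bounded representations, pigeonholing on the pairs (representation, partial
   product modulo k) shortens the product to one of bounded length that is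
   congruent to g modulo k. *)

(* Homomorphisms form a lattice and are found by linear algebra over the integers; invertibility is
   the one condition that is not linear. The isomorphisms form a torsor under an automorphism group
   that may be infinite, so a bound for the smallest one has to come from reduction theory. If the
   operators distort a quadratic form by a bounded factor, then in a reduced basis they are block
   triangular with bounded diagonal blocks: the norms of the basis vectors fall into clusters, and
   an integer coefficient of absolute value below one vanishes. The blocks below the diagonal escape
   this argument, since the gaps between clusters are unbounded. They are controlled only up to a
   coboundary, which is where semisimplicity enters; hence the passage to quotients by radicals. The
   congruence condition makes this passage reversible: it fixes the action on the torsion, which the
   quotients do not see. Only the bounds have to be recursive. Minimal vectors, paths of forms and
   pigeonholing merely prove that a bounded solution exists, so classical arguments suffice for
   them. *)
From HB Require Import structures.
From mathcomp Require boolp.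
From mathcomp Require Import all_boot all_order all_algebra perm all_field.
From mathcomp Require Import zify ring.
Require Import Defs.
Set Implicit Arguments.
Unset Strict Implicit.
Unset Printing Implicit Defensive.
Import Order.TTheory GRing.Theory Num.Theory.
Local Open Scope ring_scope.

(** * Total recursive functions *)

(* The function [F] of the list of its [k] arguments is total recursive; the
   list plays the role of an environment of de Bruijn variables. *)
Definition recf k (F : seq nat -> nat) : Prop :=
  exists f : recfun k, forall a : k.-tuple nat, computes f a (F a).

Lemma recf_ext k F G : recf k F -> (forall e, size e = k -> F e = G e) -> recf k G.
Proof. by move=> [f Hf] E; exists f => a; rewrite -E ?size_tuple. Qed.

Lemma recf_comp k m F (G : 'I_m -> seq nat -> nat) :
  recf m F -> (forall i, recf k (G i)) ->
  recf k (fun e => F [seq G i e | i <- enum 'I_m]).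
Proof.
move=> [f Hf] HG.
have [g Hg] := @fin_all_exists _ _ _ HG.
exists (RComp f g) => a /=.
exists [tuple G i a | i < m]; last exact: Hf.
by move=> i; rewrite tnth_mktuple.
Qed.

Lemma recf_comp1 k F G : recf 1 F -> recf k G -> recf k (fun e => F [:: G e]).
Proof.
move=> HF HG; apply: recf_ext (recf_comp (G := fun=> G) HF (fun=> HG)) _ => e _.
by rewrite enum_ordSl; case: (enum 'I_0) (size_enum_ord 0).
Qed.

Lemma recf_comp2 k F G H :
  recf 2 F -> recf k G -> recf k H -> recf k (fun e => F [:: G e; H e]).
Proof.
move=> HF HG HH.
apply: recf_ext (recf_comp (G := fun i => if i == ord0 then G else H) HF _) _.
  by move=> i; case: ifP.
by move=> e _; rewrite !enum_ordSl; case: (enum 'I_0) (size_enum_ord 0).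
Qed.

Lemma recf_nth k i : (i < k)%N -> recf k (fun e => nth 0%N e i).
Proof.
move=> ik; exists (RProj (Ordinal ik)) => a /=.
by rewrite (tnth_nth 0%N).
Qed.

(** Each binder extends the environment at the front, so bodies refer to outer variables through
    nested [drop]s. [is_drop] adds up their offsets; this is how [recf_tac] recognises a
    variable. *)
Definition is_drop d (s : seq nat -> seq nat) := forall e, s e = drop d e.
Lemma is_drop0 : is_drop 0 id. Proof. by move=> e; rewrite drop0. Qed.
Lemma is_dropS d d' s : is_drop d s -> is_drop (d' + d) (fun e => drop d' (s e)).
Proof. by move=> h e; rewrite h drop_drop. Qed.
Lemma recf_var k d s i : is_drop d s -> (d + i < k)%N -> recf k (fun e => nth 0%N (s e) i).
Proof. by move=> h /recf_nth H; apply: recf_ext H _ => e _; rewrite h nth_drop. Qed.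

Lemma recf_succ k F : recf k F -> recf k (fun e => (F e).+1).
Proof.
by apply: (@recf_comp1 k (fun e => (nth 0 e 0).+1)%N); exists RSucc => a /=; case: a => -[|x []].
Qed.

Lemma recf_const k c : recf k (fun=> c).
Proof. by elim: c => [|c IH]; [exists (RZero k) | apply: recf_succ]. Qed.

Lemma recf_iteri k N F (G : nat -> nat -> seq nat -> nat) :
  recf k N -> recf k F ->
  recf k.+2 (fun e => G (nth 0%N e 0) (nth 0%N e 1) (drop 2 e)) ->
  recf k (fun e => iteri (N e) (fun i z => G i z e) (F e)).
Proof.
move=> HN [f Hf] [g Hg].
have H : recf k.+1 (fun e => iteri (nth 0%N e 0) (fun i z => G i z (drop 1 e)) (F (drop 1 e))).
  exists (RPrec f g) => a; case/tupleP: a => n x /=.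
  rewrite /thead tnth0.
  (* [computes] runs over [[tuple of behead (n :: x)]], which equals [x] as a list but not by
     conversion. *)
  suff gen (t : k.-tuple nat) : t = x ->
      prec_graph (computes f t) (fun i z => computes g [tuple of i :: z :: t]) n
        (iteri n (fun i z => G i z (drop 0 x)) (F (drop 0 x))).
    by apply: gen; apply: val_inj.
  move=> ->; rewrite drop0; elim: n => [|i IH] /=; first exact: Hf.
  exists (iteri i (fun j z => G j z x) (F x)) => //.
  have := Hg [tuple of i :: iteri i (fun j z => G j z x) (F x) :: x].
  by rewrite /= drop0.
(* The family [NG] rebuilds the environment [N e :: e], on which the recursion over the first
   argument gives the claim. *)
pose NG (i : 'I_k.+1) := if unlift ord0 i is Some j then fun e => nth 0%N e (nat_of_ord j) else N.
have HNG i : recf k (NG i).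
  by rewrite /NG; case: unliftP => [j _|_] //; apply: recf_nth.
apply: recf_ext (recf_comp H HNG) _ => e se.
have E : [seq NG i e | i <- enum 'I_k.+1] = N e :: e.
  rewrite enum_ordSl /= {1}/NG unlift_none; congr cons.
  rewrite -map_comp; apply: (@eq_from_nth _ 0%N); first by rewrite size_map size_enum_ord.
  move=> i; rewrite size_map size_enum_ord => ik.
  rewrite (nth_map (Ordinal ik)) ?size_enum_ord //= /NG liftK.
  by rewrite nth_enum_ord.
by rewrite E /= drop0.
Qed.

Lemma recf_add k F G : recf k F -> recf k G -> recf k (fun e => F e + G e)%N.
Proof.
move=> HF HG; apply: recf_ext (recf_iteri (G := fun _ z _ => z.+1) HG HF _) _.
  by apply: recf_succ; apply: recf_nth.
by move=> e _; elim: (G e) => [|n /= ->]; rewrite ?addn0 ?addnS.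
Qed.

Lemma recf_pred k F : recf k F -> recf k (fun e => (F e).-1)%N.
Proof.
move=> HF; apply: recf_ext (recf_iteri (G := fun i _ _ => i) HF (recf_const k 0) _) _.
  exact: recf_nth.
by move=> e _; case: (F e).
Qed.

Lemma recf_sub k F G : recf k F -> recf k G -> recf k (fun e => F e - G e)%N.
Proof.
move=> HF HG; apply: recf_ext (recf_iteri (G := fun _ z _ => z.-1) HG HF _) _.
  by apply: recf_pred; apply: recf_nth.
by move=> e _; elim: (G e) => [|n /= ->]; rewrite ?subn0 ?subnS.
Qed.

Lemma recf_mul k F G : recf k F -> recf k G -> recf k (fun e => F e * G e)%N.
Proof.
move=> HF HG.
have H : recf 2 (fun e => nth 0 e 0 * nth 0 e 1)%N.
  apply: recf_ext (recf_iteri (N := fun e => nth 0%N e 0) (F := fun=> 0%N) (G :=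
    fun _ z e => (z + nth 0 e 1)%N) (recf_nth _) (recf_const 2 0) _) _ => //.
    apply: recf_add; first exact: recf_nth.
    by apply: (@recf_var _ 2 (drop 2)).
  by move=> e _; elim: (nth 0%N e 0) => [|n /= ->] //; rewrite mulSn addnC.
exact: recf_comp2 H HF HG.
Qed.

Lemma recf_exp k F G : recf k F -> recf k G -> recf k (fun e => F e ^ G e)%N.
Proof.
move=> HF HG.
have H : recf 2 (fun e => nth 0 e 0 ^ nth 0 e 1)%N.
  apply: recf_ext (recf_iteri (N := fun e => nth 0%N e 1) (F := fun=> 1%N) (G :=
    fun _ z e => (z * nth 0 e 0)%N) (recf_nth _) (recf_const 2 1) _) _ => //.
    apply: recf_mul; first exact: recf_nth.
    by apply: (@recf_var _ 2 (drop 2)).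
  by move=> e _; elim: (nth 0%N e 1) => [|n /= ->] //; rewrite expnSr.
exact: recf_comp2 H HF HG.
Qed.

Lemma recf_leq k F G : recf k F -> recf k G -> recf k (fun e => (F e <= G e)%N : nat).
Proof.
move=> HF HG; apply: recf_ext (recf_sub (recf_const k 1) (recf_sub HF HG)) _ => e _.
by rewrite /leq; case: (F e - G e)%N.
Qed.

Lemma recf_andb k (F G : seq nat -> bool) :
  recf k (fun e => F e : nat) -> recf k (fun e => G e : nat) ->
  recf k (fun e => F e && G e : nat).
Proof.
by move=> HF HG; apply: recf_ext (recf_mul HF HG) _ => e _; rewrite mulnb.
Qed.

Lemma recf_neg k (F : seq nat -> bool) :
  recf k (fun e => F e : nat) -> recf k (fun e => ~~ F e : nat).
Proof.
by move=> HF; apply: recf_ext (recf_sub (recf_const k 1) HF) _ => e _; case: (F e).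
Qed.

Lemma recf_eqn k F G : recf k F -> recf k G -> recf k (fun e => F e == G e : nat).
Proof.
move=> HF HG; apply: recf_ext (recf_andb (recf_leq HF HG) (recf_leq HG HF)) _ => e _.
by rewrite -eqn_leq.
Qed.

Lemma recf_sum k N (G : nat -> seq nat -> nat) :
  recf k N -> recf k.+1 (fun e => G (nth 0%N e 0) (drop 1 e)) ->
  recf k (fun e => \sum_(0 <= i < N e) G i e)%N.
Proof.
move=> HN HG.
pose G' i z e := (z + G i e)%N.
apply: recf_ext (recf_iteri (G := G') HN (recf_const k 0) _) _.
  rewrite /G'; apply: recf_add; first exact: recf_nth.
  (* The summand lives over [i :: e], the body of the recursion over [i :: z :: e]; [p] skips the
     accumulator [z]. *)
  pose p (i : 'I_k.+1) e := nth 0%N e (if i == 0 :> nat then 0 else i.+1)%N.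
  apply: recf_ext (recf_comp (G := p) HG _) _.
    by move=> i; apply: recf_nth; case: ifP => //; rewrite ltnS ltn_ord.
  move=> e se; have -> : [seq p i e | i <- enum 'I_k.+1] = nth 0%N e 0 :: drop 2 e.
    rewrite enum_ordSl /=; congr cons; rewrite -map_comp.
    apply: (@eq_from_nth _ 0%N); first by rewrite size_map size_enum_ord size_drop se; lia.
    move=> i; rewrite size_map size_enum_ord => ik.
    rewrite (nth_map (Ordinal ik)) ?size_enum_ord //= /p /= nth_enum_ord // nth_drop.
    by congr (nth _ _ _); rewrite /bump; lia.
  by rewrite /= drop0.
move=> e _; elim: (N e) => [|n /= ->]; first by rewrite big_geq.
by rewrite big_nat_recr.
Qed.

Lemma recf_all k N (G : nat -> seq nat -> bool) :
  recf k N -> recf k.+1 (fun e => G (nth 0%N e 0) (drop 1 e) : nat) ->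
  recf k (fun e => all (fun i => G i e) (iota 0 (N e)) : nat).
Proof.
move=> HN HG.
have H := recf_sum (G := fun i e => ~~ G i e : nat) HN (recf_neg HG).
apply: recf_ext (recf_eqn H (recf_const k 0)) _ => e _; congr nat_of_bool.
rewrite sum_nat_seq_eq0 /index_iota subn0; apply: eq_all => i.
by rewrite /=; case: (G i e).
Qed.

Lemma recf_has k N (G : nat -> seq nat -> bool) :
  recf k N -> recf k.+1 (fun e => G (nth 0%N e 0) (drop 1 e) : nat) ->
  recf k (fun e => has (fun i => G i e) (iota 0 (N e)) : nat).
Proof.
move=> HN HG.
have H := recf_neg (recf_all (G := fun i e => ~~ G i e) HN (recf_neg HG)).
apply: recf_ext H _ => e _; congr nat_of_bool.
by rewrite -has_predC; apply: eq_has => i /=; rewrite negbK.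
Qed.

(** With a difference of two recursive functions no case distinction on signs arises: sums and
    products keep this form, and [F = G] is tested as [P + N' = P' + N]. *)
Definition zrecf k (F : seq nat -> int) : Prop :=
  exists P N : seq nat -> nat, [/\ recf k P, recf k N & forall e, F e = (P e)%:Z - (N e)%:Z].

Lemma zrecf_nat k F : recf k F -> zrecf k (fun e => (F e)%:Z).
Proof. by move=> H; exists F, (fun=> 0%N); split=> //; [exact: recf_const | move=> e;
  rewrite subr0]. Qed.

Lemma zrecf_add k F G : zrecf k F -> zrecf k G -> zrecf k (fun e => F e + G e).
Proof.
move=> [P [N [HP HN E]]] [P' [N' [HP' HN' E']]].
exists (fun e => P e + P' e)%N, (fun e => N e + N' e)%N; split; try exact: recf_add.
by move=> e; rewrite E E'; lia.
Qed.

Lemma zrecf_mul k F G : zrecf k F -> zrecf k G -> zrecf k (fun e => F e * G e).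
Proof.
move=> [P [N [HP HN E]]] [P' [N' [HP' HN' E']]].
exists (fun e => P e * P' e + N e * N' e)%N, (fun e => P e * N' e + N e * P' e)%N.
split; try by apply: recf_add; apply: recf_mul.
by move=> e; rewrite E E' !PoszD !PoszM; ring.
Qed.

Lemma zrecf_sum k N (G : nat -> seq nat -> int) :
  recf k N -> zrecf k.+1 (fun e => G (nth 0%N e 0) (drop 1 e)) ->
  zrecf k (fun e => \sum_(0 <= i < N e) G i e).
Proof.
move=> HN [P [M [HP HM E]]].
have drop_cons (F : seq nat -> nat) : recf k.+1 F ->
    recf k.+1 (fun e => F (nth 0%N e 0 :: drop 1 e)).
  by move=> HF; apply: recf_ext HF _ => -[] //= x e; rewrite drop0.
exists (fun e => \sum_(0 <= i < N e) P (i :: e))%N, (fun e => \sum_(0 <= i < N e) M (i :: e))%N.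
split.
- exact: (recf_sum (G := fun i e => P (i :: e)) HN (drop_cons _ HP)).
- exact: (recf_sum (G := fun i e => M (i :: e)) HN (drop_cons _ HM)).
move=> e; rewrite !(raddf_sum Posz) -sumrB; apply: eq_bigr => i _.
by have /= := E (i :: e); rewrite drop0 => ->.
Qed.

Lemma recf_eqz k F G : zrecf k F -> zrecf k G -> recf k (fun e => F e == G e : nat).
Proof.
move=> [P [N [HP HN E]]] [P' [N' [HP' HN' E']]].
apply: recf_ext (recf_eqn (recf_add HP HN') (recf_add HP' HN)) _ => e _.
by rewrite E E'; congr nat_of_bool; lia.
Qed.

Definition rec1 (f : nat -> nat) := recf 1 (fun e => f (nth 0%N e 0)).
Definition rec2 (f : nat -> nat -> nat) := recf 2 (fun e => f (nth 0%N e 0) (nth 0%N e 1)).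

Lemma recf_app1 k f F : rec1 f -> recf k F -> recf k (fun e => f (F e)).
Proof. by move=> Hf; apply: (recf_comp1 Hf). Qed.
Lemma recf_app2 k f F G : rec2 f -> recf k F -> recf k G -> recf k (fun e => f (F e) (G e)).
Proof. by move=> Hf; apply: (recf_comp2 Hf). Qed.

Ltac is_drop_tac := first [exact: is_drop0 | apply: is_dropS; is_drop_tac].
Ltac recf_var_tac := apply: recf_var; [is_drop_tac | done].
Ltac recf_tac :=
  first
  [ assumption
  | exact: recf_const
  | recf_var_tac
  | apply: recf_app1; [assumption | recf_tac]
  | apply: recf_succ; recf_tac
  | apply: recf_add; recf_tac
  | apply: recf_mul; recf_tac
  | apply: recf_exp; recf_tac
  | apply: recf_sub; recf_tac
  | apply: recf_eqn; recf_tac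
  | apply: recf_sum; recf_tac ].

Lemma rec2_iter f : rec1 f -> rec2 (fun n x => iter n f x).
Proof.
move=> Hf; rewrite /rec2.
apply: recf_ext (recf_iteri (N := fun e => nth 0%N e 0) (F := fun e => nth 0%N e 1) (G :=
  fun _ z _ => f z) _ _ _) _; try recf_tac.
by move=> e _; elim: (nth 0%N e 0) => //= n ->.
Qed.

(* The class of the bounds: each lemma below bounds what it constructs by such a
   function of one number [s] that majorizes all dimensions and entries. *)
Definition mfun (f : nat -> nat) := rec1 f /\ {homo f : m n / (m <= n)%N}.

Lemma mf_const c : mfun (fun=> c).
Proof. by split; [exact: recf_const|]. Qed.
Lemma mf_id : mfun (fun s => s).
Proof. by split=> //; rewrite /rec1; recf_tac. Qed.
Lemma mf_add f g : mfun f -> mfun g -> mfun (fun s => f s + g s)%N.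
Proof.
move=> [Hf mf] [Hg mg]; split; first exact: recf_add.
by move=> m n mn; apply: leq_add; auto.
Qed.
Lemma mf_mul f g : mfun f -> mfun g -> mfun (fun s => f s * g s)%N.
Proof.
move=> [Hf mf] [Hg mg]; split; first exact: recf_mul.
by move=> m n mn; apply: leq_mul; auto.
Qed.
(** The base is [(f s).+1] because [x ^ y] increases with [y] only for [x > 0]. *)
Lemma mf_exp f g : mfun f -> mfun g -> mfun (fun s => (f s).+1 ^ g s)%N.
Proof.
move=> [Hf mf] [Hg mg]; split; first by apply: recf_exp => //; apply: recf_succ.
move=> m n mn; apply: (@leq_trans ((f n).+1 ^ g m)).
  by case: (g m) => // k; rewrite leq_exp2r // ltnS mf.
by rewrite leq_pexp2l // mg.
Qed.
Lemma mf_comp f g : mfun f -> mfun g -> mfun (fun s => f (g s)).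
Proof. by move=> [Hf mf] [Hg mg]; split; [exact: (recf_app1 Hf Hg) | move=> m n mn; apply: mf;
  apply: mg]. Qed.
(** The condition [n <= f n] yields monotonicity in the number of iterations. *)
Lemma mf_iter f g h : mfun f -> (forall n, (n <= f n)%N) -> mfun g -> mfun h ->
  mfun (fun s => iter (g s) f (h s)).
Proof.
move=> [Hf mf] lf [Hg mg] [Hh mh]; split.
  exact: (recf_app2 (rec2_iter Hf) Hg Hh).
move=> m n mn; apply: (@leq_trans (iter (g m) f (h n))).
  by elim: (g m) => /= [|i IH]; [exact: mh | exact: mf].
have [d ->] : exists d, g n = (d + g m)%N.
  by exists (g n - g m)%N; rewrite subnK // mg.
by rewrite iterD; elim: d => //= d IH; apply: leq_trans IH (lf _).
Qed.
Lemma mf_succ f : mfun f -> mfun (fun s => (f s).+1).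
Proof. by move=> [Hf mf]; split=> [|m n mn]; [exact: recf_succ | rewrite ltnS mf]. Qed.
Lemma mf_exp2 f : mfun f -> mfun (fun s => 2 ^ f s)%N.
Proof. by move=> mf; exact: mf_exp (mf_const 1) mf. Qed.

Ltac mf_tac :=
  first
  [ assumption
  | exact: mf_id
  | exact: mf_const
  | apply: mf_add; mf_tac
  | apply: mf_mul; mf_tac
  | apply: mf_succ; mf_tac
  | apply: mf_exp2; mf_tac
  | apply: mf_exp; mf_tac
  | match goal with |- mfun (fun s => ?f (@?g s)) => apply: (@mf_comp f g); mf_tac end ].

(* Head and tail of a coded list, by searching for the decomposition
   [CodeSeq.code (n :: s) = 2 ^ n * (2 * CodeSeq.code s + 1)]. *)
Definition hdc c := (\sum_(0 <= n < c) \sum_(0 <= d < c) n * (2 ^ n * (d * 2 + 1) == c))%N.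
Definition tlc c := (\sum_(0 <= n < c) \sum_(0 <= d < c) d * (2 ^ n * (d * 2 + 1) == c))%N.
Definition nthc w i := hdc (iter i tlc w).

Lemma rec1_hdc : rec1 hdc.
Proof. by rewrite /rec1 /hdc; recf_tac. Qed.
Lemma rec1_tlc : rec1 tlc.
Proof. by rewrite /rec1 /tlc; recf_tac. Qed.
Lemma rec2_nthc : rec2 nthc.
Proof.
have H1 := rec1_hdc; have H2 := rec2_iter rec1_tlc.
rewrite /rec2 /nthc; apply: (recf_app1 H1).
by apply: (@recf_app2 2 (fun n x => iter n tlc x)) => //; recf_tac.
Qed.

(** A number is in only one way a power of two times an odd number, which is used here as
    injectivity of [CodeSeq.code]; so a single term of the double sum survives. *)
Lemma code_cons_sum (F : nat -> nat -> nat) n s :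
  let c := CodeSeq.code (n :: s) in
  (\sum_(0 <= i < c) \sum_(0 <= d < c) F i d * (2 ^ i * (d * 2 + 1) == c))%N = F n (CodeSeq.code s).
Proof.
move=> c.
have ltc := CodeSeq.ltn_code (n :: s).
have nc : (n < c)%N by case/andP: ltc.
have sc : (CodeSeq.code s < c)%N.
  rewrite /c /=; apply: (@leq_trans (1 * (CodeSeq.code s).*2.+1)%N).
    by rewrite mul1n ltnS -addnn leq_addr.
  by rewrite leq_mul2r expn_gt0.
under eq_bigr do rewrite big_mkord.
rewrite big_mkord (bigD1 (Ordinal nc)) //= (bigD1 (Ordinal sc)) //=.
have uniq_code i d : (2 ^ i * (d * 2 + 1) == c)%N -> i = n /\ d = CodeSeq.code s.
  move/eqP/(congr1 CodeSeq.decode); rewrite muln2 addn1 -{1}(CodeSeq.decodeK d).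
  rewrite (CodeSeq.codeK (i :: CodeSeq.decode d)) (CodeSeq.codeK (n :: s)) => -[-> <-].
  by rewrite CodeSeq.decodeK.
rewrite muln2 addn1 eqxx muln1 !big1 ?addn0 // => [i In|d dn].
  rewrite big1 // => d _; have [/uniq_code[E _]|_] := boolP (_ == c); last by rewrite muln0.
  by case/eqP: In; apply: val_inj.
have [/uniq_code[_ E]|_] := boolP (_ == c); last by rewrite muln0.
by case/eqP: dn; apply: val_inj.
Qed.

(** The code [0] of the empty list has head and tail [0], so reading past the end yields the default
    [0] of [nth]. *)
Lemma nthc_code s i : nthc (CodeSeq.code s) i = nth 0%N s i.
Proof.
rewrite /nthc; elim: s i => [|n s IH] i.
  rewrite nth_nil /=; have -> : iter i tlc 0 = 0%N by elim: i => //= i ->; rewrite /tlc big_geq.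
  by rewrite /hdc big_geq.
case: i => [|i]; first by rewrite /= /hdc (code_cons_sum (fun n _ => n)).
by rewrite iterSr {2}/tlc (code_cons_sum (fun _ d => d)) IH.
Qed.

(** The recursion of [CodeSeq.code] in the worst case, [n] entries below [b]. The final [+ 1] makes
    the bound strict, so that such bounds can be nested. *)
Definition maxcode b n := iter n (fun W => 2 ^ b * (W * 2 + 1) + 1)%N 1%N.

Lemma code_lt_max b n s : (size s <= n)%N -> all (fun x => x < b)%N s ->
  (CodeSeq.code s < maxcode b n)%N.
Proof.
elim: n s => [|n IH] [|x s] //= sn; first by rewrite addn1.
case/andP=> xb sb; rewrite addn1 ltnS.
apply: leq_mul; first by rewrite leq_exp2l // ltnW.
by have := IH s sn sb; rewrite -/(maxcode b n); lia.
Qed.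

Lemma rec2_maxcode : rec2 maxcode.
Proof.
rewrite /rec2.
apply: recf_ext (recf_iteri (N := fun e => nth 0%N e 1) (F := fun=> 1%N) (G :=
  fun _ z e => 2 ^ nth 0 e 0 * (z * 2 + 1) + 1)%N _ _ _) _; try recf_tac.
by move=> e _; rewrite /maxcode; elim: (nth 0%N e 1) => //= n ->.
Qed.

Lemma leq_abszD (x y : int) : (`|(x + y)%R| <= `|x| + `|y|)%N.
Proof. lia. Qed.

(** * Bounded solutions of integer linear systems *)

Lemma absz_sum (I : Type) (r : seq I) (P : pred I) (F : I -> int) :
  (`|(\sum_(i <- r | P i) F i)%R| <= \sum_(i <- r | P i) `|F i|)%N.
Proof.
elim/big_ind2: _ => // x m y n xm yn.
exact: leq_trans (leq_abszD x y) (leq_add xm yn).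
Qed.

Definition mxle s m n (A : 'M[int]_(m, n)) := forall i j, (`|A i j| <= s)%N.

Lemma mxleW s t m n (A : 'M[int]_(m, n)) : mxle s A -> (s <= t)%N -> mxle t A.
Proof. by move=> sA st i j; apply: leq_trans (sA i j) st. Qed.

Lemma mxle_mul a b m n p (A : 'M[int]_(m, n)) (B : 'M[int]_(n, p)) :
  mxle a A -> mxle b B -> mxle (n * (a * b)) (A *m B).
Proof.
move=> hA hB i j; rewrite mxE; apply: leq_trans (absz_sum _ _ _) _.
apply: (@leq_trans (\sum_(k < n) a * b)); last by rewrite sum_nat_const card_ord.
by apply: leq_sum => k _; rewrite abszM; apply: leq_mul.
Qed.

Lemma mxle_add a b m n (A B : 'M[int]_(m, n)) :
  mxle a A -> mxle b B -> mxle (a + b) (A + B).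
Proof. by move=> hA hB i j; rewrite mxE; apply: leq_trans (leq_abszD _ _) (leq_add (hA i j) (hB i
  j)). Qed.

Lemma mxle_opp a m n (A : 'M[int]_(m, n)) : mxle a A -> mxle a (- A).
Proof. by move=> hA i j; rewrite mxE abszN. Qed.

Lemma mxle_sub a b m n (A B : 'M[int]_(m, n)) :
  mxle a A -> mxle b B -> mxle (a + b) (A - B).
Proof. by move=> hA hB; apply/mxle_add/mxle_opp. Qed.

Lemma mxle0 s m n : mxle s (0 : 'M_(m, n)).
Proof. by move=> i j; rewrite mxE. Qed.

Lemma mxle1 n : mxle 1 (1%:M : 'M_n).
Proof. by move=> i j; rewrite mxE; case: eqP. Qed.

Lemma mxle_perm n (s : 'S_n) : mxle 1 (perm_mx s).
Proof. by move=> i j; rewrite !mxE; case: eqP. Qed.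

Lemma mxle_det n a (A : 'M[int]_n) : mxle a A -> (`|(\det A)%R| <= n`! * a ^ n)%N.
Proof.
move=> hA; rewrite /determinant; apply: leq_trans (absz_sum _ _ _) _.
rewrite -{1}card_Sn -sum_nat_const; apply: leq_sum => /= s _.
rewrite abszM abszX /= exp1n mul1n.
have -> : (a ^ n = \prod_(i < n) a)%N by rewrite prod_nat_const card_ord.
elim/big_ind2: _ => // x m y k xm yk; rewrite abszM; exact: leq_mul.
Qed.

Definition adj_bound s := (s`! * s.+1 ^ s)%N.

Lemma mxle_adj n s a (A : 'M[int]_n) :
  (n <= s)%N -> (a <= s)%N -> mxle a A -> mxle (adj_bound s) (\adj A).
Proof.
move=> ns as_ hA i j; rewrite mxE /cofactor abszM abszX /= exp1n mul1n.
apply: leq_trans (mxle_det (a := a) _) _.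
  by move=> k l; rewrite !mxE.
case: n ns A hA i j => [|n] ns A hA i j; first by case: i.
apply: leq_mul; first by apply: leq_fact; apply: ltnW.
apply: (@leq_trans (s.+1 ^ n)%N); first by case: n {A hA i j ns} => // n; rewrite leq_exp2r // ltnW.
by rewrite leq_pexp2l //; apply: ltnW.
Qed.

Lemma mxle_detS n s a (A : 'M[int]_n) :
  (n <= s)%N -> (a <= s)%N -> mxle a A -> (`|(\det A)%R| <= adj_bound s)%N.
Proof.
move=> ns as_ /mxle_det/leq_trans; apply; apply: leq_mul; first exact: leq_fact.
apply: (@leq_trans (s.+1 ^ n)%N); first by case: n {A ns} => // n; rewrite leq_exp2r // ltnW.
by rewrite leq_pexp2l.
Qed.

(** The inverse is the adjugate up to sign. The summand [a] covers the matrices that are not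
    invertible, which [invmx] returns unchanged. *)
Lemma mxle_inv n s a (A : 'M[int]_n) :
  (n <= s)%N -> (a <= s)%N -> mxle a A -> mxle (adj_bound s + a) (invmx A).
Proof.
move=> ns as_ hA i j; rewrite /invmx; case: ifP => uA; last first.
  by apply: leq_trans (hA i j) _; rewrite leq_addl.
rewrite mxE abszM.
have -> : `|((\det A)^-1)%R|%N = 1%N.
  have : (\det A)^-1 \is a GRing.unit by rewrite unitrV -unitmxE.
  by rewrite unfold_in => /orP[] /eqP ->.
by rewrite mul1n; apply: leq_trans (mxle_adj ns as_ hA i j) _; rewrite leq_addr.
Qed.

Lemma mf_fact f : mfun f -> mfun (fun s => (f s)`!).
Proof.
move=> [Hf mf]; split; last by move=> m n mn; apply/leq_fact/mf.
have H : rec1 (fun s => s`!).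
  rewrite /rec1.
  apply: recf_ext (recf_iteri (N := fun e => nth 0%N e 0) (F := fun=> 1%N)
    (G := fun i z e => i.+1 * z)%N _ _ _) _; try recf_tac.
  by move=> e _; elim: (nth 0%N e 0) => //= n ->.
exact: (recf_app1 H Hf).
Qed.

Lemma mf_adj_bound f : mfun f -> mfun (fun s => adj_bound (f s)).
Proof.
move=> hf; rewrite /adj_bound; apply: mf_mul; first exact: mf_fact.
exact: mf_exp.
Qed.

Lemma elementary_unit n (i j : 'I_n) (c : int) : i != j ->
  (1%:M + c *: delta_mx i j : 'M[int]_n) \in unitmx.
Proof.
move=> ij; suff E : (1%:M + c *: delta_mx i j) *m (1%:M - c *: delta_mx i j) = 1%:M :> 'M[int]_n.
  by have := mulmx1_unit E => -[].
rewrite mulmxDl mul1mx mulmxBr mulmx1 -scalemxAl -scalemxAr mul_delta_mx_0 1?eq_sym //.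
by rewrite !scaler0 subr0 addrNK.
Qed.

Lemma absz_reduce (x y : int) : x != 0 -> y != 0 -> (`|y| <= `|x|)%N ->
  exists c : int, (`|c| <= 1)%N /\ (`|(x + c * y)%R| < `|x|)%N.
Proof.
move=> x0 y0 yx; exists (if (0 <= x) == (0 <= y) then -1 else 1).
by case: (lerP 0 x) => hx; case: (lerP 0 y) => hy /=; split=> //; lia.
Qed.

(* Euclid's algorithm by subtractions on the entries of a column. *)
Lemma column_euclid q m (a : 'cV[int]_q) : (\sum_i `|a i ord0| <= m)%N ->
  exists L : 'M[int]_q, [/\ L \in unitmx, mxle (q.+1 ^ m) L &
    forall i j, (L *m a) i ord0 != 0 -> (L *m a) j ord0 != 0 -> i = j].
Proof.
elim: m a => [|m IH] a ha.
  exists 1%:M; split; [exact: unitmx1 | exact: mxle1 |] => i j.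
  move: ha; rewrite leqn0 sum_nat_eq0 => /forallP/(_ i)/=.
  by rewrite mul1mx absz_eq0 => ->.
have [/existsP[i /existsP[j]]|no] := boolP [exists i, exists j,
    [&& i != j, a i ord0 != 0, a j ord0 != 0 & (`|a j ord0| <= `|a i ord0|)%N]].
  case/and4P => ij ai aj aji.
  have [c [c1 lt]] := absz_reduce ai aj aji.
  pose E := 1%:M + c *: delta_mx i j : 'M[int]_q.
  have Ea k : (E *m a) k ord0 = a k ord0 + (if k == i then c * a j ord0 else 0).
    rewrite mulmxDl mul1mx -scalemxAl !mxE.
    rewrite (bigD1 j) //= big1 ?addr0 => [|l lj]; last by rewrite mxE (negPf lj) andbF mul0r.
    by rewrite mxE eqxx andbT; case: eqP => _; rewrite ?mul1r ?mul0r ?mulr0.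
  have [|L [uL bL hL]] := IH (E *m a).
    rewrite (bigD1 i) //= Ea eqxx.
    rewrite (bigD1 i) //= in ha.
    under eq_bigr => k ki do rewrite Ea (negPf ki) addr0.
    by move: ha lt; lia.
  exists (L *m E); split.
  - by rewrite unitmx_mul uL elementary_unit.
  - move=> k l.
    (* Right multiplication by [E] adds [c] times column [i] to column [j], with [c] at most [1] in
       absolute value. Entries at most double, and [2 <= q.+1] because [q > 0]. *)
    have bE : forall k l, (`|(L *m E) k l| <= `|L k l| + `|L k i|)%N.
      move=> k' l'; rewrite mulmxDr mulmx1 -scalemxAr !mxE.
      have -> : \sum_j0 L k' j0 * delta_mx i j j0 l' = if l' == j then L k' i else 0.
        rewrite (bigD1 i) //= big1 ?addr0 => [|h hi]; last by rewrite mxE (negPf hi) mulr0.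
        by rewrite mxE eqxx /=; case: eqP; rewrite ?mulr1 ?mulr0.
      case: eqP => _; last by rewrite mulr0 addr0 leq_addr.
      apply: leq_trans (leq_abszD _ _) (leq_add (leqnn _) _).
      by rewrite abszM; case: (`|c|)%N c1 => [|[]] // _; rewrite mul1n.
    apply: leq_trans (bE k l) _.
    have := bL k l; have := bL k i; rewrite expnS.
    have : (0 < q)%N by apply: leq_ltn_trans (ltn_ord i).
    by nia.
  - by move=> k l; rewrite -!mulmxA; exact: hL.
exists 1%:M; split; [exact: unitmx1 | |].
  by apply: (mxleW (@mxle1 _)); rewrite expn_gt0.
move=> i j; rewrite mul1mx => ai aj; apply/eqP/negPn/negP => ij.
case/existsP: no; have [le|/ltnW le] := leqP `|a j ord0| `|a i ord0|.
  by exists i; apply/existsP; exists j; rewrite ij ai aj.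
by exists j; apply/existsP; exists i; rewrite eq_sym ij ai aj.
Qed.

Lemma column_reduce s q (a : 'cV[int]_(1 + q)) : (1 + q <= s)%N -> mxle s a ->
  exists L : 'M[int]_(1 + q), [/\ L \in unitmx, mxle (s * s.+1 ^ (s * s)) L & dsubmx (L *m a) = 0].
Proof.
move=> qs sa.
have [|L [uL bL hL]] := @column_euclid (1 + q) (s * s) a.
  apply: (@leq_trans (\sum_(i < 1 + q) s)); first by apply: leq_sum.
  by rewrite sum_nat_const card_ord leq_mul2r qs orbT.
pose i0 := odflt ord0 [pick i | (L *m a) i ord0 != 0].
have hi0 i : i != i0 -> (L *m a) i ord0 = 0.
  rewrite /i0; case: pickP => /= [k hk|no] ik; last by have /negbFE/eqP := no i.
  by apply/eqP/negPn/negP => /hL /(_ hk) /eqP; rewrite (negPf ik).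
exists (tperm_mx ord0 i0 *m L); split.
- by rewrite unitmx_mul uL unitmx_perm.
- apply: (mxleW (mxle_mul (@mxle_perm _ _) bL)); rewrite mul1n; apply: leq_mul => //.
  by case: (s * s)%N => // k; rewrite leq_exp2r.
apply/matrixP => i j; rewrite -mulmxA -row_permE 2!mxE [RHS]mxE ord1.
apply: hi0; apply/eqP => /(congr1 (tperm ord0 i0)); rewrite tpermK tpermR.
by move/(congr1 val).
Qed.

Definition col_bound s := (s * s.+1 ^ (s * s))%N.
(** The sum of all bounds needed in one elimination step: for the matrix with its first column
    cleared, for the product of two transformations and, as last summand, for a combination of rows
    after the contribution of the pivot row is subtracted. *)
Definition ech_step x :=
  (x.+1 + x * (col_bound x * x) + x * (x * x) + col_bound x + (x + x * (x * (col_bound x * x))))%N.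

Lemma mf_ech_step f : mfun f -> mfun (fun s => ech_step (f s)).
Proof.
move=> hf; apply: (@mf_comp ech_step) => //.
by rewrite /ech_step /col_bound; mf_tac.
Qed.

Lemma leq_ech_step x : (x <= ech_step x)%N.
Proof. by rewrite /ech_step; lia. Qed.

Lemma leq_iter (f : nat -> nat) n x : (forall y, (y <= f y)%N) -> (x <= iter n f x)%N.
Proof. by move=> hf; elim: n => //= n IH; apply: leq_trans IH (hf _). Qed.

(** The last clause is the echelon shape in quantitative form: by substitution, the coefficients at
    the first [r] rows are bounded in terms of the combination of rows itself. *)
Definition echelon_spec b (h : nat -> nat) (s q p : nat) (A : 'M[int]_(q,
    p)) (L : 'M[int]_q) (r : nat) :=
  [/\ L \in unitmx, mxle b L, (forall (i : 'I_q) j, (r <= i)%N -> (L *m A) i j = 0) &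
   forall u (w : 'rV[int]_q), (s <= u)%N -> mxle u (w *m (L *m A)) ->
     forall i : 'I_q, (i < r)%N -> (`|w 0%R i| <= h u)%N].

Lemma mono_ech_step : {homo ech_step : x y / (x <= y)%N}.
Proof. by have [] := mf_ech_step mf_id. Qed.

(** Induction on the columns. Each column costs one [ech_step] before and one after the recursive
    call, whence [p.*2]. *)
Lemma echelon p s q (A : 'M[int]_(q, p)) : (q <= s)%N -> mxle s A ->
  exists L r, echelon_spec (iter p.*2 ech_step s) (iter p.*2 ech_step) s A L r.
Proof.
elim: p s q A => [|p IH] s q A qs sA.
  exists 1%:M, 0%N; split; [exact: unitmx1 | | by move=> i j; have := ltn_ord j; rewrite ltn0 |
    by []].
    move=> i j; apply: leq_trans (@mxle1 _ i j) _.
    by apply: leq_trans qs; apply: leq_ltn_trans (ltn_ord i).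
case: q qs A sA => [|q] qs A sA.
  have no (i : 'I_0) : False by have := ltn_ord i; rewrite ltn0.
  exists 1%:M, 0%N; split; [exact: unitmx1 | | | ].
  - by move=> i; case: (no i).
  - by move=> i; case: (no i).
  - by move=> u w _ _ i; case: (no i).
change (is_true (1 + q <= s)%N) in qs; move: A sA.
change (forall A : 'M[int]_(1 + q, 1 + p), mxle s A -> exists (L : 'M[int]_(1 + q)) r,
  echelon_spec (iter p.+1.*2 ech_step s) (iter p.+1.*2 ech_step) s A L r) => A sA.
have [|L1 [uL1 bL1 hL1]] := @column_reduce s q (lsubmx A) qs.
  by move=> i j; rewrite mxE.
have [A1 eA1] : exists A1, A1 = L1 *m A by exists (L1 *m A).
have sA1 : mxle (s * (col_bound s * s)) A1.
  by rewrite eA1 => i j; apply: leq_trans (mxle_mul bL1 sA i j) _; rewrite leq_mul2r qs orbT.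
have ls1 : (s * (col_bound s * s) <= ech_step s)%N by rewrite /ech_step; lia.
have ss1 : (s <= ech_step s)%N := leq_ech_step s.
have dl0 : dlsubmx A1 = 0.
  by rewrite -hL1 eA1; apply/matrixP => i j; rewrite !mxE; apply: eq_bigr => k _; rewrite !mxE.
have A1E : A1 = block_mx (ulsubmx A1) (ursubmx A1) 0 (drsubmx A1).
  by rewrite -dl0 submxK.
pose F := iter p.*2 ech_step (ech_step s).
have FE : iter p.+1.*2 ech_step s = ech_step F.
  by rewrite doubleS iterS iterSr.
have FE' u : iter p.+1.*2 ech_step u = ech_step (iter p.*2 ech_step (ech_step u)).
  by rewrite doubleS iterS iterSr.
have sF : (ech_step s <= F)%N by apply: leq_iter; exact: leq_ech_step.
have bL (L2 : 'M[int]_(1 + q)) : mxle F L2 -> mxle (iter p.+1.*2 ech_step s) (L2 *m L1).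
  move=> bL2 i j; apply: leq_trans (mxle_mul bL2 bL1 i j) _; rewrite FE.
  apply: (@leq_trans (F * (F * F))%N); last by rewrite /ech_step; lia.
  apply: leq_mul; first by apply: leq_trans qs (leq_trans ss1 sF).
  rewrite leq_mul2l; apply/orP; right; apply: leq_trans sF.
  by rewrite -/(col_bound s) /ech_step; lia.
(* Without a pivot the whole first column vanishes and all rows are passed on; with a pivot the
   first row is set aside. *)
have [d0|d0] := eqVneq (A1 ord0 ord0) 0.
  have ul0 : ulsubmx A1 = 0.
    by apply/matrixP => i j; rewrite !mxE !ord1 -[RHS]d0; congr (A1 _ _); apply: val_inj.
  have A1E' : A1 = row_mx 0 (rsubmx A1).
    rewrite -[LHS]hsubmxK; congr row_mx.
    by rewrite A1E ul0 block_mxEh row_mxKl col_mx0.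
  have [||L2 [r [uL2 bL2 z2 w2]]] := IH (ech_step s) _ (rsubmx A1).
  - exact: leq_trans qs ss1.
  - by move=> i j; rewrite mxE; apply: leq_trans (sA1 _ _) ls1.
  exists (L2 *m L1), r.
  have LE : L2 *m L1 *m A = row_mx 0 (L2 *m rsubmx A1).
    by rewrite -mulmxA -eA1 {1}A1E' mul_mx_row mulmx0.
  split; [by rewrite unitmx_mul uL2 | exact: bL | |].
    move=> i j ri; rewrite LE -(splitK j); case: (split j) => k /=.
      by rewrite row_mxEl mxE.
    by rewrite row_mxEr z2.
  move=> u w su; rewrite LE mul_mx_row mulmx0 => hu i ir.
  rewrite FE'; apply: leq_trans (leq_ech_step _).
  apply: (w2 (ech_step u) w) => //; first exact: mono_ech_step.
  move=> k l; have := hu k (rshift 1 l); rewrite row_mxEr => /leq_trans; apply.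
  exact: leq_ech_step.
have [||L2 [r [uL2 bL2 z2 w2]]] := IH (ech_step s) _ (drsubmx A1).
- by apply: leq_trans ss1; apply: leq_trans qs; rewrite leq_addl.
- by move=> i j; rewrite !mxE; apply: leq_trans (sA1 _ _) ls1.
exists (block_mx 1%:M 0 0 L2 *m L1), r.+1.
have LE : block_mx 1%:M 0 0 L2 *m L1 *m A =
    block_mx (ulsubmx A1) (ursubmx A1) 0 (L2 *m drsubmx A1).
  by rewrite -mulmxA -eA1 {1}A1E mulmx_block !mul1mx !mul0mx !mulmx0 !addr0 !add0r.
rewrite /echelon_spec; split.
- by rewrite unitmx_mul uL1 andbT unitmxE det_ublock det1 mul1r -unitmxE.
- apply: bL => i j; rewrite -(splitK i) -(splitK j).
  have F1 : (0 < F)%N by apply: leq_trans sF; rewrite /ech_step.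
  case: (split i) => k; case: (split j) => l /=;
    rewrite ?block_mxEul ?block_mxEur ?block_mxEdl ?block_mxEdr ?[(0 : 'M_(_, _)) _ _]mxE //.
  by apply: leq_trans F1; exact: mxle1.
- move=> i j; rewrite LE -(splitK i) -(splitK j).
  case: (split i) => k /=; first by rewrite ord1.
  rewrite add1n ltnS => rk.
  by case: (split j) => l /=; rewrite ?block_mxEdl ?block_mxEdr ?z2 // mxE.
move=> u w su; rewrite LE -{1}(hsubmxK w) mul_row_block mulmx0 addr0 => hu i.
(* The first entry of the product is this coefficient times the pivot, a nonzero integer. *)
have w0 : (`|w 0%R (lshift q (@ord0 0))| <= u)%N.
  have := hu 0 (lshift p (@ord0 0)); rewrite row_mxEl mxE big_ord_recl big_ord0 addr0.
  rewrite abszM; apply: leq_trans.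
  rewrite mxE leq_pmulr // !mxE absz_gt0; apply: contraNneq d0 => <-.
  by apply/eqP; congr (A1 _ _); apply: val_inj.
rewrite FE' -(splitK i); case: (split i) => k /=.
  rewrite (ord1 k) => _; apply: leq_trans w0 _.
  apply: leq_trans (leq_ech_step _).
  apply: leq_trans (leq_ech_step u) _; exact/leq_iter/leq_ech_step.
rewrite add1n ltnS => kr; apply: leq_trans (leq_ech_step _).
have -> : w 0 (rshift 1 k) = rsubmx w 0 k by rewrite mxE.
apply: (w2 (ech_step u) (rsubmx w)) => //; first exact: mono_ech_step.
move=> a b; have := hu a (rshift 1 b); rewrite row_mxEr => hab.
have gen (X Y : 'M[int]_(1, p)) : Y a b = (X + Y) a b - X a b by rewrite mxE addrAC subrr add0r.
rewrite (gen (lsubmx w *m ursubmx A1)).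
apply: leq_trans (leq_abszD _ _) _; rewrite abszN.
apply: leq_trans (leq_add hab (leqnn _)) _.
have : (`|((lsubmx w *m ursubmx A1) a b)%R| <= u * (u * (col_bound u * u)))%N.
  rewrite mxE big_ord_recl big_ord0 addr0 abszM; apply: leq_mul.
    by rewrite mxE (ord1 a).
  rewrite !mxE; apply: leq_trans (sA1 _ _) _; apply: leq_mul => //; apply: leq_mul => //.
  rewrite /col_bound; apply: leq_mul => //.
  apply: (@leq_trans (s.+1 ^ (u * u))); first by apply: leq_pexp2l => //; apply: leq_mul.
  by case: (u * u)%N => // n; rewrite leq_exp2r.
by move=> h; apply: leq_trans (leq_add (leqnn u) h) _; rewrite /ech_step; lia.
Qed.

Definition ech_bound s := (iter s.*2 ech_step s + (adj_bound (s + iter s.*2 ech_step s) + iter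
    s.*2 ech_step s))%N.

Lemma mf_ech_bound f : mfun f -> mfun (fun s => ech_bound (f s)).
Proof.
move=> hf; apply: (@mf_comp ech_bound) => //.
have h : mfun (fun s => iter s.*2 ech_step s).
  apply: mf_iter; [exact: mf_ech_step mf_id | exact: leq_ech_step | | exact: mf_id].
  by have [h1 h2] := mf_add mf_id mf_id; split=> [|m n mn]; [apply: recf_ext h1 _ => e _;
    rewrite addnn | rewrite -!addnn; exact: h2].
rewrite /ech_bound; apply: mf_add => //; apply: mf_add => //.
by apply: mf_adj_bound; apply: mf_add => //; exact: mf_id.
Qed.

Lemma echelonS s q p (A : 'M[int]_(q, p)) :
  (q <= s)%N -> (p <= s)%N -> mxle s A ->
  exists (L : 'M[int]_q) (r : nat), [/\ [/\ L \in unitmx, (r <= q)%N,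
    mxle (ech_bound s) L & mxle (ech_bound s) (invmx L)],
    forall (i : 'I_q) j, (r <= i)%N -> (L *m A) i j = 0,
    (forall w : 'rV[int]_q, mxle s (w *m (L *m A)) ->
       forall i : 'I_q, (i < r)%N -> (`|w 0%R i| <= ech_bound s)%N) &
    (forall w : 'rV[int]_q, w *m (L *m A) = 0 -> forall i : 'I_q, (i < r)%N -> w 0 i = 0)].
Proof.
move=> qs ps sA; have [L [r [uL bL zL wL]]] := echelon qs sA.
have pE : (iter p.*2 ech_step s <= iter s.*2 ech_step s)%N.
  have [d ->] : exists d, s.*2 = (d + p.*2)%N by exists (s.*2 - p.*2)%N;
    rewrite subnK // leq_double.
  by rewrite iterD; apply: leq_iter; exact: leq_ech_step.
have bL' := mxleW bL pE.
have wL' (w : 'rV[int]_q) : mxle s (w *m (L *m A)) ->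
    forall i : 'I_q, (i < r)%N -> (`|w 0%R i| <= iter s.*2 ech_step s)%N.
  by move=> hw i ir; apply: leq_trans (wL s w (leqnn s) hw i ir) pE.
exists L, (minn r q); split.
- split=> //; first exact: geq_minr.
    by apply: (mxleW bL'); rewrite leq_addr.
  apply: (mxleW (mxle_inv (s := s + iter s.*2 ech_step s) _ _ bL')).
  + by apply: leq_trans qs _; rewrite leq_addr.
  + by rewrite leq_addl.
  + by rewrite leq_addl.
- by move=> i j ri; apply: zL; move: ri; rewrite geq_min; have := ltn_ord i; lia.
- move=> w hw i ir; apply: leq_trans (wL' w hw i _) _; last by rewrite leq_addr.
  by apply: leq_trans ir _; exact: geq_minl.
move=> w w0 i ir; apply/eqP; rewrite -absz_eq0 -leqn0.
(* All multiples of [w] are killed as well and obey the same bound [b]; the multiple by [b.+1]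
   forces the coefficient to vanish. *)
pose b := iter s.*2 ech_step s.
have H : (`|(b.+1%:Z *: w) 0%R i| <= b)%N.
  apply: wL'; last by apply: leq_trans ir _; exact: geq_minl.
  by rewrite -scalemxAl w0 scaler0; exact: mxle0.
move: H; rewrite mxE abszM /=.
case: (absz (w 0 i)) => // n; nia.
Qed.

(** Systems are given by additive functionals on vectors over an arbitrary finite index type instead
    of by a matrix. The coefficients are the values on unit vectors, so a bound on vectors with
    entries at most [1] bounds them. *)
Section LinearSystems.
Variables (I K : finType) (phi : K -> {ffun I -> int} -> int).
Hypothesis phiD : forall k x y, phi k (x + y) = phi k x + phi k y.

Let dlt (i : I) : {ffun I -> int} := [ffun j => (j == i)%:R].
Definition sys_mx : 'M[int]_(#|I|, #|K|) := \matrix_(i, k) phi (enum_val k) (dlt (enum_val i)).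

Lemma sys_phi0 k : phi k 0 = 0.
Proof. by apply: (addrI (phi k 0)); rewrite -phiD !addr0. Qed.

Lemma sys_phiZ k x (n : int) : phi k (x *~ n) = n * phi k x.
Proof.
have N y : phi k (- y) = - phi k y.
  by apply: (addrI (phi k y)); rewrite -phiD !subrr sys_phi0.
have H (m : nat) : phi k (x *+ m) = m%:Z * phi k x.
  elim: m => [|m IH]; first by rewrite mulr0n sys_phi0 mul0r.
  by rewrite mulrS phiD IH -add1n PoszD mulrDl mul1r.
case: n => n; first by rewrite -pmulrn H.
by rewrite NegzE mulrNz N -pmulrn H mulNr.
Qed.

Lemma sys_sum k (J : Type) (r : seq J) (P : pred J) (F : J -> {ffun I -> int}) :
  phi k (\sum_(j <- r | P j) F j) = \sum_(j <- r | P j) phi k (F j).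
Proof. by elim/big_ind2: _ => [|x y a b <- <-|//]; rewrite ?sys_phi0 ?phiD. Qed.

Lemma ffun_mulz (x : {ffun I -> int}) n i : (x *~ n) i = n * x i.
Proof.
case: n => n; first by rewrite -pmulrn ffunMnE -mulr_natl natz.
by rewrite NegzE mulrNz ffunE -pmulrn ffunMnE -mulr_natl natz mulNr.
Qed.

Lemma sys_phiE k (x : {ffun I -> int}) :
  phi k x = ((\row_i x (enum_val i)) *m sys_mx) 0 (enum_rank k).
Proof.
have -> : phi k x = \sum_i x i * phi k (dlt i).
  have {1}-> : x = \sum_i dlt i *~ x i.
    apply/ffunP => j; rewrite sum_ffunE (bigD1 j) //= big1 ?addr0 => [|i ij];
      by rewrite ffun_mulz ffunE 1?eq_sym ?(negPf ij) ?mulr0 // eqxx mulr1.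
  by rewrite sys_sum; apply: eq_bigr => i _; rewrite sys_phiZ.
rewrite mxE (reindex (fun i : 'I_#|I| => enum_val i)) /=.
  by apply: eq_bigr => i _; rewrite !mxE enum_rankK.
by exists enum_rank => i _; rewrite ?enum_rankK ?enum_valK.
Qed.

Variable s : nat.
Hypothesis phis : forall k (x : {ffun I -> int}), (forall i, (`|x i| <= 1)%N) -> (`|phi k x|
  <= s)%N.

Lemma sys_mx_le : mxle s sys_mx.
Proof.
move=> i k; rewrite mxE; apply: phis => j; rewrite ffunE.
by case: eqP.
Qed.
End LinearSystems.

(** In the coordinates of the echelon form, the coefficients of a solution at the zero rows may be
    replaced by zero; the others are bounded by the right-hand side. *)
Lemma lin_solve : exists f, mfun f /\
  forall s (I K : finType) (phi : K -> {ffun I -> int} -> int) (b : K -> int) x,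
  (#|I| <= s)%N -> (#|K| <= s)%N ->
  (forall k x y, phi k (x + y) = phi k x + phi k y) ->
  (forall k (x : {ffun I -> int}), (forall i, (`|x i| <= 1)%N) -> (`|phi k x| <= s)%N) ->
  (forall k, (`|b k| <= s)%N) -> (forall k, phi k x = b k) ->
  exists y, (forall k, phi k y = b k) /\ forall i, (`|y i| <= f s)%N.
Proof.
exists (fun s => s * (ech_bound s * ech_bound s))%N; split.
  by have h := mf_ech_bound mf_id; apply: mf_mul; [exact: mf_id | apply: mf_mul].
move=> s I K phi b x Is Ks phiD phis bs xb.
have [L [r [[uL rq bL bL'] zL wL kL]]] := echelonS Is Ks (sys_mx_le phis).
set A := sys_mx phi in zL wL kL.
pose u := \row_i x (enum_val i) : 'rV[int]_#|I|.
pose w := u *m invmx L.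
pose w' := \row_i (if (i < r)%N then w 0 i else 0) : 'rV[int]_#|I|.
have wE : w *m (L *m A) = \row_k b (enum_val k).
  rewrite mulmxA mulmxKV //; apply/rowP => k.
  by rewrite [RHS]mxE -xb sys_phiE // enum_valK.
have w'E : w' *m (L *m A) = w *m (L *m A).
  apply/rowP => k; rewrite [LHS]mxE [RHS]mxE; apply: eq_bigr => i _.
  by rewrite [w' _ _]mxE; case: ltnP => // ri; rewrite zL // !mulr0.
have bw' : mxle (ech_bound s) w'.
  move=> i j; rewrite mxE; case: ltnP => // jr.
  by apply: (wL w) => // a k; rewrite wE mxE.
pose y := [ffun i => (w' *m L) 0 (enum_rank i)].
have yE : \row_i y (enum_val i) = w' *m L.
  by apply/rowP => i; rewrite mxE ffunE enum_valK.
exists y; split.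
  move=> k; rewrite sys_phiE // yE -mulmxA -/A w'E wE mxE enum_rankK //.
move=> i; rewrite ffunE; apply: leq_trans (mxle_mul bw' bL _ _) _.
by rewrite leq_mul2r Is orbT.
Qed.

(** The rows of [L] from index [r] on span the kernel. The earlier ones are replaced by zero to keep
    [#|I|] as the number of generators. *)
Lemma lin_gen : exists f, mfun f /\
  forall s (I K : finType) (phi : K -> {ffun I -> int} -> int),
  (#|I| <= s)%N -> (#|K| <= s)%N ->
  (forall k x y, phi k (x + y) = phi k x + phi k y) ->
  (forall k (x : {ffun I -> int}), (forall i, (`|x i| <= 1)%N) -> (`|phi k x| <= s)%N) ->
  exists l (e : 'I_l -> {ffun I -> int}), [/\ (l <= s)%N,
    forall a k, phi k (e a) = 0, forall a i, (`|e a i| <= f s)%N &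
    forall x, (forall k, phi k x = 0) -> exists z : 'I_l -> int, x = \sum_a e a *~ z a].
Proof.
exists ech_bound; split; first exact: mf_ech_bound mf_id.
move=> s I K phi Is Ks phiD phis.
have [L [r [[uL rq bL bL'] zL wL kL]]] := echelonS Is Ks (sys_mx_le phis).
set A := sys_mx phi in zL wL kL.
exists #|I|, (fun a : 'I_#|I| => [ffun i => if (r <= a)%N then L a (enum_rank i) else 0]).
have rowE (a : 'I_#|I|) : \row_i [ffun i => if (r <= a)%N then L a (enum_rank i) else 0]
  (enum_val i) =
    if (r <= a)%N then row a L else 0.
  by apply/rowP => i; rewrite mxE ffunE enum_valK; case: ifP; rewrite !mxE.
split=> //.
- move=> a k; rewrite sys_phiE // rowE; case: ifP => ra; last by rewrite mul0mx mxE.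
  by rewrite -row_mul mxE zL.
- by move=> a i; rewrite ffunE; case: ifP.
move=> x x0; pose w := (\row_i x (enum_val i)) *m invmx L.
exists (fun a => w 0 a).
have w0 (i : 'I_#|I|) : (i < r)%N -> w 0 i = 0.
  apply: kL; rewrite /w mulmxA mulmxKV //; apply/rowP => k.
  by rewrite -(enum_valK k) -sys_phiE // x0 mxE.
apply/ffunP => i; rewrite sum_ffunE.
have -> : x i = (w *m L) 0 (enum_rank i) by rewrite mulmxKV // mxE enum_rankK.
rewrite mxE; apply: eq_bigr => a _; rewrite ffun_mulz ffunE.
by case: leqP => // ar; rewrite w0 // !mul0r.
Qed.

(** The kernel is a direct summand, spanned by the last rows of [L]: [T] reads off the first [r]
    coordinates in the basis of the rows of [L], and [S] consists of the first [r] rows. *)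
Lemma lin_quot : exists f, mfun f /\
  forall s q p (A : 'M[int]_(q, p)), (q <= s)%N -> (p <= s)%N -> mxle s A ->
  exists d (S : 'M[int]_(d, q)) (T : 'M[int]_(q, d)),
    [/\ (d <= s)%N, mxle (f s) S, mxle (f s) T, S *m T = 1%:M &
     forall v : 'rV[int]_q, v *m A = 0 <-> v *m T = 0].
Proof.
exists ech_bound; split; first exact: mf_ech_bound mf_id.
move=> s q p A qs ps sA.
have [L [r [[uL rq bL bL'] zL wL kL]]] := echelonS qs ps sA.
exists r, (rowsub (widen_ord rq) L), (colsub (widen_ord rq) (invmx L)).
split; first exact: leq_trans rq qs.
- by move=> i j; rewrite mxE.
- by move=> i j; rewrite mxE.
- apply/matrixP => i j; rewrite mxE.
  have := congr1 (fun M : 'M[int]_q => M (widen_ord rq i) (widen_ord rq j)) (mulmxV uL).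
  rewrite /= 3!mxE => E; rewrite -[RHS]E; apply: eq_bigr => k _; rewrite !mxE.
  - by [].
move=> v; have vT j : (v *m colsub (widen_ord rq) (invmx L)) 0 j = (v *m invmx L) 0 (widen_ord rq
  j).
  by rewrite !mxE; apply: eq_bigr => k _; rewrite mxE.
split=> h.
  apply/rowP => j; rewrite vT [RHS]mxE; apply: kL => //=.
  by rewrite mulmxA mulmxKV.
rewrite -(mulmxKV uL v) -[_ *m L *m A]mulmxA; apply/rowP => j; rewrite mxE big1 => [|i _];
  first by rewrite mxE.
have [ir|ri] := ltnP i r; last by rewrite zL ?mulr0.
have := vT (Ordinal ir); rewrite h mxE => E.
have -> : i = widen_ord rq (Ordinal ir) by apply: val_inj.
by rewrite -E mul0r.
Qed.

Lemma row_sqr_eq0 n (x : 'rV[int]_n) : x *m x^T = 0 -> x = 0.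
Proof.
move=> /(congr1 (fun M : 'M_1 => M 0 0)); rewrite !mxE => h.
apply/rowP => i; rewrite mxE; apply/eqP; rewrite -sqrf_eq0.
have := h; under eq_bigr => j _ do rewrite mxE -expr2.
move/eqP; rewrite psumr_eq0 => [/allP/(_ i)|j _]; last exact: sqr_ge0.
by apply; rewrite mem_index_enum.
Qed.

(** [T] maps the cokernel of [R] onto its quotient by the torsion, and [k] annihilates the torsion.
    The echelon form is taken of [R^T], that is by column operations on [R]; the columns made zero
    give [T]. The remaining ones are independent, and [k] is their Gram determinant: after
    multiplication by it, Cramer's rule solves the system. *)
Lemma lin_torsion : exists f, mfun f /\
  forall s m n (R : 'M[int]_(m, n)), (m <= s)%N -> (n <= s)%N -> mxle s R ->
  exists d (S : 'M[int]_(d, n)) (T : 'M[int]_(n, d)) (k : nat),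
    [/\ [/\ (d <= s)%N, mxle (f s) S, mxle (f s) T & (0 < k <= f s)%N],
     S *m T = 1%:M, R *m T = 0 &
     forall v : 'rV[int]_n, v *m T = 0 -> exists c : 'rV[int]_m, k%:Z *: v = c *m R].
Proof.
pose e s := (s * (ech_bound s * s))%N.
pose h s := (s * (e s * e s))%N.
exists (fun s => ech_bound s + adj_bound (s + h s))%N; split.
  have he := mf_ech_bound mf_id.
  have hh : mfun h by rewrite /h /e; mf_tac.
  by apply: mf_add => //; apply: mf_adj_bound; apply: mf_add => //; exact: mf_id.
move=> s m n R ms ns sR.
have [|L [r [[uL rq bL bL'] zL wL kL]]] := echelonS (s := s) (A := R^T) ns ms.
  by move=> i j; rewrite mxE.
have sh (i : 'I_(n - r)) : (r + i < n)%N by have := ltn_ord i; lia.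
pose up i := Ordinal (sh i).
pose dn (i : 'I_r) := widen_ord rq i.
pose E := rowsub dn (L *m R^T).
pose G := E *m E^T.
have G0 : \det G != 0.
  apply/negP => /det0P[z z0 zG]; case/negP: z0; apply/eqP.
  have zE : z *m E = 0.
    by apply: row_sqr_eq0; rewrite trmx_mul mulmxA -[z *m E *m _]mulmxA zG mul0mx.
  pose w := \row_i (if insub (val i) is Some j then z 0 j else 0) : 'rV[int]_n.
  have wdn j : w 0 (dn j) = z 0 j.
    by rewrite mxE /= insubT //= => lt; congr (z _ _); apply: val_inj.
  have w0 : w *m (L *m R^T) = 0.
    rewrite -zE; apply/rowP => k; rewrite [LHS]mxE [RHS]mxE.
    rewrite (bigID (fun i : 'I_n => (i < r)%N)) /= [X in _ + X]big1 ?addr0; last first.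
      by move=> i; rewrite -leqNgt => ri; rewrite zL ?mulr0.
    rewrite (big_ord_narrow rq); apply: eq_bigr => i _.
    by rewrite -/(dn i) wdn [E _ _]mxE.
  by apply/rowP => j; rewrite -wdn (kL w w0) ?mxE //=.
exists (n - r)%N, (rowsub up (invmx L)^T), (colsub up L^T), `|\det G|%N.
have bE : mxle (e s) E.
  move=> i j; rewrite mxE; apply: leq_trans (mxle_mul bL (_ : mxle s R^T) _ _) _.
    by move=> a b; rewrite mxE.
  by rewrite leq_mul2r ns orbT.
have bG : mxle (h s) G.
  move=> i j; apply: leq_trans (mxle_mul bE (_ : mxle (e s) E^T) _ _) _.
    by move=> a b; rewrite mxE.
  by rewrite leq_mul2r ms orbT.
split.
- split; first by apply: leq_trans (leq_subr _ _) ns.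
  + by move=> i j; rewrite !mxE; apply: leq_trans (bL' _ _) _; rewrite leq_addr.
  + by move=> i j; rewrite !mxE; apply: leq_trans (bL _ _) _; rewrite leq_addr.
  rewrite absz_gt0 G0 /=; apply: leq_trans (mxle_detS (s := s + h s) _ _ bG) _.
  + by apply: leq_trans rq (leq_trans ns (leq_addr _ _)).
  + by rewrite leq_addl.
  + by rewrite leq_addl.
- apply/matrixP => i j; have := congr1 (fun M : 'M[int]_n => M (up j) (up i)) (mulmxV uL).
  rewrite /= !mxE => H; transitivity ((up j == up i)%:R : int); last first.
    by rewrite eq_sym; congr (_%:R); congr nat_of_bool; apply/eqP/eqP => [[/addnI] /val_inj|->].
  by rewrite -H; apply: eq_bigr => k _; rewrite !mxE mulrC.
- apply/matrixP => i j; rewrite !mxE.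
  have := zL (up j) i; rewrite /= leq_addr mxE => /(_ isT) H; rewrite -[RHS]H.
  by apply: eq_bigr => k _; rewrite !mxE mulrC.
move=> v vT.
pose y := v *m L^T.
have yup j : y 0 (up j) = 0.
  have := congr1 (fun M : 'rV[int]_(n - r) => M 0 j) vT; rewrite /= !mxE => H; rewrite -[RHS]H.
  by apply: eq_bigr => k _; rewrite !mxE.
pose y1 := colsub dn y.
pose c := y1 *m \adj G *m E.
have cE : c *m (L *m R^T)^T = \det G *: y.
  have c1 : c *m E^T = \det G *: y1.
    by rewrite /c -!mulmxA mul_adj_mx mul_mx_scalar.
  apply/rowP => j; rewrite [RHS]mxE.
  have [jr|rj] := ltnP j r.
    have dnE : dn (Ordinal jr) = j by apply: val_inj.
    have := congr1 (fun M : 'rV[int]_r => M 0 (Ordinal jr)) c1.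
    have -> : (\det G *: y1) 0 (Ordinal jr) = \det G * y 0 j.
      by rewrite mxE [y1 _ _]mxE dnE.
    move=> /= <-; rewrite [LHS]mxE [RHS]mxE; apply: eq_bigr => k _.
    by rewrite [_^T _ _]mxE [E^T _ _]mxE [E _ _]mxE dnE.
  have -> : y 0 j = 0.
    have jn : (j - r < n - r)%N by rewrite ltn_sub2r // (leq_ltn_trans rj).
    by rewrite -(yup (Ordinal jn)); congr (y _ _); apply: val_inj; rewrite /= subnKC.
  by rewrite mulr0 [LHS]mxE big1 // => k _; rewrite [_^T _ _]mxE zL ?mulr0.
have dv : \det G *: v = c *m R.
  have uLT : L^T \in unitmx by rewrite unitmx_tr.
  by apply: (can_inj (mulmxK uLT)); rewrite -scalemxAl -/y -cE trmx_mul trmxK mulmxA.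
exists ((Num.sg (\det G)) *: c).
by rewrite -scalemxAl -dv scalerA -normrEsg abszE.
Qed.

(** * Reduction of positive definite forms *)

Definition qf n (G : 'M[int]_n) (v : 'rV[int]_n) : int := (v *m G *m v^T) 0 0.
Definition posdef n (G : 'M[int]_n) := G^T = G /\ forall v, v != 0 -> 0 < qf G v.

Lemma qf_ge0 n (G : 'M[int]_n) v : posdef G -> 0 <= qf G v.
Proof.
move=> [_ pG]; have [->|/pG/ltW//] := eqVneq v 0.
by rewrite /qf !mul0mx mxE.
Qed.

Lemma qfZ n (G : 'M[int]_n) c v : qf G (c *: v) = c ^+ 2 * qf G v.
Proof. by rewrite /qf linearZ /= -!scalemxAl -scalemxAr !mxE mulrA. Qed.

Lemma qf_base n (G P : 'M[int]_n) v : qf (P *m G *m P^T) v = qf G (v *m P).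
Proof. by rewrite /qf trmx_mul !mulmxA. Qed.

Lemma qfD2 n (G : 'M[int]_n) u v : posdef G ->
  qf G (u + v) + qf G (u - v) = 2 * qf G u + 2 * qf G v.
Proof.
move=> _; rewrite /qf.
have -> : (u + v)^T = u^T + v^T by rewrite linearD.
have -> : (u - v)^T = u^T - v^T by rewrite linearB.
rewrite !mulmxDl !mulmxDr !mulNmx !mulmxN.
move: (u *m G *m u^T) (u *m G *m v^T) (v *m G *m u^T) (v *m G *m v^T) => a b c d.
by rewrite !mxE; ring.
Qed.

Lemma qfD_le n (G : 'M[int]_n) u v : posdef G -> qf G (u + v) <= 2 * qf G u + 2 * qf G v.
Proof. by move=> pG; rewrite -qfD2 // lerDl qf_ge0. Qed.

Lemma qf_sum_le n (G : 'M[int]_n) k (u : 'I_k -> 'rV[int]_n) : posdef G ->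
  qf G (\sum_i u i) <= (2 ^ k)%:Z * \sum_i qf G (u i).
Proof.
move=> pG; elim: k u => [|k IH] u.
  by rewrite !big_ord0 /qf !mul0mx mxE mulr0.
rewrite !big_ord_recl; apply: le_trans (qfD_le _ _ pG) _.
set X := qf G (u ord0); set Y := qf G _; set Z := \sum_(i < k) _.
have h1 : Y <= (2 ^ k)%:Z * Z := IH (fun i => u (lift ord0 i)).
have h2 : 0 <= X by exact: qf_ge0.
have h3 : 1 <= (2 ^ k)%:Z by rewrite lez_nat expn_gt0.
have h4 : 1 * X <= (2 ^ k)%:Z * X by apply: ler_wpM2r.
by rewrite expnS PoszM; lia.
Qed.

Lemma exists_min (T : Type) (P : T -> Prop) (f : T -> nat) :
  (exists x, P x) -> exists x, P x /\ forall y, P y -> (f x <= f y)%N.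
Proof.
case=> x Px; have [n] := ubnP (f x); elim: n x Px => // n IH x Px fx.
have [[y [Py yx]]|no] := boolp.EM (exists y, P y /\ (f y < f x)%N).
  by apply: (IH y) => //; apply: leq_trans yx _.
by exists x; split=> // y Py; rewrite leqNgt; apply/negP => yx; apply: no; exists y.
Qed.

Lemma posdef_base n (G P : 'M[int]_n) : P \in unitmx -> posdef G -> posdef (P *m G *m P^T).
Proof.
move=> uP [sG pG]; split; first by rewrite !trmx_mul trmxK sG mulmxA.
move=> v v0; rewrite qf_base; apply: pG; apply: contra v0 => /eqP E.
by rewrite -(mulmxK uP v) E mul0mx.
Qed.

(** By the Smith normal form of a single row, a shortest nonzero vector is an integer multiple of
    the first row of a unimodular matrix, and that row is no longer than it. *)
Lemma shortest_basis n (G : 'M[int]_(1 + n)) : posdef G ->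
  exists P : 'M[int]_(1 + n), P \in unitmx /\
    forall v, v != 0 -> qf G (row 0 P) <= qf G v.
Proof.
move=> pG.
have [v [v0 hv]] : exists v, v != 0 /\ forall w, w != 0 -> (`|qf G v| <= `|qf G w|)%N.
  apply: exists_min; exists (delta_mx 0 0); apply/eqP => /(congr1 (fun M : 'rV_(1 + n) => M 0 0)).
  by rewrite !mxE.
have [L uL [R uR [d _ vE]]] := int_Smith_normal_form v.
exists R; split=> // w w0.
pose c := L 0 0 * d`_0.
have {}vE : v = c *: row 0 R.
  rewrite vE; apply/rowP => j; rewrite [LHS]mxE (bigD1 0) //= big1 ?addr0 => [|i i0].
    by rewrite [RHS]mxE [row _ _ _ _]mxE [X in X * _]mxE big_ord1 mxE mulr1n.
  rewrite [X in X * _]mxE big_ord1 mxE; case: eqP => [e|_]; last by rewrite mulr0n mulr0 mul0r.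
  by case/eqP: i0; apply: val_inj; rewrite /= -e.
have c0 : c != 0 by apply: contraNneq v0 => c0; rewrite vE c0 scale0r.
have h1 := hv w w0; rewrite vE qfZ expr2 in h1.
have h2 := qf_ge0 w pG; have h3 := qf_ge0 (row 0 R) pG.
have h4 : 1 <= c * c by clearbody c; nia.
have h5 : 1 * qf G (row 0 R) <= c * c * qf G (row 0 R) by apply: ler_wpM2r.
by move: h1 h2 h3 h5; rewrite mul1r; move: (c * c) (qf G w) (qf G _) => t x y; lia.
Qed.

Lemma nearest_mult (a z : int) : 0 < a -> exists x, 4 * (a * x + z) ^+ 2 <= a ^+ 2.
Proof.
(* [x] rounds [z / a] to a nearest integer; its opposite is the witness. *)
move=> a0; pose x := ((2 * z + a) %/ (2 * a))%Z.
have h1 := divz_eq (2 * z + a) (2 * a).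
have h2 : 0 <= ((2 * z + a) %% (2 * a))%Z by apply: modz_ge0; lia.
have h3 : ((2 * z + a) %% (2 * a))%Z < 2 * a by apply: ltz_pmod; lia.
exists (- x); rewrite -/x in h1; move: x h1 ((_ %% _)%Z) h2 h3 => x h1 r h2 h3.
rewrite !expr2; have : - a <= 2 * (a * - x + z) <= a by apply/andP; split; lia.
by move: (a * - x + z) => y /andP[]; nia.
Qed.

(** With [x] majorizing the rank and the previous constant: the first coordinate is recovered from
    the others, each controlled with twice that constant, and the power of two is the loss in
    [qf_sum_le]. *)
Definition red_step x := (2 + 2 ^ (x + 1) * x * 2 * x + 2 * x)%N.

Lemma leq_red_step x : (x <= red_step x)%N.
Proof. rewrite /red_step; lia. Qed.

(* Gram-Schmidt on a shortest vector, with the projected form scaled to stay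
   integral: [a q(x, y) = (a x + y w^T)^2 + q2(y)]. *)
Lemma reduced_basis s n (G : 'M[int]_n) : (n <= s)%N -> posdef G ->
  exists b : 'M[int]_n, b \in unitmx /\
    forall (c : 'rV[int]_n) i, c 0 i ^+ 2 * qf G (row i b) <= (iter n red_step s)%:Z * qf G (c *m
      b).
Proof.
elim: n G => [|n IH] G ns pG.
  by exists 1%:M; split; [exact: unitmx1 | move=> c i; have := ltn_ord i; rewrite ltn0].
change 'M[int]_(1 + n) in (type of G).
suff main (H : 'M[int]_(1 + n)) : posdef H ->
    (forall v : 'rV[int]_(1 + n), v != 0 -> H 0 0 <= qf H v) ->
    exists b : 'M[int]_(1 + n), b \in unitmx /\
    forall (c : 'rV[int]_(1 + n)) i,
      c 0 i ^+ 2 * qf H (row i b) <= (iter n.+1 red_step s)%:Z * qf H (c *m b).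
  have [P [uP hP]] := @shortest_basis n G pG.
  have [||b [ub hb]] := main (P *m G *m P^T).
  - exact: posdef_base.
  - move=> v v0; rewrite qf_base.
    have -> : (P *m G *m P^T) 0 0 = qf G (row 0 P).
      by rewrite /qf -row_mul [in LHS]mxE [in RHS]mxE; apply: eq_bigr => k _; rewrite !mxE.
    apply: hP; apply: contra v0 => /eqP E.
    by rewrite -(mulmxK uP v) E mul0mx.
  exists (b *m P); split; first by rewrite unitmx_mul ub.
  by move=> c i; have := hb c i; rewrite !qf_base row_mul mulmxA.
move=> {pG}pH hmin; set a := H 0 0 in hmin *.
pose w := ursubmx H; pose G1 := drsubmx H.
have HE : H = block_mx a%:M w w^T G1.
  rewrite -[LHS]submxK; congr block_mx; apply/matrixP => i j.
    by rewrite !mxE !ord1 eqxx mulr1n /a; congr (H _ _); apply: val_inj.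
  by rewrite -{1}(proj1 pH) !mxE.
have sG1 : G1^T = G1.
  by apply/matrixP => i j; rewrite !mxE -{1}(proj1 pH) !mxE.
pose G2 := a *: G1 - w^T *m w.
have a0 : 0 < a.
  have -> : a = qf H (row_mx 1%:M 0).
    rewrite /qf HE mul_row_block mul0mx !mul1mx mul0mx !addr0 tr_row_mx mul_row_col trmx0 mulmx0
      addr0 trmx1 mulmx1.
    by rewrite mxE eqxx mulr1n.
  apply: (proj2 pH); apply/eqP => /(congr1 lsubmx); rewrite row_mxKl linear0 => /matrixP/(_ 0 0).
  by rewrite !mxE.
have key (x : int) (y : 'rV[int]_n) :
    a * qf H (row_mx x%:M y) = (a * x + (y *m w^T) 0 0) ^+ 2 + qf G2 y.
  rewrite /qf HE mul_row_block tr_row_mx mul_row_col tr_scalar_mx.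
  rewrite /G2 mulmxBr mulmxBl -scalemxAr -scalemxAl !mulmxDl.
  have -> : x%:M *m w *m y^T = x *: (y *m w^T)^T.
    by rewrite trmx_mul trmxK -mulmxA mul_scalar_mx.
  have -> : y *m (w^T *m w) *m y^T = (y *m w^T) *m (y *m w^T)^T.
    by rewrite trmx_mul trmxK !mulmxA.
  rewrite -scalar_mxM !mul_mx_scalar.
  move: (y *m w^T) (y *m G1 *m y^T) => u t.
  by rewrite !mxE big_ord1 !mxE eqxx !mulr1n expr2; ring.
have pG2 : posdef G2.
  split; first by rewrite /G2 linearB /= linearZ /= trmx_mul trmxK sG1.
  (* At this vector the square in [key] vanishes, so positivity passes from [H] to [G2]. *)
  move=> y y0; pose v := row_mx (- (y *m w^T) 0 0)%:M (a *: y).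
  have v0 : v != 0.
    apply: contra y0 => /eqP/(congr1 rsubmx); rewrite row_mxKr linear0 => /rowP ay.
    apply/eqP/rowP => j; have /eqP := ay j; rewrite !mxE mulf_eq0 gt_eqF //=.
    by move/eqP.
  have := proj2 pH v v0; have := key (- (y *m w^T) 0 0) (a *: y).
  rewrite -scalemxAl qfZ -/v [(a *: (y *m w^T)) 0 0]mxE mulrN addNr expr2 mul0r add0r.
  by move: (qf H v) (qf G2 y) => A B; nia.
have [|b2 [ub2 hb2]] := IH G2 _ pG2; first exact: ltnW.
(* Each basis vector of the projected lattice is lifted so that its component along the shortest
   vector is at most half of that vector. *)
have [X hX] : exists X : 'I_n -> int, forall i, 4 * (a * X i + (row i b2 *m w^T) 0 0) ^+ 2 <= a
  ^+ 2.
  exact: fin_all_exists (fun i => @nearest_mult a ((row i b2 *m w^T) 0 0) a0).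
pose b := block_mx (1%:M : 'M_1) 0 (\col_i X i) b2.
exists b; split; first by rewrite unitmxE det_lblock det1 mul1r -unitmxE.
move=> c i.
pose C := iter n red_step s.
have rowb j : row (rshift 1 j) b = row_mx (X j)%:M (row j b2).
  rewrite /b; apply/rowP => k; rewrite [LHS]mxE -(splitK k); case: (split k) => l /=.
    by rewrite block_mxEdl row_mxEl !mxE !ord1 eqxx mulr1n.
  by rewrite block_mxEdr row_mxEr mxE.
have row0 : row (lshift n 0) b = row_mx 1%:M 0.
  rewrite /b; apply/rowP => k; rewrite [LHS]mxE -(splitK k); case: (split k) => l /=.
    by rewrite block_mxEul row_mxEl.
  by rewrite block_mxEur row_mxEr.
have nz j : row j b != 0.
  have ub : b \in unitmx by rewrite unitmxE det_lblock det1 mul1r -unitmxE.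
  apply/eqP => /(congr1 (mulmx^~ (invmx b))); rewrite mul0mx -row_mul mulmxV // => /rowP/(_ j).
  by rewrite !mxE eqxx.
have lowi j : c 0 (rshift 1 j) ^+ 2 * qf H (row (rshift 1 j) b) <= 2 * C%:Z * qf H (c *m b).
  have h1 := key (X j) (row j b2); rewrite -rowb in h1.
  have h2 := hX j.
  have h3 := hmin _ (nz (rshift 1 j)).
  have cbE : c *m b = row_mx (c 0 (lshift n 0) + (rsubmx c *m \col_i X i) 0 0)%:M (rsubmx c *m b2).
    rewrite -{1}(hsubmxK c) mul_row_block mulmx1 mulmx0 add0r; congr row_mx.
    by apply/matrixP => k l; rewrite !ord1 [RHS]mxE eqxx mulr1n [LHS]mxE; congr (_ + _);
      rewrite mxE.
  have h4 := key (c 0 (lshift n 0) + (rsubmx c *m \col_i X i) 0 0) (rsubmx c *m b2);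
    rewrite -cbE in h4.
  have h5 := hb2 (rsubmx c) j; rewrite mxE -/C in h5.
  have h6 : 0 <= c 0 (rshift 1 j) ^+ 2 by exact: sqr_ge0.
  move: h1 h2; set t := _ ^+ 2 => h1 h2.
  move: h4; set t' := _ ^+ 2 => h4; have h7 : 0 <= t' by exact: sqr_ge0.
  (* Hermite's factor 4/3: by minimality [a] is at most the value at the lifted vector, and the
     square is at most [a ^ 2 / 4] by the choice of the lift. *)
  have h8 : 3 * a * qf H (row (rshift 1 j) b) <= 4 * qf G2 (row j b2).
    have : a * a <= a * qf H (row (rshift 1 j) b) by rewrite ler_pM2l.
    by move: h1 h2; rewrite expr2; lia.
  have h9 : qf G2 (rsubmx c *m b2) <= a * qf H (c *m b) by rewrite h4 lerDr.
  have h10 : 0 <= C%:Z by [].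
  have h11 : 0 <= qf H (c *m b) by exact: qf_ge0.
  clear h1 h2 h4 h7 h3; rewrite -(ler_pM2l (_ : 0 < 3 * a)); last by lia.
  have h12 : c 0 (rshift 1 j) ^+ 2 * (3 * a * qf H (row (rshift 1 j) b)) <=
    c 0 (rshift 1 j) ^+ 2 * (4 * qf G2 (row j b2)) by exact: ler_wpM2l.
  have h13 : C%:Z * qf G2 (rsubmx c *m b2) <= C%:Z * (a * qf H (c *m b)) by exact: ler_wpM2l.
  move: h5 h12 h13 (mulr_ge0 (mulr_ge0 h10 (ltW a0)) h11).
  move: (c 0 (rshift 1 j) ^+ 2) (qf H (row (rshift 1 j) b)) (qf G2 (row j b2)) (qf G2 (rsubmx c
    *m b2)) (qf H (c *m b)) C%:Z => x1 x2 x3 x4 x5 x6.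
  by lia.
have sC : (s <= C)%N by apply: leq_iter; exact: leq_red_step.
have q0 : 0 <= qf H (c *m b) by exact: qf_ge0.
rewrite iterS -/C -(splitK i); case: (split i) => j /=; last first.
  apply: le_trans (lowi j) _; apply: ler_wpM2r => //.
  by rewrite -PoszM lez_nat /red_step; lia.
rewrite (ord1 j).
have cE : c 0 (lshift n 0) *: row (lshift n 0) b =
    c *m b + \sum_(j < n) (- c 0 (rshift 1 j)) *: row (rshift 1 j) b.
  have -> : c *m b = \sum_k c 0 k *: row k b.
    by rewrite -mulmx_sum_row.
  rewrite big_split_ord /= big_ord1 -addrA -big_split /= big1 ?addr0 //.
  by move=> k _; rewrite scaleNr subrr.
rewrite -qfZ cE; apply: le_trans (qfD_le _ _ pH) _.
set u := fun j : 'I_n => (- c 0 (rshift 1 j)) *: row (rshift 1 j) b.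
have h1 : qf H (\sum_(j < n) u j) <= (2 ^ n)%:Z * \sum_(j < n) qf H (u j) by exact: qf_sum_le.
have h2 : \sum_(j < n) qf H (u j) <= n%:Z * (2 * C%:Z * qf H (c *m b)).
  have -> : n%:Z * (2 * C%:Z * qf H (c *m b)) = \sum_(j < n) 2 * C%:Z * qf H (c *m b).
    by rewrite sumr_const card_ord -[RHS]mulr_natl (natz n).
  by apply: ler_sum => k _; rewrite /u qfZ sqrrN.
have h3 : (2 ^ n)%:Z * (\sum_(j < n) qf H (u j)) <=
    (2 ^ n)%:Z * (n%:Z * (2 * C%:Z * qf H (c *m b))) by apply: ler_wpM2l.
have h4 : (2 ^ n * (n * (2 * C)) * 2 + 2 <= red_step C)%N.
  have nC : (n <= C)%N by apply: leq_trans sC; apply: ltnW.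
  rewrite /red_step expnD expn1.
  have : (2 ^ n * (n * (2 * C)) <= 2 ^ C * (C * (2 * C)))%N.
    by apply: leq_mul; [rewrite leq_exp2l | rewrite leq_mul2r nC orbT].
  by move: (2 ^ C)%N (2 ^ n)%N => x y; lia.
have h5 : (2 ^ n * (n * (2 * C)) * 2 + 2)%:Z * qf H (c *m b) <= (red_step C)%:Z * qf H (c *m b).
  by apply: ler_wpM2r => //; rewrite lez_nat.
move: h1 h3 h5; rewrite PoszD !PoszM; move: (qf H (c *m b)) (\sum_(j < n) qf H (u j)) (qf H
  (\sum_(j < n) u j)) => x1 x2 x3.
move: (2 ^ n)%:Z (red_step C)%:Z C%:Z n%:Z => x4 x5 x6 x7.
by lia.
Qed.

(** On a logarithmic scale the numbers are cut at every gap wider than the factor [T], and the level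
    counts the indices just below a cut that lie under [n i]. Inside a cluster one climbs from [n j]
    to [n i] in at most [#|I|] steps, each of factor at most [T]. *)
Lemma cluster (I : finType) (n : I -> int) (T : nat) : (0 < T)%N -> (forall i, 0 < n i) ->
  exists l : I -> nat, [/\ forall i, (l i <= #|I|)%N,
    forall i j, (l j < l i)%N -> T%:Z * n j < n i &
    forall i j, l i = l j -> n i <= (T ^ #|I|)%:Z * n j].
Proof.
move=> T0 n0; pose gap j := [forall k, (n k <= n j) || (T%:Z * n j < n k)].
pose D i := [set j | gap j & n j < n i].
have T1 : 1 <= T%:Z by rewrite lez_nat.
exists (fun i => #|D i|); split.
- by move=> i; apply: max_card.
- move=> i j lt.
  have /subsetPn[k kDi kDj] : ~~ (D i \subset D j).
    by apply: contraL lt => /subset_leq_card; rewrite -leqNgt.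
  move: kDi kDj; rewrite !inE => /andP[gk ki]; rewrite gk /= -leNgt => jk.
  have /forallP/(_ i) := gk; rewrite leNgt ki /= => lt'.
  by apply: le_lt_trans lt'; rewrite ler_pM2l // (lt_le_trans _ T1).
move=> i j E.
have TP m : 1 <= (T ^ m)%:Z by rewrite lez_nat expn_gt0 T0.
have [ij|ji] := leP (n i) (n j).
  by apply: le_trans ij _; rewrite ler_peMl // ltW.
have sub : D j \subset D i.
  by apply/subsetP => k; rewrite !inE => /andP[-> /lt_trans]; apply.
have DE : D j = D i by apply/eqP; rewrite eqEcard sub E leqnn.
have nogap k : n j <= n k -> n k < n i -> ~~ gap k.
  move=> jk ki; apply/negP => gk; have : k \in D i by rewrite inE gk ki.
  by rewrite -DE inE gk /= ltNge jk.
have : n i <= (T ^ #|[set k | (n j <= n k) && (n k < n i)]|)%:Z * n j.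
  clear E sub DE ji; have [m] := ubnP #|[set k | (n j <= n k) && (n k < n i)]|.
  elim: m j nogap => // m IH j nogap cm.
  have [ij|ji] := leP (n i) (n j).
    by apply: le_trans ij _; rewrite ler_peMl // ltW.
  have := nogap j (lexx _) ji; rewrite negb_forall => /existsP[k].
  rewrite negb_or -ltNge -leNgt => /andP[jk kj].
  set A := [set _ | _] in cm *.
  have pr : [set h | (n k <= n h) && (n h < n i)] \proper A.
    apply/properP; split.
      by apply/subsetP => h; rewrite !inE => /andP[/(lt_le_trans jk)/ltW-> ->].
    by exists j; rewrite !inE ?lexx ?ji // leNgt jk.
  have {}IH := IH k _ (leq_trans (proper_card pr) cm).
  apply: le_trans (IH _) _.
    by move=> h kh; apply: nogap; apply: le_trans kh; exact: ltW.
  apply: le_trans (ler_wpM2l _ kj) _; first by rewrite (le_trans _ (TP _)).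
  rewrite mulrA -PoszM -expnSr; apply: ler_wpM2r; first exact: ltW.
  by rewrite lez_nat leq_pexp2l // proper_card.
move/le_trans; apply; apply: ler_wpM2r; first exact: ltW.
by rewrite lez_nat leq_pexp2l // max_card.
Qed.

(** * Isomorphisms of semisimple representations *)

Definition tri m n (la : 'I_m -> nat) (lb : 'I_n -> nat) (A : 'M[int]_(m, n)) :=
  forall i j, (la i < lb j)%N -> A i j = 0.
(** Between block triangular matrices this means equality of the diagonal blocks, since the entries
    with [la i < lb j] vanish in both. *)
Definition deq m n (la : 'I_m -> nat) (lb : 'I_n -> nat) (A B : 'M[int]_(m, n)) :=
  forall i j, (la i <= lb j)%N -> A i j = B i j.

Lemma deq_tri m n la lb (A B : 'M[int]_(m, n)) : deq la lb A B -> tri la lb B -> tri la lb A.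
Proof. by move=> h t i j ij; rewrite h ?t // ltnW. Qed.

Lemma tri1 n (l : 'I_n -> nat) : tri l l 1%:M.
Proof. by move=> i j; rewrite mxE; case: eqP => // ->; rewrite ltnn. Qed.

Lemma tri_mul m n p la lb lc (A : 'M[int]_(m, n)) (B : 'M[int]_(n, p)) :
  tri la lb A -> tri lb lc B -> tri la lc (A *m B).
Proof.
move=> tA tB i j ij; rewrite mxE big1 // => k _.
have [ik|ki] := ltnP (la i) (lb k); first by rewrite tA ?mul0r.
by rewrite tB ?mulr0 // (leq_ltn_trans ki).
Qed.

Lemma deq_mul m n p la lb lc (A A' : 'M[int]_(m, n)) (B B' : 'M[int]_(n, p)) :
  tri la lb A' -> tri lb lc B' -> deq la lb A A' -> deq lb lc B B' ->
  deq la lc (A *m B) (A' *m B').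
Proof.
move=> tA tB eA eB i j ij; rewrite !mxE; apply: eq_bigr => k _.
have tA0 := deq_tri eA tA; have tB0 := deq_tri eB tB.
have [ik|ki] := ltnP (la i) (lb k); first by rewrite tA ?tA0 ?mul0r.
have [kj|jk] := ltnP (lb k) (lc j); first by rewrite tB ?tB0 ?mulr0.
by rewrite eA ?eB //; [apply: leq_trans ki ij | apply: leq_trans ij jk].
Qed.

Definition strict n (l : 'I_n -> nat) c (A : 'M[int]_n) :=
  forall i j, (l i < l j + c)%N -> A i j = 0.

Lemma strictW n l c d (A : 'M[int]_n) : strict l c A -> (d <= c)%N -> strict l d A.
Proof. by move=> h dc i j ij; apply: h; apply: leq_trans ij _; rewrite leq_add2l. Qed.

Lemma strict_add n l c (A B : 'M[int]_n) : strict l c A -> strict l c B -> strict l c (A + B).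
Proof. by move=> hA hB i j ij; rewrite mxE hA ?hB ?addr0. Qed.

Lemma strict_opp n l c (A : 'M[int]_n) : strict l c A -> strict l c (- A).
Proof. by move=> hA i j ij; rewrite mxE hA ?oppr0. Qed.

Lemma strict_mul n l c d (A B : 'M[int]_n) :
  strict l c A -> strict l d B -> strict l (c + d) (A *m B).
Proof.
move=> hA hB i j ij; rewrite mxE big1 // => k _.
have [ik|ki] := ltnP (l i) (l k + c); first by rewrite hA ?mul0r.
by rewrite hB ?mulr0 //; move: ij ki; lia.
Qed.

Definition unitri n (l : 'I_n -> nat) (Z : 'M[int]_n) := deq l l Z 1%:M.

Lemma unitriE n l (Z : 'M[int]_n) : unitri l Z <-> strict l 1 (Z - 1%:M).
Proof.
split=> h i j ij; first by rewrite !mxE h ?mxE ?subrr //; move: ij; rewrite addn1.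
by have := h i j; rewrite !mxE addn1 ltnS => /(_ ij)/eqP; rewrite subr_eq0 => /eqP.
Qed.

Lemma unitri_tri n l (Z : 'M[int]_n) : unitri l Z -> tri l l Z.
Proof. by move/deq_tri; apply; exact: tri1. Qed.

Lemma unitri_strict0 n l (Z : 'M[int]_n) : unitri l Z -> strict l 0 Z.
Proof. by move=> /unitri_tri h i j; rewrite addn0; exact: h. Qed.

Lemma unitri_mul n l (Y Z : 'M[int]_n) : unitri l Y -> unitri l Z -> unitri l (Y *m Z).
Proof.
move=> hY hZ; have := deq_mul (@tri1 _ l) (@tri1 _ l) hY hZ.
by rewrite mul1mx.
Qed.

Lemma strict_big n l c (A : 'M[int]_n) : (forall i, (l i < c)%N) -> strict l c A -> A = 0.
Proof. by move=> lc hA; apply/matrixP => i j; rewrite hA ?mxE // (leq_trans (lc i)) // leq_addl.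
  Qed.

Lemma level_bound n (l : 'I_n -> nat) : exists c, forall i, (l i < c)%N.
Proof. by exists (\max_i l i).+1 => i; rewrite ltnS; exact: leq_bigmax. Qed.

(** Neumann series: [1 - Z] has depth one, so its powers vanish once the depth exceeds all
    levels. *)
Lemma unitri_inv n l (Z : 'M[int]_n) : unitri l Z -> Z \in unitmx /\ unitri l (invmx Z).
Proof.
move=> /unitriE hZ; pose N := 1%:M - Z.
have hN : strict l 1 N by move=> i j ij; rewrite /N -(opprB Z) mxE hZ ?oppr0.
pose P k := iter k (mulmx N) 1%:M.
have hP k : strict l k (P k).
  elim: k => [|k IH]; first by move=> i j; rewrite addn0; exact: tri1.
  by rewrite -add1n; exact: strict_mul.
have [M lM] := level_bound l.
pose S := \sum_(k < M.+1) P k.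
have ZS : Z *m S = 1%:M.
  have -> : Z = 1%:M - N by rewrite /N opprB addrC subrK.
  have key m : (1%:M - N) *m \sum_(k < m) P k = 1%:M - P m.
    elim: m => [|m IH]; first by rewrite big_ord0 mulmx0 subrr.
    rewrite big_ord_recr mulmxDr IH mulmxBl mul1mx /= -[N *m P m]/(P m.+1).
    by rewrite addrA subrK.
  by rewrite key (strict_big (fun i => leqW (lM i)) (hP M.+1)) subr0.
have [uZ _] := mulmx1_unit ZS; split=> //.
have -> : invmx Z = S by rewrite -[S]mul1mx -(mulVmx uZ) -mulmxA ZS mulmx1.
apply/unitriE; rewrite /S big_ord_recl /= addrAC subrr add0r.
elim/big_ind: _ => [|A B|k _]; [by move=> i j _; rewrite mxE | exact: strict_add |].
by refine (strictW (hP (lift ord0 k)) _).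
Qed.

(** * Factorisations into bounded steps *)

Section Chains.
Variables (K : finType) (N : nat).
Implicit Types X Y : K -> 'M[int]_N.

(** The steps and the representations that they connect are bounded, but not the number of steps;
    pigeonholing takes care of that. *)
Inductive chain (B : nat) X : (K -> 'M[int]_N) -> 'M[int]_N -> Prop :=
| chain0 : (forall k, mxle B (X k)) -> chain B X X 1%:M
| chainS Y Y' g d : chain B X Y g -> (forall k, mxle B (Y' k)) -> d \in unitmx ->
    mxle B d -> (forall k, d *m Y k = Y' k *m d) -> chain B X Y' (d *m g).

Lemma chain_trans B X Y Z g h : chain B X Y g -> chain B Y Z h -> chain B X Z (h *m g).
Proof.
move=> hg; elim=> [_|Y1 Y' g1 d _ IH bY' ud bd com]; first by rewrite mul1mx.
by rewrite -mulmxA; apply: chainS IH bY' ud bd com.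
Qed.

Lemma chain_mono B B' X Y g : (B <= B')%N -> chain B X Y g -> chain B' X Y g.
Proof.
move=> BB; elim=> [bX|Y1 Y' g1 d _ IH bY' ud bd com].
  by apply: chain0 => k; apply: mxleW (bX k) BB.
apply: chainS IH _ ud _ com; last exact: mxleW bd BB.
by move=> k; apply: mxleW (bY' k) BB.
Qed.

Lemma chain1 B X Y d : (forall k, mxle B (X k)) -> (forall k, mxle B (Y k)) ->
  d \in unitmx -> mxle B d -> (forall k, d *m X k = Y k *m d) -> chain B X Y d.
Proof. by move=> bX bY ud bd com; rewrite -[d]mulmx1; apply: chainS (chain0 bX) bY ud bd com. Qed.

Lemma chain_iso B X Y g : chain B X Y g -> g \in unitmx /\ forall k, g *m X k = Y k *m g.
Proof.
elim=> [_|Y1 Y' g1 d _ [ug cg] _ ud _ cd]; first by split=> [|k]; rewrite ?unitmx1 ?mulmx1 ?mul1mx.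
split=> [|k]; first by rewrite unitmx_mul ud.
by rewrite -mulmxA cg mulmxA cd mulmxA.
Qed.
End Chains.

Definition mx_of_ffun m n (x : {ffun 'I_m * 'I_n -> int}) : 'M[int]_(m, n) := \matrix_(i,
    j) x (i, j).
Definition ffun_of_mx m n (A : 'M[int]_(m, n)) : {ffun 'I_m * 'I_n -> int} := [ffun p => A p.1 p.2].
Lemma ffun_of_mxK m n : cancel (@ffun_of_mx m n) (@mx_of_ffun m n).
Proof. by move=> A; apply/matrixP => i j; rewrite mxE ffunE. Qed.
Lemma mx_of_ffunD m n x y : @mx_of_ffun m n (x + y) = mx_of_ffun x + mx_of_ffun y.
Proof. by apply/matrixP => i j; rewrite !mxE ffunE. Qed.

Lemma lin_solve_mx : exists f, mfun f /\
  forall s m n (K : finType) (phi : K -> 'M[int]_(m, n) -> int) (b : K -> int) A,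
  (m <= s)%N -> (n <= s)%N -> (#|K| <= s)%N ->
  (forall k A B, phi k (A + B) = phi k A + phi k B) ->
  (forall k (A : 'M_(m, n)), mxle 1 A -> (`|phi k A| <= s)%N) ->
  (forall k, (`|b k| <= s)%N) -> (forall k, phi k A = b k) ->
  exists B, (forall k, phi k B = b k) /\ mxle (f s) B.
Proof.
have [f [mf hf]] := lin_solve; exists (fun s => f (s * s + s)%N); split; first by mf_tac.
move=> s m n K phi b A ms ns Ks phiD phis bs Ab.
have [||||||y [yb by_]] := hf (s * s + s)%N _ K (fun k x => phi k (mx_of_ffun x)) b (ffun_of_mx A).
- by rewrite card_prod !card_ord; apply: leq_trans (leq_mul ms ns) (leq_addr _ _).
- by apply: leq_trans Ks (leq_addl _ _).
- by move=> k x y; rewrite mx_of_ffunD.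
- move=> k x x1; apply: leq_trans (leq_addl _ _); apply: phis => i j; by rewrite mxE.
- by move=> k; apply: leq_trans (bs k) (leq_addl _ _).
- by move=> k; rewrite ffun_of_mxK.
by exists (mx_of_ffun y); split=> // i j; rewrite mxE.
Qed.

Lemma lin_gen_mx : exists f, mfun f /\
  forall s m n (K : finType) (phi : K -> 'M[int]_(m, n) -> int),
  (m <= s)%N -> (n <= s)%N -> (#|K| <= s)%N ->
  (forall k A B, phi k (A + B) = phi k A + phi k B) ->
  (forall k (A : 'M_(m, n)), mxle 1 A -> (`|phi k A| <= s)%N) ->
  exists l (e : 'I_l -> 'M[int]_(m, n)), [/\ (l <= f s)%N,
    forall a k, phi k (e a) = 0, forall a, mxle (f s) (e a) &
    forall A, (forall k, phi k A = 0) -> exists z : 'I_l -> int, A = \sum_a z a *: e a].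
Proof.
have [f [mf hf]] := lin_gen; exists (fun s => f (s * s + s) + (s * s + s))%N; split.
  by mf_tac.
move=> s m n K phi ms ns Ks phiD phis.
have [||||l [e [ls e0 be ge]]] := hf (s * s + s)%N _ K (fun k (x : {ffun 'I_m * 'I_n ->
  int}) => phi k (mx_of_ffun x)).
- by rewrite card_prod !card_ord; apply: leq_trans (leq_mul ms ns) (leq_addr _ _).
- by apply: leq_trans Ks (leq_addl _ _).
- by move=> k x y; rewrite mx_of_ffunD.
- by move=> k x x1; apply: leq_trans (leq_addl _ _); apply: phis => i j; rewrite mxE.
exists l, (fun a => mx_of_ffun (e a)); split=> //.
- by apply: leq_trans ls (leq_addl _ _).
- by move=> a i j; rewrite mxE; apply: leq_trans (be _ _) (leq_addr _ _).
move=> A A0; have [|z Az] := ge (ffun_of_mx A).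
  by move=> k; rewrite ffun_of_mxK.
exists z; rewrite -[LHS]ffun_of_mxK Az; apply/matrixP => i j.
rewrite mxE sum_ffunE summxE; apply: eq_bigr => a _.
by rewrite ffun_mulz !mxE.
Qed.

Lemma intertwine_inv n (A X Y : 'M[int]_n) : A \in unitmx -> A *m X = Y *m A ->
  invmx A *m Y = X *m invmx A.
Proof.
move=> uA AX; apply: (can_inj (mulKmx uA)); apply: (can_inj (mulmxK uA)).
by rewrite !mulmxA mulmxV // mul1mx AX mulmxKV.
Qed.

(* The size parameter for the linear system [g X_k = Y_k g] with prescribed
   entries of [g]. *)
Definition com_size s := (s * s * s + s * s + 2 * (s * (s * 1)) + s)%N.

Section Commuting.
Variables (K : finType) (N : nat) (X Y : K -> 'M[int]_N) (mask : 'I_N -> 'I_N -> bool).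

Definition com_phi (k : (K * 'I_N * 'I_N) + ('I_N * 'I_N)) (A : 'M[int]_N) : int :=
  match k with
  | inl (k, i, j) => (A *m X k - Y k *m A) i j
  | inr (i, j) => if mask i j then A i j else 0
  end.

Lemma com_phiD k A B : com_phi k (A + B) = com_phi k A + com_phi k B.
Proof.
case: k => [[[k i] j]|[i j]] /=; last by case: ifP; rewrite ?addr0 // mxE.
have gen (C D : 'M[int]_N) : (C + D) i j = C i j + D i j by rewrite mxE.
by rewrite -gen mulmxDl mulmxDr opprD addrACA.
Qed.

Lemma com_phi_le s k (A : 'M[int]_N) : (N <= s)%N -> (forall k, mxle s (X k)) -> (forall k,
    mxle s (Y k)) ->
  mxle 1 A -> (`|com_phi k A| <= com_size s)%N.
Proof.
move=> Ns sX sY A1; case: k => [[[k i] j]|[i j]] /=; last first.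
  case: ifP => // _; apply: leq_trans (A1 i j) _.
  by rewrite /com_size; have := ltn_ord i; lia.
apply: leq_trans (mxle_sub (mxle_mul A1 (sX k)) (mxle_mul (sY k) A1) _ _) _.
rewrite /com_size muln1 mul1n addnn -mul2n.
have : (N * s <= s * s)%N by rewrite leq_mul2r Ns orbT.
by lia.
Qed.

Lemma com_card s : (N <= s)%N -> (#|K| <= s)%N ->
  (#|{: (K * 'I_N * 'I_N) + ('I_N * 'I_N)}| <= com_size s)%N.
Proof.
move=> Ns Ks; rewrite card_sum !card_prod !card_ord /com_size.
have h1 : (#|K| * N * N <= s * s * s)%N by rewrite !leq_mul.
have h2 : (N * N <= s * s)%N by rewrite leq_mul.
by lia.
Qed.
End Commuting.

Lemma leq_com_size s : (s <= com_size s)%N.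
Proof. by rewrite /com_size; lia. Qed.

Lemma mf_com_size f : mfun f -> mfun (fun s => com_size (f s)).
Proof. by move=> h; rewrite /com_size; mf_tac. Qed.

(* The group of unitriangular automorphisms is generated by bounded elements:
   it is filtered by the groups [1 + n] with [n] strictly triangular of depth
   [c], and modulo depth [c + 1] the map [n -> 1 + n] turns sums into products. *)
Lemma unitri_chain : exists f, mfun f /\ forall s (K : finType) N (X : K -> 'M[int]_N) l v,
  (N <= s)%N -> (#|K| <= s)%N -> (forall k, mxle s (X k)) ->
  unitri l v -> (forall k, v *m X k = X k *m v) -> chain (f s) X X v.
Proof.
have [f [mf hf]] := lin_gen_mx.
pose E s := (f (com_size s) + 1 + s)%N.
pose B s := (adj_bound (E s) + E s)%N.
have mE : mfun E by apply: mf_add mf_id; apply: mf_add (mf_const 1);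
  exact/mf_comp/mf_com_size/mf_id.
have mB : mfun B by apply: mf_add => //; exact: mf_adj_bound.
exists B; split=> // s K N X l v Ns Ks sX.
have sE : (s <= E s)%N by rewrite leq_addl.
have EB : (E s <= B s)%N by rewrite leq_addl.
pose Com (n : 'M[int]_N) := forall k, n *m X k = X k *m n.
have Com1 : Com 1%:M by move=> k; rewrite mul1mx mulmx1.
have ComD a b : Com a -> Com b -> Com (a + b).
  by move=> ha hb k; rewrite mulmxDl mulmxDr ha hb.
have ComN a : Com a -> Com (- a) by move=> ha k; rewrite mulNmx mulmxN ha.
have ComM a b : Com a -> Com b -> Com (a *m b).
  by move=> ha hb k; rewrite -mulmxA hb mulmxA ha mulmxA.
have ComV a : a \in unitmx -> Com a -> Com (invmx a).
  by move=> ua ha k; exact: intertwine_inv ua (ha k).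
have chain_com w : chain (B s) X X w -> Com w by case/chain_iso.
have sXB : forall k, mxle (B s) (X k).
  by move=> k; apply: mxleW (sX k) (leq_trans sE EB).
pose D c (n : 'M[int]_N) := strict l c n /\ Com n.
(* [Q c n] says that some product of bounded automorphisms agrees with [1 + n] modulo depth
   [c + 1]. *)
pose Q c n := exists2 w, chain (B s) X X w & D c n /\ D c.+1 (w - 1%:M - n).
have Dw c n w : (0 < c)%N -> D c n -> D c.+1 (w - 1%:M - n) -> D c (w - 1%:M).
  move=> c0 [n1 n2] [w1 w2]; have -> : w - 1%:M = (w - 1%:M - n) + n by rewrite subrK.
  by split; [apply: strict_add => //; exact: (strictW w1 (leqnSn c)) | exact: ComD].
have QD c a b : (0 < c)%N -> Q c a -> Q c b -> Q c (a + b).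
  move=> c0 [u cu [Da Du]] [w cw [Db Dw']].
  exists (u *m w); first exact: chain_trans cw cu.
  split; first by split; [exact: strict_add (proj1 Da) (proj1 Db) |
    exact: (ComD _ _ (proj2 Da) (proj2 Db))].
  (* The last term is a product of two elements of depth [c], hence of depth [2 c >= c + 1]. *)
  have -> : u *m w - 1%:M - (a + b) = (u - 1%:M - a) + (w - 1%:M - b) + (u - 1%:M) *m (w - 1%:M).
    rewrite mulmxBl mulmxBr mulmx1 !mul1mx; move: (u *m w) (1%:M : 'M[int]_N) => x y.
    by apply/matrixP => i j; rewrite !mxE; ring.
  have [h1 h2] := Dw _ _ _ c0 Da Du; have [h3 h4] := Dw _ _ _ c0 Db Dw'.
  split; last by apply: (ComD _ _ _ (ComM _ _ h2 h4)); apply: ComD; [case: Du | case: Dw'].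
  apply: strict_add; first by apply: strict_add; [case: Du | case: Dw'].
  by refine (strictW (strict_mul h1 h3) _); lia.
have main c : (0 < c)%N -> forall n, D c n -> Q c n.
  move=> c0 n [n1 n2].
  have [|||||l' [e [ls e0 be ge]]] := hf (com_size s) N N _ (com_phi X X (fun i j => (l i < l j +
    c)%N)).
  - exact: leq_trans Ns (leq_com_size s).
  - exact: leq_trans Ns (leq_com_size s).
  - exact: com_card.
  - by move=> k A A'; exact: com_phiD.
  - by move=> k A; exact: com_phi_le.
  have De a : D c (e a).
    split=> [i j ij|k]; first by have := e0 a (inr (i, j)); rewrite /= ij.
    apply/eqP; rewrite -subr_eq0; apply/eqP/matrixP => i j.
    by have := e0 a (inl (k, i, j)); rewrite /= => ->; rewrite mxE.
  have ue a : unitri l (1%:M + e a).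
    by apply/unitriE; rewrite addrAC subrr add0r; exact: (strictW (proj1 (De a)) c0).
  have be1 a : mxle (E s) (1%:M + e a).
    by refine (mxleW (mxle_add (@mxle1 N) (be a)) _); rewrite /E; lia.
  have ce a : Com (1%:M + e a) by apply: ComD => //; case: (De a).
  have Qe a : Q c (e a).
    exists (1%:M + e a).
      apply: chain1 => //; [by case: (unitri_inv (ue a)) | exact: mxleW (be1 a) EB | exact: ce].
    split; first exact: De.
    have -> : 1%:M + e a - 1%:M - e a = 0 by rewrite (addrC 1%:M) addrK subrr.
    by split=> [i j _|k]; rewrite ?mxE // mul0mx mulmx0.
  have Qe' a : Q c (- e a).
    have [uu uv] := unitri_inv (ue a).
    exists (invmx (1%:M + e a)).
      apply: chain1 => //; first by rewrite unitmx_inv.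
        by apply: mxle_inv (be1 a) => //; apply: leq_trans Ns sE.
      exact: (ComV _ uu (ce a)).
    split; first by split; [exact: strict_opp (proj1 (De a)) | exact: (ComN _ (proj2 (De a)))].
    have -> : invmx (1%:M + e a) - 1%:M - - e a = invmx (1%:M + e a) *m (e a *m e a).
      apply: (can_inj (mulKmx uu)).
      rewrite (mulmxA _ (invmx _)) mulmxV // mul1mx opprK mulmxDr mulmxBr mulmxV // mulmx1.
      by rewrite mulmxDl mul1mx; apply/matrixP => i j; move: (e a *m e a) => z; rewrite !mxE; ring.
    split; last by apply: (ComM _ _ _ (ComM _ _ (proj2 (De a)) (proj2 (De a)))); exact: (ComV _ uu).
    by refine (strictW (strict_mul (unitri_strict0 uv) (strict_mul (proj1 (De a)) (proj1 (De
      a)))) _); lia.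
  have Q0 : Q c 0.
    have D0 c' : D c' 0 by split=> [i j _|k]; rewrite ?mxE // mul0mx mulmx0.
    by exists 1%:M; [exact: chain0 | rewrite subrr subr0].
  have [|z ->] := ge n.
    case=> [[[k i] j]|[i j]] /=; first by rewrite n2 subrr mxE.
    by case: ifP => // ij; rewrite n1.
  elim/big_ind: _ => [//|a b|a _]; first exact: QD.
  case: (z a) => m.
    by elim: m => [|m IH]; rewrite ?scale0r // -add1n PoszD scalerDl scale1r; apply: QD.
  rewrite NegzE scaleNr -scalerN; elim: m => [|m IH]; first by rewrite scale1r.
  by rewrite -add1n PoszD scalerDl scale1r; apply: QD.
move=> uv cv.
have [M lM] := level_bound l.
(* Dividing by the approximation raises the depth of the remainder by one, until it exceeds all
   levels. *)
have ind d : forall c, (0 < c)%N -> (M <= c + d)%N -> forall n, D c n -> chain (B s) X X (1%:M + n).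
  elim: d => [|d IH] c c0 Mcd n Dn.
    rewrite addn0 in Mcd; have -> : n = 0 := strict_big lM (strictW (proj1 Dn) Mcd).
    by rewrite addr0; exact: chain0.
  have [w cw [_ Dw']] := main c c0 n Dn.
  have [w1 w2] := Dw _ _ _ c0 Dn Dw'.
  have uw : unitri l w by apply/unitriE; exact: (strictW w1 c0).
  have [uu ui] := unitri_inv uw.
  have -> : 1%:M + n = w *m (1%:M + invmx w *m (- (w - 1%:M - n))).
    rewrite mulmxDr mulmx1 mulmxA mulmxV // mul1mx.
    by apply/matrixP => i j; rewrite !mxE; ring.
  refine (chain_trans _ cw); apply: (IH c.+1) => //; first by move: Mcd; lia.
  split; first exact: (strict_mul (unitri_strict0 ui) (strict_opp (proj1 Dw'))).
  by apply: ComM; [apply: (ComV _ uu (chain_com _ cw)) | apply: ComN; case: Dw'].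
have -> : v = 1%:M + (v - 1%:M) by rewrite addrC subrK.
apply: (ind M 1%N) => //.
split; first exact/unitriE.
by apply: ComD => //; exact: ComN.
Qed.

Lemma mul_inv_det n (A B : 'M[int]_n) : A *m B \in unitmx -> A \in unitmx /\ B \in unitmx.
Proof. by rewrite unitmx_mul => /andP[]. Qed.

(* A block triangular isomorphism differs from a bounded one with the same
   diagonal blocks by a unitriangular automorphism. *)
Lemma triangular_chain : exists f, mfun f /\
  forall s (K : finType) N (X Y : K -> 'M[int]_N) (la lb : 'I_N -> nat) (g : 'M[int]_N),
  (N <= s)%N -> (#|K| <= s)%N -> (forall k, mxle s (X k)) -> (forall k, mxle s (Y k)) ->
  g \in unitmx -> (forall k, g *m X k = Y k *m g) ->
  tri la lb g -> tri lb la (invmx g) -> (forall i j, la i = lb j -> (`|g i j| <= s)%N) ->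
  chain (f s) X Y g.
Proof.
have [f [mf hf]] := lin_solve_mx; have [f2 [mf2 hf2]] := unitri_chain.
pose F s := (f (com_size s) + s)%N.
exists (fun s => f2 s + F s)%N; split.
  apply: mf_add => //; apply: mf_add mf_id; apply: mf_comp => //; exact: mf_com_size mf_id.
move=> s K N X Y la lb g Ns Ks sX sY ug cg tg tg' dg.
(* The system prescribes the entries of [g] in the diagonal blocks, which are bounded, and above
   them, where they vanish; the entries below are free. *)
pose mask i j := (la i <= lb j)%N.
have [|||||||g1 [h1 bg1]] := hf (com_size s) N N _ (com_phi X Y mask)
    (fun k => match k with inl _ => 0 | inr (i, j) => if mask i j then g i j else 0 end) g.
- exact: leq_trans Ns (leq_com_size s).
- exact: leq_trans Ns (leq_com_size s).
- exact: com_card.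
- by move=> k A B; exact: com_phiD.
- by move=> k A; exact: com_phi_le.
- case=> // -[i j]; case: ifP => // ij; apply: leq_trans (leq_com_size s).
  by move: ij; rewrite /mask leq_eqVlt => /orP[/eqP/dg//|/tg->].
- by case=> [[[k i] j]|[i j]] //=; rewrite cg subrr mxE.
have c1 k : g1 *m X k = Y k *m g1.
  apply/eqP; rewrite -subr_eq0; apply/eqP/matrixP => i j.
  by have := h1 (inl (k, i, j)); rewrite /= => ->; rewrite mxE.
have d1 : deq la lb g1 g.
  by move=> i j ij; have := h1 (inr (i, j)); rewrite /= /mask ij.
pose w := invmx g *m g1.
have uw : unitri lb w.
  by rewrite /unitri -(mulVmx ug); apply: deq_mul tg' tg _ d1.
have [ww wi] := unitri_inv uw.
have ug1 : g1 \in unitmx by case/mul_inv_det: ww.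
have -> : g = g1 *m invmx w.
  by rewrite -[g1](mulKVmx ug) -/w -mulmxA mulmxV // mulmx1.
apply: (@chain_trans _ _ _ X X Y).
  apply: chain_mono (leq_addr _ _) _; apply: hf2 => // k.
    exact: wi.
  by apply: intertwine_inv => //; rewrite /w -!mulmxA c1 !mulmxA (intertwine_inv ug (cg k)).
apply: chain1 => //.
- by move=> k; apply: mxleW (sX k) _; rewrite /F; lia.
- by move=> k; apply: mxleW (sY k) _; rewrite /F; lia.
- by apply: mxleW bg1 _; rewrite /F; lia.
Qed.

(* Invariant pure sublattices have invariant rational complements: [U] projects
   on the sublattice and [P / D] is an equivariant projection on it. *)
Definition semisimple (K : Type) N (X : K -> 'M[int]_N) := forall U : 'M[int]_N,
  U *m U = U -> (forall k, U *m X k = U *m X k *m U) ->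
  exists D (P : 'M[int]_N), [/\ 0 < D, forall k, P *m X k = X k *m P, U *m P = D *: U & P *m U = P].

Lemma semisimple_conj (K : Type) N (X : K -> 'M[int]_N) b : b \in unitmx ->
  semisimple X -> semisimple (fun k => b *m X k *m invmx b).
Proof.
move=> ub sX U UU UX.
have [||D [P [D0 PX UP PU]]] := sX (invmx b *m U *m b).
- by rewrite -!mulmxA (mulmxA b) mulmxV // mul1mx (mulmxA U U) UU.
- move=> k; have := congr1 (fun M => invmx b *m M *m b) (UX k).
  by rewrite !mulmxA mulmxKV // => ->; rewrite !mulmxA -(mulmxA _ (invmx b) b) mulVmx // mulmx1.
exists D, (b *m P *m invmx b); split=> //.
- by move=> k; rewrite !mulmxA mulmxKV // -(mulmxA b P) PX !mulmxA mulmxKV.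
- have := congr1 (fun M => b *m M *m invmx b) UP.
  by rewrite -scalemxAr -scalemxAl !mulmxA mulmxV // mul1mx mulmxK // => ->.
- have := congr1 (fun M => b *m M *m invmx b) PU.
  by rewrite !mulmxA -(mulmxA _ b (invmx b)) mulmxV // mulmx1.
Qed.

(** The cost of one level: two sums of at most [N] products, each at most the previous bound once
    divided by [D]. *)
Definition nf_step x := (x * (x + x) + x)%N.

(* Semisimplicity makes the part of [X] below the diagonal blocks a rational
   coboundary; subtracting the coboundary of the integral part leaves a
   bounded remainder.  This is done one level at a time. *)
Lemma normal_form s (K : finType) N (X : K -> 'M[int]_N) (l : 'I_N -> nat) :
  (N <= s)%N -> (forall i, (l i <= s)%N) -> semisimple X ->
  (forall k, tri l l (X k)) -> (forall k i j, l i = l j -> (`|X k i j| <= s)%N) ->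
  exists Z, unitri l Z /\ forall k, mxle (iter s.+1 nf_step s) (Z *m X k *m invmx Z).
Proof.
move=> Ns ls sX tX dX.
suff main c : exists Z, unitri l Z /\ forall k i j, (l i < c)%N ->
    (`|(Z *m X k *m invmx Z) i j| <= iter c nf_step s)%N.
  have [Z [uZ hZ]] := main s.+1; exists Z; split=> // k i j.
  by apply: hZ; rewrite ltnS.
elim: c => [|c [Z [uZ hZ]]]; first by exists 1%:M.
have [uu ui] := unitri_inv uZ.
pose Y k := Z *m X k *m invmx Z.
have tY k : tri l l (Y k) by apply: tri_mul (tri_mul (unitri_tri uZ) (tX k)) (unitri_tri ui).
have dY k : deq l l (Y k) (X k).
  rewrite -[X k]mulmx1 -[X k]mul1mx; apply: deq_mul ui; rewrite ?mul1mx //; first exact: tri1.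
  by rewrite -[X in deq _ _ _ X]mul1mx; apply: deq_mul => //; exact: tri1.
have sY : semisimple Y := semisimple_conj uu sX.
(* As [Y] is triangular, the coordinates of level below [c] span an invariant sublattice, and
   semisimplicity supplies an equivariant projection [P / D] on it. *)
pose U : 'M[int]_N := \matrix_(i, j) ((i == j) && (l i < c)%N)%:R.
have UA (A : 'M[int]_N) i j : (U *m A) i j = if (l i < c)%N then A i j else 0.
  rewrite mxE (bigD1 i) //= big1 ?addr0 => [|k ki]; last by rewrite mxE eq_sym (negPf ki) mul0r.
  by rewrite mxE eqxx /=; case: ifP; rewrite ?mul1r ?mul0r.
have AU (A : 'M[int]_N) i j : (A *m U) i j = if (l j < c)%N then A i j else 0.
  rewrite mxE (bigD1 j) //= big1 ?addr0 => [|k ki]; last by rewrite mxE (negPf ki) mulr0.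
  by rewrite mxE eqxx /=; case: ifP; rewrite ?mulr1 ?mulr0.
have [||D [P [D0 PY UP PU]]] := sY U.
- by apply/matrixP => i j; rewrite UA mxE; case: ltnP; rewrite ?andbF.
- move=> k; apply/matrixP => i j; rewrite AU UA; case: (ltnP (l i) c) => lic; last by case: ifP.
  by case: ltnP => // clj; rewrite tY // (leq_trans lic).
have P0 i j : (c <= l j)%N -> P i j = 0.
  by move=> clj; rewrite -PU AU ltnNge clj.
have PD i j : (l i < c)%N -> P i j = D * (i == j)%:R.
  by move=> lic; have := congr1 (fun M : 'M[int]_N => M i j) UP; rewrite UA lic => ->;
    rewrite !mxE lic andbT.
(* Up to sign, the integral part of [P / D] in the rows of level [c]. *)
pose z : 'M[int]_N := \matrix_(i, j) (if (l i == c) && (l j < c)%N then - (P i j %/ D)%Z else 0).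
have zz : z *m z = 0.
  apply/matrixP => i j; rewrite !mxE big1 // => k _; rewrite !mxE.
  case: (ltnP (l k) c) => lkc; last by rewrite andbF mul0r.
  by rewrite (ltn_eqF lkc) mulr0.
have sz : strict l 1 z.
  move=> i j ij; rewrite mxE; case: ifP => // /andP[/eqP li lj].
  by move: ij lj; rewrite li; lia.
pose V := 1%:M + z.
have uV : unitri l V by apply/unitriE; rewrite /V addrC addKr.
have Vi : invmx V = 1%:M - z.
  have h : V *m (1%:M - z) = 1%:M by rewrite mulmxBr mulmx1 mulmxDl zz addr0 mul1mx addrK.
  by have [uVV _] := mulmx1_unit h; rewrite -[RHS](mulKmx uVV) h mulmx1.
exists (V *m Z); split; first exact: unitri_mul.
move=> k i j lic.
have -> : V *m Z *m X k *m invmx (V *m Z) = V *m Y k *m (1%:M - z).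
  rewrite -Vi /Y; have [uVV _] := unitri_inv uV.
  have -> : invmx (V *m Z) = invmx Z *m invmx V.
    have uVZ : V *m Z \in unitmx by rewrite unitmx_mul uVV.
    apply: (can_inj (mulKmx uVZ)); rewrite mulmxV // -!mulmxA (mulmxA Z) mulmxV // mul1mx.
    by rewrite mulmxV.
  by rewrite !mulmxA.
have zA (A : 'M[int]_N) a b : l a != c -> (z *m A) a b = 0.
  by move=> la; rewrite mxE big1 // => t _; rewrite [z a t]mxE (negPf la) mul0r.
set b := iter c nf_step s.
have sb : (s <= b)%N by apply: leq_iter => y; rewrite /nf_step leq_addl.
rewrite iterS -/b.
have E : (V *m Y k *m (1%:M - z)) i j = (V *m Y k) i j - (V *m Y k *m z) i j.
  by rewrite mulmxBr mulmx1 !mxE.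
have E1 : (V *m Y k) i j = Y k i j + (z *m Y k) i j by rewrite mulmxDl mul1mx mxE.
have E2 : (V *m Y k *m z) i j = (Y k *m z) i j + (z *m Y k *m z) i j.
  by rewrite mulmxDl mul1mx mulmxDl mxE.
have zYz : z *m Y k *m z = 0.
  apply/matrixP => p q; rewrite mxE big1 ?mxE // => t _.
  have [tc|tc] := eqVneq (l t) c; last by rewrite [z t q]mxE (negPf tc) mulr0.
  rewrite mxE big1 ?mul0r // => r _; rewrite [z p r]mxE; case: (ltnP (l r) c) => lrc;
    last by rewrite andbF mul0r.
  by rewrite tY ?mulr0 // tc.
rewrite E E1 E2 zYz [(0 : 'M_(_, _)) _ _]mxE addr0.
move: lic; rewrite ltnS leq_eqVlt => /orP[/eqP lic|lic]; last first.
  rewrite zA ?addr0 ?(ltn_eqF lic) //.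
  have -> : (Y k *m z) i j = 0.
    rewrite mxE big1 // => t _; have [tc|tc] := eqVneq (l t) c.
      by rewrite tY ?mul0r // tc.
    by rewrite [z t j]mxE (negPf tc) mulr0.
  by rewrite subr0; apply: leq_trans (hZ k i j lic) _; rewrite /nf_step leq_addl.
have [jc|jc] := ltnP (l j) c; last first.
  have -> : (z *m Y k) i j = 0.
    rewrite mxE big1 // => t _; rewrite [z i t]mxE; case: (ltnP (l t) c) => ltc;
      last by rewrite andbF mul0r.
    by rewrite tY ?mulr0 // (leq_trans ltc).
  have -> : (Y k *m z) i j = 0.
    by rewrite mxE big1 // => t _; rewrite [z t j]mxE (ltnNge (l j)) jc andbF mulr0.
  rewrite addr0 subr0 dY ?lic //.
  move: jc; rewrite leq_eqVlt => /orP[/eqP jc|jc].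
    by apply: leq_trans (dX k i j _) _; rewrite ?lic // (leq_trans sb) // /nf_step leq_addl.
  by rewrite tX ?lic.
pose rho a b := (P a b %% D)%Z.
have rhoE a t : l a = c -> (l t < c)%N -> P a t = - D * z a t + rho a t.
  by move=> ac tc; rewrite mxE ac eqxx tc mulrNN mulrC {1}(divz_eq (P a t) D).
have bnd (x y : int) (M : nat) : (`|y| <= M)%N -> `|(x %% D)%Z * y| <= D * M%:Z.
  move=> yM; rewrite normrM; apply: ler_pM; rewrite ?normr_ge0 // -?abszE ?lez_nat //.
  by rewrite abszE ger0_norm ?modz_ge0 ?gt_eqF // ltW // ltz_pmod.
have PYE : (P *m Y k) i j = - D * (z *m Y k) i j + \sum_(a | (l a < c)%N) rho i a * Y k a j.
  rewrite [in LHS]mxE [in RHS]mxE mulr_sumr [in LHS](bigID (fun a => (l a < c)%N)) /=.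
  rewrite [X in _ + X = _]big1 ?addr0; last by move=> a; rewrite -leqNgt => ca; rewrite P0 ?mul0r.
  rewrite [in RHS](bigID (fun a => (l a < c)%N)) /= [X in _ + X + _]big1 ?addr0; last first.
    by move=> a ca; rewrite [z i a]mxE (negPf ca) andbF mul0r mulr0.
  rewrite -big_split /=; apply: eq_bigr => a ac.
  by rewrite (rhoE i a) // mulrDl mulrA.
have YPE : (Y k *m P) i j = D * Y k i j - D * (Y k *m z) i j + \sum_(a |
  l a == c) Y k i a * rho a j.
  rewrite [in LHS]mxE [in LHS](bigID (fun a => (l a < c)%N)) /= -addrA; congr (_ + _).
    rewrite (bigD1 j) //= big1 ?addr0 => [|a /andP[ac aj]].
      by rewrite PD // eqxx mulr1 mulrC.
    by rewrite PD // (negPf aj) !mulr0.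
  rewrite [(Y k *m z) i j]mxE mulr_sumr -sumrN.
  rewrite (bigID (fun a => l a == c)) /= [X in _ + X = _]big1 ?addr0; last first.
    by move=> a /andP[]; rewrite -leqNgt leq_eqVlt eq_sym => /orP[->//|ca] _;
      rewrite tY ?mul0r // lic.
  rewrite [in RHS](bigID (fun a => l a == c)) /= [X in _ + X + _]big1 ?addr0; last first.
    by move=> a ac; rewrite [z a j]mxE (negPf ac) !mulr0 oppr0.
  rewrite -big_split /=; apply: eq_big => [a|a /andP[_ /eqP ac]].
    by case: eqP => [->|_]; rewrite ?ltnn ?andbF.
  by rewrite (rhoE a j) //; ring.
(* This compares entries of [P *m Y k] and [Y k *m P]. The left side is [D] times the new entry; the
   remainders [rho] lie between [0] and [D], and the entries of [Y] on the right have lower level or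
   lie in a diagonal block, so dividing by [D] leaves a bound. *)
have key : D * (Y k i j + (z *m Y k) i j - (Y k *m z) i j) =
    \sum_(a | (l a < c)%N) rho i a * Y k a j - \sum_(a | l a == c) rho a j * Y k i a.
  have := congr1 (fun M : 'M[int]_N => M i j) (PY k); rewrite /= PYE YPE => h.
  have -> : \sum_(a | l a == c) rho a j * Y k i a = \sum_(a | l a == c) Y k i a * rho a j.
    by apply: eq_bigr => a _; rewrite mulrC.
  have ring_id (x y p q r t d : int) : - d * y + p = d * x - d * q + t -> d * (x + y - q) = p - t.
    by lia.
  exact: ring_id h.
have sum_bnd (Q : pred 'I_N) (F : 'I_N -> int) (M : nat) :
    (forall a, Q a -> `|F a| <= D * M%:Z) -> `|\sum_(a | Q a) F a| <= D * (N * M)%:Z.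
  move=> hF; apply: le_trans (ler_norm_sum _ _ _) _.
  apply: (@le_trans _ _ (\sum_(a < N) D * M%:Z)).
    rewrite big_mkcond; apply: ler_sum => a _; case: ifP => [/hF //|_].
    by rewrite mulr_ge0 // ltW.
  by rewrite sumr_const card_ord -[X in X <= _]mulr_natr (natz N) PoszM; lia.
rewrite -lez_nat abszE -(ler_pM2l D0).
have -> : D * `|Y k i j + (z *m Y k) i j - (Y k *m z) i j| =
   `|D * (Y k i j + (z *m Y k) i j - (Y k *m z) i j)| by rewrite normrM (gtr0_norm D0).
rewrite key; apply: le_trans (ler_normB _ _) _.
apply: le_trans (lerD (sum_bnd _ _ b _) (sum_bnd _ _ b _)) _.
- by move=> a ac; apply: bnd; apply: hZ.
- move=> a /eqP ac; apply: bnd; rewrite dY ?lic ?ac //.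
  by apply: leq_trans (dX k i a _) sb; rewrite lic ac.
rewrite -mulrDr ler_pM2l // -PoszD lez_nat /nf_step.
have := leq_mul (leq_trans Ns sb) (leqnn b); lia.
Qed.

(** * Reduced bases and the transitions between them *)

Definition orth n (c : nat) (G b : 'M[int]_n) := b \in unitmx /\
  forall (v : 'rV[int]_n) i, v 0 i ^+ 2 * qf G (row i b) <= c%:Z * qf G (v *m b).

Definition gaps n (T : nat) (G b : 'M[int]_n) (l : 'I_n -> nat) :=
  forall i j, (l j < l i)%N -> T%:Z * qf G (row j b) < qf G (row i b).

Lemma posdef_row n (G b : 'M[int]_n) i : posdef G -> b \in unitmx -> 0 < qf G (row i b).
Proof.
move=> [_ pG] ub; apply: pG; apply/eqP => /(congr1 (mulmx^~ (invmx b))).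
rewrite mul0mx -row_mul mulmxV // => /rowP/(_ i).
by rewrite !mxE eqxx.
Qed.

Lemma orth_coef n c (G b g : 'M[int]_n) i j : orth c G b ->
  (g *m invmx b) i j ^+ 2 * qf G (row j b) <= c%:Z * qf G (row i g).
Proof.
move=> [ub ob]; have := ob (row i (g *m invmx b)) j.
by rewrite mxE -row_mul mulmxKV.
Qed.

(** The square of an integer is zero as soon as it is less than one. This turns estimates of norms
    into block triangularity. *)
Lemma sqr_small (a x y : int) (c : nat) : a ^+ 2 * x <= c%:Z * y -> 0 < x -> c%:Z * y < x -> a = 0.
Proof.
move=> h x0 yx; apply/eqP; apply: contraT => a0.
have : 1 <= a ^+ 2 by rewrite expr2; nia.
by move: (a ^+ 2) h => t h; nia.
Qed.

Lemma absz_le_sqr (a : int) (m : nat) : a ^+ 2 <= m%:Z -> (`|a| <= m)%N.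
Proof. by rewrite expr2 => h; have [->//|a0] := eqVneq a 0; nia. Qed.

Lemma sqr_bound (a x y : int) (c d : nat) : a ^+ 2 * x <= c%:Z * y -> 0 < x -> y <= d%:Z * x ->
  (`|a| <= c * d)%N.
Proof.
move=> h x0 yx; apply: absz_le_sqr; rewrite -(ler_pM2r x0).
have -> : (c * d)%:Z * x = c%:Z * (d%:Z * x) by rewrite PoszM mulrA.
by apply: (le_trans h); apply: ler_wpM2l.
Qed.

(** In a reduced basis, an entry of an operator satisfies [a ^ 2 * q(b_j) <= c * C * q(b_i)]. It
    vanishes if [b_j] lies in a higher cluster than [b_i] and is bounded if both lie in the same
    one, which is what [normal_form] asks for. *)
Lemma reduced_normal_form s t (K : finType) N (X : K -> 'M[int]_N) (G b : 'M[int]_N) (c C T : nat) :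
  (N <= s)%N -> (c * C * T ^ N <= s)%N -> (c * C <= T)%N -> (t <= T)%N -> (0 < T)%N ->
  posdef G -> orth c G b ->
  (forall k v, qf G (v *m X k) <= C%:Z * qf G v) -> semisimple X ->
  exists l Z, [/\ unitri l Z, gaps t G b l &
    forall k, mxle (iter s.+1 nf_step s) (Z *m b *m X k *m invmx (Z *m b))].
Proof.
move=> Ns cs cT tT T0 pG ob CX sX; have ub := proj1 ob.
have n0 i : 0 < qf G (row i b) by exact: posdef_row.
have [l [l1 l2 l3]] := cluster T0 n0.
have aX k i j : (b *m X k *m invmx b) i j ^+ 2 * qf G (row j b) <= (c * C)%:Z * qf G (row i b).
  apply: le_trans (orth_coef _ i j ob) _; rewrite PoszM -mulrA; apply: ler_wpM2l => //.
  by rewrite row_mul.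
have [||||Z [uZ bZ]] := @normal_form s K N (fun k => b *m X k *m invmx b) l Ns.
- by move=> i; apply: leq_trans (l1 i) _; rewrite card_ord.
- exact: semisimple_conj.
- move=> k i j ij; apply: sqr_small (aX k i j) (n0 j) _.
  apply: le_lt_trans (l2 _ _ ij); apply: ler_wpM2r; first exact: ltW.
  by rewrite lez_nat.
- move=> k i j ij; apply: leq_trans cs; apply: sqr_bound (aX k i j) (n0 j) _.
  by have := l3 _ _ ij; rewrite card_ord.
exists l, Z; split=> //.
  move=> i j ij; apply: le_lt_trans (l2 _ _ ij); apply: ler_wpM2r; first exact: ltW.
  by rewrite lez_nat.
move=> k; have -> // : Z *m b *m X k *m invmx (Z *m b) = Z *m (b *m X k *m invmx b) *m invmx Z.
have [uu _] := unitri_inv uZ; have uZb : Z *m b \in unitmx by rewrite unitmx_mul uu.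
by apply: (can_inj (mulmxK uZb)); rewrite mulmxKV // !mulmxA mulmxKV // mulmxKV.
Qed.

(** The levels [la] come from another clustering, whose clusters have ratio at most [T]. A nonzero
    off-diagonal entry of [Z] spans a gap wider than [T], so it goes strictly down for [la] too. *)
Lemma unitri_gaps n (G b Z : 'M[int]_n) (l la : 'I_n -> nat) (T : nat) :
  (forall i, 0 < qf G (row i b)) -> (0 < T)%N ->
  unitri l Z -> gaps T G b l ->
  (forall i j, (la j < la i)%N -> qf G (row j b) <= qf G (row i b)) ->
  (forall i j, la i = la j -> qf G (row i b) <= T%:Z * qf G (row j b)) -> unitri la Z.
Proof.
move=> n0 T0 uZ gT h1 h2 i j ij; have [lij|lji] := leqP (l i) (l j); first exact: uZ.
have := gT _ _ lji; rewrite ltNge => /negP[].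
move: ij; rewrite leq_eqVlt => /orP[/eqP/h2//|/h1 h].
by apply: le_trans h _; rewrite ler_peMl ?lez_nat // ltW.
Qed.

(* Two adjusted bases reduced for the same form: clustering the norms of both
   bases together makes the transition matrix block triangular. *)
Lemma transition_chain : exists f, mfun f /\
  forall s (K : finType) N (X : K -> 'M[int]_N) (G b b' Z Z' : 'M[int]_N) (l l' : 'I_N ->
    nat) (c : nat),
  (N <= s)%N -> (#|K| <= s)%N -> (0 < c)%N -> (c * c ^ (N + N) <= s)%N -> posdef G ->
  orth c G b -> orth c G b' -> unitri l Z -> unitri l' Z' ->
  gaps (c ^ (N + N)) G b l -> gaps (c ^ (N + N)) G b' l' ->
  (forall k, mxle s (Z *m b *m X k *m invmx (Z *m b))) ->
  (forall k, mxle s (Z' *m b' *m X k *m invmx (Z' *m b'))) ->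
  chain (f s) (fun k => Z *m b *m X k *m invmx (Z *m b))
    (fun k => Z' *m b' *m X k *m invmx (Z' *m b')) (Z' *m b' *m invmx (Z *m b)).
Proof.
have [f [mf hf]] := triangular_chain; exists f; split=> //.
move=> s K N X G b b' Z Z' l l' c Ns Ks c0 cs pG ob ob' uZ uZ' gb gb' sX sX'.
have ub := proj1 ob; have ub' := proj1 ob'.
have n0 i : 0 < qf G (row i b) by exact: posdef_row.
have n0' i : 0 < qf G (row i b') by exact: posdef_row.
pose nn (i : 'I_N + 'I_N) := match i with inl i => qf G (row i b) | inr i => qf G (row i b') end.
have nn0 i : 0 < nn i by case: i.
have [L [_ L2 L3]] := cluster c0 nn0; rewrite card_sum card_ord in L3.
pose lb i := L (inl i); pose la i := L (inr i).
have c1 : 1 <= c%:Z by rewrite lez_nat.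
have lem x y : 0 < y -> c%:Z * x < y -> 0 < x -> x <= y.
  by move=> y0 /ltW xy x0; apply: le_trans xy; rewrite ler_peMl // ltW.
have cc0 : (0 < c ^ (N + N))%N by rewrite expn_gt0 c0.
have uZb : unitri lb Z.
  apply: (unitri_gaps n0 cc0 uZ gb) => i j ij; last exact: (L3 (inl i) (inl j)).
  by apply: lem => //; exact: (L2 (inl i) (inl j)).
have uZa : unitri la Z'.
  apply: (unitri_gaps n0' cc0 uZ' gb') => i j ij; last exact: (L3 (inr i) (inr j)).
  by apply: lem => //; exact: (L2 (inr i) (inr j)).
have [uu ui] := unitri_inv uZb; have [uu' ui'] := unitri_inv uZa.
have uZB : Z *m b \in unitmx by rewrite unitmx_mul uu.
have uZB' : Z' *m b' \in unitmx by rewrite unitmx_mul uu'.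
have inv_mul (A B : 'M[int]_N) : A \in unitmx -> B \in unitmx ->
  invmx (A *m B) = invmx B *m invmx A.
  move=> uA uB; have uAB : A *m B \in unitmx by rewrite unitmx_mul uA.
  apply: (can_inj (mulKmx uAB)); rewrite mulmxV // -!mulmxA (mulmxA B) mulmxV // mul1mx.
  by rewrite mulmxV.
pose g := b' *m invmx b.
have gE : Z' *m b' *m invmx (Z *m b) = Z' *m g *m invmx Z by rewrite inv_mul // !mulmxA.
have gE' : invmx (Z' *m b' *m invmx (Z *m b)) = Z *m (b *m invmx b') *m invmx Z'.
  by rewrite inv_mul ?unitmx_inv // invmxK inv_mul // !mulmxA.
have tg : tri la lb g.
  by move=> i j ij; apply: sqr_small (orth_coef b' i j ob) (n0 j) _; exact: (L2 (inl j) (inr i)).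
have tg' : tri lb la (b *m invmx b').
  by move=> i j ij; apply: sqr_small (orth_coef b i j ob') (n0' j) _; exact: (L2 (inr j) (inl i)).
apply: hf => //.
- by rewrite unitmx_mul unitmx_inv uZB'.
- move=> k; move: (Z *m b) (Z' *m b') uZB uZB' => A A' uA uA'.
  by rewrite !mulmxA mulmxKV // mulmxKV.
- by rewrite gE; apply: tri_mul (tri_mul (unitri_tri uZa) tg) (unitri_tri ui).
- by rewrite gE'; apply: tri_mul (tri_mul (unitri_tri uZb) tg') (unitri_tri ui').
move=> i j ij.
have -> : (Z' *m b' *m invmx (Z *m b)) i j = g i j.
  have d : deq la lb (Z' *m b' *m invmx (Z *m b)) (1%:M *m g *m 1%:M).
    rewrite gE; apply: (@deq_mul _ _ _ la lb lb) => //; first by rewrite mul1mx.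
      exact: tri1.
    by apply: (@deq_mul _ _ _ la la lb) => //; exact: tri1.
  by rewrite d ?ij // mul1mx mulmx1.
apply: leq_trans cs; apply: sqr_bound (orth_coef b' i j ob) (n0 j) _.
exact: (L3 (inr i) (inl j) ij).
Qed.

(** Bounds the square of the Euclidean operator norm; the power of two comes from [qf_sum_le]. *)
Definition norm_bound s := (2 ^ s * (s * (s * s)))%N.

Lemma qf1 n (v : 'rV[int]_n) : qf 1%:M v = \sum_i v 0 i ^+ 2.
Proof. by rewrite /qf mulmx1 mxE; apply: eq_bigr => i _; rewrite mxE expr2. Qed.

Lemma posdef1 n : posdef (1%:M : 'M[int]_n).
Proof.
split; first exact: trmx1.
move=> v v0; rewrite qf1 lt_neqAle sumr_ge0 ?andbT => [|i _]; last exact: sqr_ge0.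
apply: contra v0; rewrite eq_sym psumr_eq0 => [/allP h|i _]; last exact: sqr_ge0.
by apply/eqP/rowP => i; have := h i (mem_index_enum i); rewrite /= sqrf_eq0 mxE => /eqP.
Qed.

Lemma norm_mul_le s n (A : 'M[int]_n) (v : 'rV[int]_n) : (n <= s)%N -> mxle s A ->
  qf 1%:M (v *m A) <= (norm_bound s)%:Z * qf 1%:M v.
Proof.
move=> ns sA; rewrite mulmx_sum_row.
apply: le_trans (qf_sum_le (fun i => v 0 i *: row i A) (@posdef1 n)) _.
rewrite /norm_bound PoszM -mulrA; apply: ler_pM => //.
- by apply: sumr_ge0 => i _; apply: qf_ge0; exact: posdef1.
- by rewrite lez_nat leq_exp2l.
rewrite qf1 mulr_sumr; apply: ler_sum => i _; rewrite qfZ mulrC; apply: ler_wpM2r.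
  exact: sqr_ge0.
rewrite qf1; apply: (@le_trans _ _ (\sum_(j < n) (s * s)%:Z)).
  apply: ler_sum => j _; rewrite mxE.
  have := sA i j; rewrite expr2; move: (A i j) => x xs; rewrite PoszM; nia.
rewrite sumr_const card_ord -[X in X <= _]mulr_natl (natz n) -PoszM lez_nat.
by rewrite leq_mul2r ns orbT.
Qed.

Lemma qf_lin n (G H : 'M[int]_n) a b v : qf (a *: G + b *: H) v = a * qf G v + b * qf H v.
Proof.
rewrite /qf mulmxDr mulmxDl -!scalemxAr -!scalemxAl.
by move: (v *m G *m v^T) (v *m H *m v^T) => x y; rewrite !mxE.
Qed.

Lemma posdef_lin n (G H : 'M[int]_n) (a b : nat) : (0 < a + b)%N -> posdef G -> posdef H ->
  posdef (a%:Z *: G + b%:Z *: H).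
Proof.
move=> ab pG pH; split; first by rewrite linearD /= !linearZ /= (proj1 pG) (proj1 pH).
move=> v v0; rewrite qf_lin; have := proj2 pG v v0; have := proj2 pH v v0.
by move: (qf G v) (qf H v) => x y; nia.
Qed.

Lemma mxle_exists m n (A : 'M[int]_(m, n)) : exists b, mxle b A.
Proof.
exists (\sum_i \sum_j `|A i j|)%N => i j.
by rewrite (bigD1 i) //= (bigD1 j) //= -!addnA leq_addr.
Qed.

(* Moving along the segment of forms from [1] to [g^-1 (g^-1)^T] in small
   steps and reducing at each step factors [g].  All these forms satisfy
   [q(v X_k) <= C q(v)], a condition convex in [q], so that the reduced and
   normalised representations met on the way are bounded. *)
Lemma semisimple_chain : exists f, mfun f /\
  forall s (K : finType) N (X Y : K -> 'M[int]_N) g,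
  (N <= s)%N -> (#|K| <= s)%N -> (forall k, mxle s (X k)) -> (forall k, mxle s (Y k)) ->
  semisimple X -> g \in unitmx -> (forall k, g *m X k = Y k *m g) -> chain (f s) X Y g.
Proof.
have [f [mf hf]] := transition_chain.
(* [c] is the constant of reduced bases, [C] that of the operators, [t] the gap demanded between
   clusters and [T] the ratio used to form them. Replacing a form by its neighbour costs a factor
   [2] on either side, whence [4 * c] and the factor [4] in [t]. *)
pose c s := (iter s red_step s).+1.
pose C s := (norm_bound s).+1.
pose t s := (4 * (4 * c s).+1 ^ (s + s))%N.
pose T s := (t s + c s * C s)%N.
pose S s := (s + c s * C s * (T s).+1 ^ s)%N.
pose B s := (iter (S s).+1 nf_step (S s) + (s + (4 * c s) * (4 * c s).+1 ^ (s + s)))%N.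
have mc : mfun c.
  rewrite /c; apply: mf_succ; apply: mf_iter; [| exact: leq_red_step | exact: mf_id | exact: mf_id].
  by rewrite /red_step; mf_tac.
have mC : mfun C by rewrite /C /norm_bound; mf_tac.
have mt : mfun t by rewrite /t; mf_tac.
have mT : mfun T by rewrite /T; mf_tac.
have mS : mfun S by rewrite /S; mf_tac.
have mB : mfun B.
  rewrite /B; apply: mf_add; last by mf_tac.
  by apply: (@mf_iter nf_step (fun s => (S s).+1) S); rewrite /nf_step; try mf_tac; move=> y;
    rewrite leq_addl.
exists (fun s => f (B s) + B s)%N; split; first by mf_tac.
move=> s K N X Y g Ns Ks sX sY ssX ug cg.
have c1 : (0 < c s)%N by [].
have cc : (0 < 4 * c s)%N by [].
have B1 : (0 < B s)%N.
  have h : (0 < 4 * c s * (4 * c s).+1 ^ (s + s))%N by rewrite muln_gt0 cc expn_gt0.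
  by apply: leq_trans h _; rewrite /B addnA leq_addl.
have sB : (s <= B s)%N by rewrite /B addnCA leq_addr.
have cB : (4 * c s * (4 * c s) ^ (N + N) <= B s)%N.
  apply: (@leq_trans (4 * c s * (4 * c s).+1 ^ (s + s))%N); last by rewrite /B addnA leq_addl.
  rewrite leq_mul2l; apply/orP; right.
  apply: (@leq_trans ((4 * c s).+1 ^ (N + N))%N).
    by case: (N + N)%N => // n; rewrite leq_exp2r.
  by apply: leq_pexp2l => //; apply: leq_add.
have ct : (4 * (4 * c s) ^ (N + N) <= t s)%N.
  rewrite /t leq_mul2l; apply/orP; right.
  apply: (@leq_trans ((4 * c s).+1 ^ (N + N))%N).
    by case: (N + N)%N => // n; rewrite leq_exp2r.
  by apply: leq_pexp2l => //; apply: leq_add.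
pose H := invmx g *m 1%:M *m (invmx g)^T.
have ug' : invmx g \in unitmx by rewrite unitmx_inv.
have pH : posdef H by apply: posdef_base => //; exact: posdef1.
have HE v : qf H v = qf 1%:M (v *m invmx g) by rewrite /H qf_base.
have [m1 bm1] := mxle_exists g; have [m2 bm2] := mxle_exists (invmx g).
(* [L] bounds the distortion between the two end forms. With weights [L - i] and [i], neighbouring
   forms then differ by a factor of at most [2], even at the ends, where one weight vanishes. *)
pose L := (norm_bound (N + m1) + norm_bound (N + m2) + 1)%N.
have q0v v : 0 <= qf (1%:M : 'M[int]_N) v by apply: qf_ge0; exact: posdef1.
have qHv v : 0 <= qf H v by exact: qf_ge0.
have HL v : qf H v <= L%:Z * qf 1%:M v.
  rewrite HE.
  apply: le_trans (@norm_mul_le (N + m2) _ _ _ (leq_addr _ _) (mxleW bm2 (leq_addl _ _))) _.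
  by apply: ler_wpM2r => //; rewrite lez_nat /L; lia.
have LH v : qf 1%:M v <= L%:Z * qf H v.
  rewrite HE -{1}(mulmxKV ug v).
  apply: le_trans (@norm_mul_le (N + m1) _ _ _ (leq_addr _ _) (mxleW bm1 (leq_addl _ _))) _.
  by apply: ler_wpM2r => //; rewrite lez_nat /L; lia.
have L0 : (0 < L)%N by rewrite /L addn1.
pose G i := (L - i)%:Z *: 1%:M + i%:Z *: H : 'M[int]_N.
have GE i v : qf (G i) v = (L - i)%:Z * qf 1%:M v + i%:Z * qf H v by rewrite qf_lin.
have pG i : (i <= L)%N -> posdef (G i).
  by move=> iL; apply: posdef_lin => //; [rewrite subnK | exact: posdef1].
have GC i k v : (i <= L)%N -> qf (G i) (v *m X k) <= (C s)%:Z * qf (G i) v.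
  move=> iL; have h1 := norm_mul_le v Ns (sX k).
  have h2 : qf H (v *m X k) <= (norm_bound s)%:Z * qf H v.
    by rewrite !HE -mulmxA -(intertwine_inv ug (cg k)) mulmxA; exact: norm_mul_le.
  have nC : (norm_bound s)%:Z <= (C s)%:Z by rewrite lez_nat /C.
  have {}h1 := le_trans h1 (ler_wpM2r (q0v v) nC).
  have {}h2 := le_trans h2 (ler_wpM2r (qHv v) nC).
  rewrite !GE mulrDr; apply: lerD; rewrite [leRHS]mulrCA; exact: ler_wpM2l.
have GS1 i v : (i < L)%N -> qf (G i) v <= 2 * qf (G i.+1) v.
  move=> iL; have := q0v v; have := qHv v; have := LH v; rewrite !GE.
  have [d Ld] : exists d, L = (i + d).+1 by exists (L - i.+1)%N; lia.
  rewrite Ld; have -> : ((i + d).+1 - i = d.+1)%N by lia.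
  have -> : ((i + d).+1 - i.+1 = d)%N by lia.
  case: d {Ld} => [|d]; rewrite ?addn0; move: (qf _ v) (qf _ v) => x y; nia.
have GS2 i v : (i < L)%N -> qf (G i.+1) v <= 2 * qf (G i) v.
  move=> iL; have := q0v v; have := qHv v; have := HL v; rewrite !GE.
  have [d Ld] : exists d, L = (i + d).+1 by exists (L - i.+1)%N; lia.
  rewrite Ld; have -> : ((i + d).+1 - i = d.+1)%N by lia.
  have -> : ((i + d).+1 - i.+1 = d)%N by lia.
  case: i {Ld iL} => [|i]; rewrite ?add0n; move: (qf _ v) (qf _ v) => x y; nia.
pose St (A : 'M[int]_N) := fun k => A *m X k *m invmx A.
pose good i b Z l := [/\ orth (c s) (G i) b, unitri l Z, gaps (t s) (G i) b l &
  forall k, mxle (B s) (St (Z *m b) k)].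
have step i b b' Z Z' l l' : (i < L)%N -> good i b Z l -> good i.+1 b' Z' l' ->
    chain (f (B s)) (St (Z *m b)) (St (Z' *m b')) (Z' *m b' *m invmx (Z *m b)).
  move=> iL [ob uZ gb bZ] [ob' uZ' gb' bZ'].
  have pG' := pG _ iL.
  apply: (hf (B s) K N X (G i.+1) b b' Z Z' l l' (4 * c s)%N) => //.
  - exact: leq_trans Ns sB.
  - exact: leq_trans Ks sB.
  - split; first by case: ob.
    move=> v j; have := (proj2 ob) v j; have := GS1 i (v *m b) iL; have := GS2 i (row j b) iL.
    rewrite PoszM; have := sqr_ge0 (v 0 j); move: (v 0 j ^+ 2) (c s)%:Z (isT : 0 <= (c s)%:Z) =>
      x y y0 x0.
    move: (qf (G i.+1) _) (qf (G i) _) (qf (G i.+1) _) (qf (G i) _) => q1 q2 q3 q4 h1 h2 h3.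
    have h4 : x * q3 <= x * (2 * q4) by apply: ler_wpM2l.
    have h5 : y * q2 <= y * (2 * q1) by apply: ler_wpM2l.
    by lia.
  - split; first by case: ob'.
    move=> v j; apply: le_trans ((proj2 ob') v j) _; apply: ler_wpM2r; first exact: qf_ge0.
    by rewrite lez_nat leq_pmull.
  - move=> p q pq; have := gb _ _ pq; have := GS1 i (row p b) iL; have := GS2 i (row q b) iL.
    have : 0 <= qf (G i.+1) (row q b) by exact: qf_ge0.
    move: ct; rewrite -lez_nat PoszM; move: (t s)%:Z ((4 * c s) ^ (N + N))%N%:Z (isT : 0 <= ((4 *
      c s) ^ (N + N))%N%:Z) => x y y0 xy.
    move: (qf (G i.+1) (row q b)) (qf (G i) (row q b)) (qf (G i.+1) (row p b)) (qf (G i) (row p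
      b)) => q1 q2 q3 q4 h0 h1 h2 h3.
    have q20 : 0 <= q2 by lia.
    have h5 : y * q1 <= y * (2 * q2) by apply: ler_wpM2l.
    have h6 : 4 * y * q2 <= x * q2 by apply: ler_wpM2r => //.
    by lia.
  - move=> p q pq; apply: le_lt_trans (gb' _ _ pq); apply: ler_wpM2r; first exact: qf_ge0.
    by rewrite lez_nat; apply: leq_trans ct; rewrite leq_pmull.
have q0row i : qf (1%:M : 'M[int]_N) (row i 1%:M) = 1.
  rewrite qf1 (bigD1 i) //= big1 => [|j ji]; rewrite !mxE ?eqxx ?expr1n ?addr0 //.
  by rewrite eq_sym (negPf ji) expr0n.
have vi_le (v : 'rV[int]_N) i : v 0 i ^+ 2 <= qf (1%:M : 'M[int]_N) v.
  by rewrite qf1 (bigD1 i) //= lerDl sumr_ge0 // => j _; exact: sqr_ge0.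
have cL (x y : int) : 0 <= y -> x <= y -> x * L%:Z <= (c s)%:Z * (L%:Z * y).
  move=> y0 xy; rewrite mulrA [_ * y]mulrC; apply: le_trans (ler_wpM2r _ xy) _ => //.
  by apply: ler_wpM2l => //; rewrite ler_peMl // lez_nat.
have good0 : good 0%N 1%:M 1%:M (fun=> 0%N).
  split=> //.
  - split; first exact: unitmx1.
    move=> v i; rewrite !GE subn0 !mul0r !addr0 q0row mulr1 mulmx1; exact: cL.
  - by move=> k; rewrite /St mulmx1 invmx1 mulmx1 mul1mx; exact: mxleW (sX k) sB.
(* The rows of [g] are orthonormal for [H], and [g] carries [X] to [Y]. So the path may end with the
   basis [g], and the product of the transitions telescopes to [g]. *)
have goodL : good L g 1%:M (fun=> 0%N).
  split=> //.
  - split=> // v i; rewrite !GE subnn !mul0r !add0r !HE -row_mul mulmxV // q0row mulr1 mulmxK //.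
    exact: cL.
  - by move=> k; rewrite /St mul1mx cg mulmxK //; exact: mxleW (sY k) sB.
have good_ex i : (i <= L)%N -> exists b Z l, good i b Z l.
  move=> iL; have pGi := pG _ iL.
  have [b [ub hb]] := reduced_basis Ns pGi.
  have ob : orth (c s) (G i) b.
    split=> // v j; apply: le_trans (hb v j) _; apply: ler_wpM2r; first exact: qf_ge0.
    rewrite lez_nat /c; apply: leqW.
    have [d ->] : exists d, s = (d + N)%N by exists (s - N)%N; rewrite subnK.
    by rewrite iterD; apply: leq_iter; exact: leq_red_step.
  have [|||||l [Z [uZ gZ bZ]]] := @reduced_normal_form (S s) (t s) K N X (G i) b (c s) (C s) (T
    s) _ _ _ _ _ pGi ob (fun k v => GC i k v iL) ssX.
  - by apply: leq_trans Ns _; rewrite /S leq_addr.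
  - rewrite /S; apply: leq_trans (leq_addl _ _); rewrite leq_mul2l; apply/orP; right.
    apply: (@leq_trans ((T s).+1 ^ N)%N); last by rewrite leq_pexp2l.
    by case: (N) => // n; rewrite leq_exp2r.
  - by rewrite /T leq_addl.
  - by rewrite /T leq_addr.
  - by rewrite /T addn_gt0 /t muln_gt0 expn_gt0.
  exists b, Z, l; split=> // k; apply: mxleW (bZ k) _.
  by rewrite /B leq_addr.
have path i : (i < L)%N -> exists b Z l, good i b Z l /\ chain (f (B s) + B s)%N X (St (Z *m b))
  (Z *m b).
  elim: i => [|i IH] iL.
    exists 1%:M, 1%:M, (fun=> 0%N); split=> //.
    have [_ _ _ bb] := good0.
    apply: (chain_mono (leq_addl (f (B s)) (B s))); apply: chain1 => //.
    - by move=> k; exact: mxleW (sX k) sB.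
    - by rewrite unitmx_mul unitmx1.
    - by rewrite mulmx1; exact: mxleW (@mxle1 N) B1.
    - by move=> k; rewrite /St mulmx1 invmx1 mulmx1 mulmx1 mul1mx.
  have [b [Z [l [gd ch]]]] := IH (ltnW iL).
  have [b' [Z' [l' gd']]] := good_ex i.+1 (ltnW iL).
  exists b', Z', l'; split=> //.
  have uZb : Z *m b \in unitmx.
    by case: gd => [[ub _] /unitri_inv[uZ _] _ _]; rewrite unitmx_mul uZ.
  have -> : Z' *m b' = (Z' *m b' *m invmx (Z *m b)) *m (Z *m b) by rewrite mulmxKV.
  apply: chain_trans ch _; rewrite mulmxKV //; apply: chain_mono (leq_addr _ _) _.
  exact: (step _ _ _ _ _ _ _ (ltnW iL) gd gd').
have [L' LE] : exists L', L = L'.+1 by exists L.-1; rewrite prednK.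
have [|b [Z [l [gd ch]]]] := path L'; first by rewrite LE.
have := goodL; rewrite LE => gd'.
have uZb : Z *m b \in unitmx.
  by case: gd => [[ub _] /unitri_inv[uZ _] _ _]; rewrite unitmx_mul uZ.
have ch' := step _ _ _ _ _ _ _ (_ : (L' < L)%N) gd gd'.
have := chain_trans ch (chain_mono (leq_addr _ _) (ch' _)); rewrite mulmxKV // mul1mx LE => /(_
  (leqnn _)) hc.
(* [hc] ends in a family that equals [Y] only pointwise; an identity step replaces it by [Y]. *)
rewrite -[g]mul1mx; apply: chainS hc _ (unitmx1 _ _) _ _.
- by move=> k; apply: mxleW (sY k) _; rewrite (leq_trans sB) // leq_addl.
- by apply: mxleW (@mxle1 N) _; rewrite (leq_trans B1) // leq_addl.
- by move=> k; rewrite mul1mx mulmx1 /St cg mulmxK.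
Qed.

(** * Shortening a chain modulo [k] by pigeonholing *)

Definition congm m n (k : nat) (A B : 'M[int]_(m, n)) := exists D, A = B + k%:Z *: D.

Lemma congm_refl m n k (A : 'M[int]_(m, n)) : congm k A A.
Proof. by exists 0; rewrite scaler0 addr0. Qed.
Lemma congm_sym m n k (A B : 'M[int]_(m, n)) : congm k A B -> congm k B A.
Proof. by move=> [D ->]; exists (- D); rewrite scalerN addrK. Qed.
Lemma congm_trans m n k (A B C : 'M[int]_(m, n)) : congm k A B -> congm k B C -> congm k A C.
Proof. by move=> [D ->] [E ->]; exists (E + D); rewrite scalerDr addrA. Qed.
Lemma congm_mull m n p k (C : 'M[int]_(p, m)) (A B : 'M[int]_(m, n)) :
  congm k A B -> congm k (C *m A) (C *m B).
Proof. by move=> [D ->]; exists (C *m D); rewrite mulmxDr scalemxAr. Qed.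
Lemma congm_mod m n k (A : 'M[int]_(m, n)) : congm k A (map_mx (fun x => (x %% k%:Z)%Z) A).
Proof.
exists (map_mx (fun x => (x %/ k%:Z)%Z) A); apply/matrixP => i j.
by rewrite !mxE addrC mulrC -divz_eq.
Qed.

Section Shorten.
Variables (K : finType) (N B k' : nat).
Implicit Types X Y : K -> 'M[int]_N.
Let k := k'.+1.
(** Entries between [-B] and [B], shifted by [B], and residues modulo [k] are stored as ordinals; so
    the states form a finite type, to which [connect] and [shortenP] apply. *)
Definition state := ({ffun K * 'I_N * 'I_N -> 'I_(2 * B).+1} * {ffun 'I_N * 'I_N -> 'I_k'.+1})%type.
Definition st_rep (a : state) (t : K) : 'M[int]_N := \matrix_(i, j) ((a.1 (t, i,
    j) : nat)%:Z - B%:Z).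
Definition st_res (a : state) : 'M[int]_N := \matrix_(i, j) (a.2 (i, j) : nat)%:Z.

Lemma state_exists (X : K -> 'M[int]_N) (R : 'M[int]_N) : (forall t, mxle B (X t)) ->
  exists a, (forall t, st_rep a t = X t) /\ congm k (st_res a) R.
Proof.
move=> bX.
pose a : state := ([ffun p => inord `|(X p.1.1 p.1.2 p.2 + B%:Z)%R|],
  [ffun p => inord `|(R p.1 p.2 %% k%:Z)%Z|]).
exists a; split.
  move=> t; apply/matrixP => i j; have h := bX t i j.
  by rewrite mxE ffunE /= inordK; lia.
apply: congm_trans (congm_sym (congm_mod k R)).
suff -> : st_res a = map_mx (fun x => (x %% k%:Z)%Z) R by exact: congm_refl.
apply/matrixP => i j; rewrite !mxE ffunE /=.
have h1 := @ltz_pmod (R i j) k%:Z isT; have h2 := @modz_ge0 (R i j) k%:Z isT.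
by rewrite inordK; move: h1 h2; rewrite /k; lia.
Qed.

Definition st_step (a b : state) := exists d : 'M[int]_N, [/\ d \in unitmx, mxle B d,
  forall t, d *m st_rep a t = st_rep b t *m d & congm k (st_res b) (d *m st_res a)].
Definition st_rel : rel state := fun a b => boolp.asbool (st_step a b).

Lemma chain_connect X Y g : chain B X Y g ->
  forall a, (forall t, st_rep a t = X t) -> congm k (st_res a) 1%:M ->
  exists b, [/\ connect st_rel a b, forall t, st_rep b t = Y t & congm k (st_res b) g].
Proof.
move=> ch a aX a1; elim: ch => [_|Y1 Y' g1 d _ [b [ab bY bg]] bY' ud bd cd].
  by exists a; split.
have [b' [b'Y b'R]] := state_exists (d *m g1) bY'.
exists b'; split=> //; apply: connect_trans ab (connect1 _); apply/boolp.asboolP.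
exists d; split=> // [t|]; first by rewrite bY b'Y.
by apply: congm_trans b'R _; apply: congm_mull; exact: congm_sym.
Qed.

Lemma path_iso p a : path st_rel a p -> exists h : 'M[int]_N,
  [/\ h \in unitmx, mxle ((N * B).+1 ^ size p) h,
   forall t, h *m st_rep a t = st_rep (last a p) t *m h &
   congm k (st_res (last a p)) (h *m st_res a)].
Proof.
elim: p a => [|b p IH] a /=.
  move=> _; exists 1%:M; split; [exact: unitmx1 | exact: mxle1 | by move=> t;
    rewrite mul1mx mulmx1 |].
  by rewrite mul1mx; exact: congm_refl.
case/andP=> /boolp.asboolP[d [ud bd cd rd]] /IH[h [uh bh ch rh]].
exists (h *m d); split.
- by rewrite unitmx_mul uh.
- apply: (mxleW (mxle_mul bh bd)); rewrite expnS.
  by move: (_ ^ _)%N => z; nia.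
- by move=> t; rewrite -mulmxA cd mulmxA ch mulmxA.
- by apply: congm_trans rh _; rewrite -mulmxA; exact: congm_mull.
Qed.

(** A path without repetitions is no longer than the number of states. Its product connects the same
    representations, and is congruent to [g] because the last state records the residue. *)
Lemma chain_short X Y g : (forall t, mxle B (X t)) -> chain B X Y g ->
  exists h : 'M[int]_N, [/\ h \in unitmx, mxle ((N * B).+1 ^ #|{: state}|) h,
    forall t, h *m X t = Y t *m h & congm k h g].
Proof.
move=> bX ch; have [a [aX a1]] := state_exists 1%:M bX.
have [b [/connectP[p pp ->] bY bg]] := chain_connect ch aX a1.
case/shortenP: pp bY bg => p' pp' up _ bY bg.
have [h [uh bh ch' rh]] := path_iso pp'.
exists h; split=> //.
- apply: (mxleW bh); apply: leq_pexp2l => //.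
  by have := max_card (mem (a :: p')); rewrite (card_uniqP up) => /ltnW.
- by move=> t; rewrite -aX ch' bY.
apply: congm_trans bg; apply: congm_sym; apply: congm_trans rh _.
by rewrite -[X in congm _ _ X]mulmx1; exact: congm_mull.
Qed.
End Shorten.

Lemma semisimple_iso_mod : exists f, mfun f /\
  forall s (K : finType) N (X Y : K -> 'M[int]_N) g k,
  (N <= s)%N -> (#|K| <= s)%N -> (forall k, mxle s (X k)) -> (forall k, mxle s (Y k)) ->
  semisimple X -> g \in unitmx -> (forall k, g *m X k = Y k *m g) -> (0 < k <= s)%N ->
  exists h, [/\ h \in unitmx, mxle (f s) h, forall k, h *m X k = Y k *m h & congm k h g].
Proof.
have [f [mf hf]] := semisimple_chain.
pose B s := (f s + s)%N.
(* The outer exponent bounds the number of states: bounded representations times matrices of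
   residues. *)
exists (fun s => (s * B s).+1 ^ ((2 * B s).+1 ^ (s * s * s) * s.+1 ^ (s * s)))%N; split.
  have mB : mfun B by rewrite /B; mf_tac.
  by mf_tac.
move=> s K N X Y g k Ns Ks sX sY ssX ug cg /andP[k0 ks].
case: k k0 ks => // k' _ ks.
have ch : chain (B s) X Y g by apply: (chain_mono (leq_addr s (f s))); exact: hf.
have [|h [uh bh ch' cgh]] := chain_short k' _ ch.
  by move=> t; apply: mxleW (sX t) (leq_addl _ _).
exists h; split=> //; apply: (mxleW bh).
apply: (@leq_trans ((s * B s).+1 ^ #|{: state K N (B s) k'}|)%N).
  have : (0 < #|{: state K N (B s) k'}|)%N.
    have [a _] := @state_exists K N (B s) k' (fun=> 0) 0 (fun=> @mxle0 _ _ _).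
    by apply/card_gt0P; exists a.
  by case: (#|_|) => // n _; rewrite leq_exp2r // ltnS leq_mul2r Ns orbT.
apply: leq_pexp2l => //; rewrite card_prod !card_ffun !card_prod !card_ord.
apply: leq_mul; first by apply: leq_pexp2l => //; rewrite !leq_mul.
apply: (@leq_trans (s.+1 ^ (N * N))%N); last by apply: leq_pexp2l => //; exact: leq_mul.
by case: (N * N)%N => // n; rewrite leq_exp2r // ltnW.
Qed.

(** * Orders and lattices *)

Definition mxpow (R : pzRingType) n (A : 'M[R]_n) k := iter k (mulmx A) 1%:M.
Definition mxnilp (R : pzRingType) n (A : 'M[R]_n) := exists k, mxpow A k = 0.

Lemma mxpow1 (R : pzRingType) n (A : 'M[R]_n) : mxpow A 1 = A.
Proof. by rewrite /mxpow /= mulmx1. Qed.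

Lemma mxpowD (R : pzRingType) n (A : 'M[R]_n) j k : mxpow A (j + k) = mxpow A j *m mxpow A k.
Proof. by elim: j => [|j IH]; rewrite /mxpow ?mul1mx //= -/(mxpow A (j + k)) IH mulmxA. Qed.

Lemma mxpowSr (R : pzRingType) n (A : 'M[R]_n) k : mxpow A k.+1 = mxpow A k *m A.
Proof. by rewrite -addn1 mxpowD mxpow1. Qed.

Lemma mxpowM (R : pzRingType) n (A : 'M[R]_n) j k : mxpow (mxpow A j) k = mxpow A (j * k).
Proof. by elim: k => [|k IH]; rewrite ?muln0 // mulnS mxpowD -IH. Qed.

Lemma mxpow_exp (R : nzRingType) n (A : 'M[R]_n.+1) k : mxpow A k = A ^+ k.
Proof. by elim: k => [|k IH]; rewrite ?expr0 // exprS -IH. Qed.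

Lemma map_mxpow (R S : pzRingType) (f : {rmorphism R -> S}) n (A : 'M[R]_n) k :
  map_mx f (mxpow A k) = mxpow (map_mx f A) k.
Proof. by elim: k => [|k IH]; rewrite /mxpow /= ?map_mx1 // map_mxM -/(mxpow A k) IH. Qed.

(** The trace of an idempotent is its rank, because the two factors of its rank decomposition
    multiply to the identity in the other order. *)
Lemma mxtrace_idem (F : numFieldType) n (E : 'M[F]_n) : E *m E = E -> \tr E = 0 -> E = 0.
Proof.
move=> EE tE; have h : row_base E *m col_base E = 1%:M.
  apply: (row_free_inj (row_base_free E)); apply: (row_full_inj (col_base_full E)).
  by rewrite /= mul1mx mulmx_base -(mulmxA (row_base E)) mulmxA mulmx_base EE.
move: tE; rewrite -{1}(mulmx_base E) mxtrace_mulC h mxtrace1 => /eqP.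
by rewrite pnatr_eq0 mxrank_eq0 => /eqP.
Qed.

(* The idempotent polynomial in [A] without constant term that projects on the
   non-nilpotent part has trace zero, hence vanishes. *)
Lemma trace_pow_nilp_field (F : numFieldType) n (A : 'M[F]_n) :
  (forall k, \tr (mxpow A k.+1) = 0) -> mxnilp A.
Proof.
case: n A => [|n] A h; first by exists 0%N; apply/matrixP => -[].
set p := char_poly A.
have p0 : p != 0 by rewrite -size_poly_gt0 size_char_poly.
have [m [q]] := multiplicity_XsubC p 0; rewrite p0 /= subr0 => q0 pE.
have /Bezout_eq1_coprimepP[[u v] /= uv] : coprimep q ('X ^+ m.+1).
  by apply: coprimep_expr; have := coprimep_XsubC q 0; rewrite subr0 => ->.
pose E := horner_mx A (v * 'X ^+ m.+1); pose G := horner_mx A (u * q).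
have EG : G + E = 1 by rewrite /E /G -rmorphD uv rmorph1.
have pA : horner_mx A p = 0 by exact: Cayley_Hamilton.
have GE : G * E = 0.
  rewrite /E /G -rmorphM; have -> : u * q * (v * 'X ^+ m.+1) = p * (u * v * 'X) by rewrite pE
    exprS; ring.
  by rewrite rmorphM /= pA mul0r.
have EE : E *m E = E.
  by rewrite -[LHS]add0r -[0 in LHS]GE -mulrDl EG mul1r.
have tE (w : {poly F}) k : \tr (horner_mx A w * A ^+ k.+1) = 0.
  elim/poly_ind: w k => [|w c IH] k; first by rewrite rmorph0 mul0r mxtrace0.
  rewrite rmorphD rmorphM /= horner_mx_X horner_mx_C mulrDl -mulrA -exprS mxtraceD IH add0r.
  by rewrite -[_ * _]/(c%:M *m _) mul_scalar_mx mxtraceZ -mxpow_exp h mulr0.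
have E0 : E = 0.
  apply: mxtrace_idem => //; rewrite /E rmorphM /= rmorphXn /= horner_mx_X; exact: tE.
exists m; rewrite mxpow_exp -[A ^+ m]mul1r -EG E0 addr0 /G -[in A ^+ m](horner_mx_X A) -rmorphXn
  -rmorphM.
have -> : u * q * 'X^m = p * u by rewrite pE; ring.
by rewrite rmorphM /= pA mul0r.
Qed.

(** All eigenvalues vanish, so the characteristic polynomial is a power of [X] and the trace is one
    of its zero coefficients. *)
Lemma nilp_trace_closed (F : numClosedFieldType) n (A : 'M[F]_n) : mxnilp A -> \tr A = 0.
Proof.
case: n A => [|n] A [k Ak]; first by rewrite /mxtrace big_ord0.
have root0 a : root (char_poly A) a -> a = 0.
  rewrite -eigenvalue_root_char => /eigenvalueP[v vA v0].
  have vk j : v *m mxpow A j = a ^+ j *: v.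
    by elim: j => [|j IH]; rewrite ?mulmx1 ?scale1r // mxpowSr mulmxA IH -scalemxAl vA scalerA
      -exprSr.
  have := vk k; rewrite Ak mulmx0 => /esym/eqP; rewrite scaler_eq0 (negPf v0) orbF expf_eq0.
  by case/andP=> _ /eqP.
have [r pE] := closed_field_poly_normal (char_poly A).
have := char_poly_monic A; rewrite monicE => /eqP lc; rewrite lc scale1r in pE.
have r0 : all (pred1 0) r.
  apply/allP => z zr /=; apply/eqP/root0; rewrite pE root_prod_XsubC //.
have sr : size r = n.+1.
  by have := size_char_poly A; rewrite pE size_prod_XsubC => -[].
have pX : char_poly A = 'X^(n.+1).
  rewrite pE -sr (eq_big_seq (fun=> 'X)) => [|z zr]; last by rewrite (eqP (allP r0 z zr)) subr0.
  by elim: (r) => [|z t IH]; rewrite ?big_nil ?expr0 // big_cons IH exprS.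
have := char_poly_trace A isT; rewrite pX coefXn /= (ltn_eqF (ltnSn n)) => /eqP.
by rewrite eq_sym oppr_eq0 => /eqP.
Qed.

Lemma trace_pow_nilp n (A : 'M[int]_n) : (forall k, \tr (mxpow A k.+1) = 0) -> mxnilp A.
Proof.
move=> h; have [k|k Ak] := @trace_pow_nilp_field rat n (map_mx intr A).
  by rewrite -map_mxpow trace_map_mx h.
exists k; apply/matrixP => i j; move: Ak; rewrite -map_mxpow => /matrixP/(_ i j).
by rewrite !mxE => /eqP; rewrite intr_eq0 => /eqP.
Qed.

Lemma nilp_trace n (A : 'M[int]_n) : mxnilp A -> \tr A = 0.
Proof.
move=> [k Ak]; have : \tr (map_mx intr A : 'M[algC]_n) = 0.
  by apply: nilp_trace_closed; exists k; rewrite -map_mxpow Ak map_mx0.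
by rewrite trace_map_mx => /eqP; rewrite intr_eq0 => /eqP.
Qed.

(* A ring structure on [Z^e]: [L z] is the matrix of left multiplication by
   [z], so that [y *m L z] is the product [z y], and [Rm y] is the matrix of
   right multiplication by [y]. *)
Section Casimir.
Variables (e : nat) (Lb : 'I_e -> 'M[int]_e) (o : 'rV[int]_e).
Definition Lm (z : 'rV[int]_e) := \sum_i z 0 i *: Lb i.
Definition Rm (y : 'rV[int]_e) : 'M[int]_e := \matrix_i (y *m Lb i).
Hypothesis L_assoc : forall y z, Lm (y *m Lm z) = Lm y *m Lm z.
Hypothesis L_unit : Lm o = 1%:M.
Hypothesis R_unit : forall y, o *m Lm y = y.

Lemma LmD y z : Lm (y + z) = Lm y + Lm z.
Proof. by rewrite /Lm -big_split; apply: eq_bigr => i _; rewrite mxE scalerDl. Qed.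
Lemma LmZ c z : Lm (c *: z) = c *: Lm z.
Proof. by rewrite /Lm scaler_sumr; apply: eq_bigr => i _; rewrite mxE scalerA. Qed.
Lemma Lm_delta i : Lm (delta_mx 0 i) = Lb i.
Proof.
rewrite /Lm (bigD1 i) //= big1 ?addr0 => [|j ji]; first by rewrite mxE !eqxx scale1r.
by rewrite mxE eqxx (negPf ji) scale0r.
Qed.
Lemma RmE z y : z *m Rm y = y *m Lm z.
Proof.
rewrite mulmx_sum_row /Lm mulmx_sumr; apply: eq_bigr => i _.
by rewrite rowK -scalemxAr.
Qed.
Lemma Lm_inj_eq A B : (forall z : 'rV[int]_e, z *m A = z *m B) -> A = B :> 'M[int]_e.
Proof. by move=> h; apply/row_matrixP => i; rewrite !rowE. Qed.
Lemma Rm_assoc y z : Rm (y *m Lm z) = Rm z *m Rm y.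
Proof.
by apply: Lm_inj_eq => w; rewrite RmE mulmxA (RmE w z) RmE L_assoc mulmxA.
Qed.
Definition tform (z : 'rV[int]_e) := \tr (Rm z).
Lemma tformD y z : tform (y + z) = tform y + tform z.
Proof. by rewrite /tform -mxtraceD; congr mxtrace; apply: Lm_inj_eq => w;
  rewrite mulmxDr !RmE mulmxDl. Qed.
Lemma tformZ c z : tform (c *: z) = c * tform z.
Proof. by rewrite /tform -mxtraceZ; congr mxtrace; apply: Lm_inj_eq => w;
  rewrite -scalemxAr !RmE scalemxAl. Qed.
Lemma tformC y z : tform (y *m Lm z) = tform (z *m Lm y).
Proof. by rewrite /tform !Rm_assoc mxtrace_mulC. Qed.

Definition gram : 'M[int]_e := \matrix_(i, j) tform (delta_mx 0 j *m Lb i).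
Lemma tform_gram z y : tform (y *m Lm z) = (z *m gram *m y^T) 0 0.
Proof.
have h1 (F : 'I_e -> 'rV[int]_e) : tform (\sum_i F i) = \sum_i tform (F i).
  elim/big_ind2: _ => [|a b c d <- <-|//]; last by rewrite tformD.
  by have := tformZ 0 0; rewrite scale0r mul0r.
rewrite {1}(row_sum_delta y) mulmx_suml h1 mxE; apply: eq_bigr => j _.
rewrite -scalemxAl tformZ [X in _ = _ * X]mxE mulrC; congr (_ * _).
rewrite /Lm mulmx_sumr h1 mxE; apply: eq_bigr => i _.
by rewrite -scalemxAr tformZ mxE.
Qed.
Lemma gram_sym : gram^T = gram.
Proof.
apply/matrixP => i j; rewrite !mxE -(Lm_delta j) tformC Lm_delta //.
Qed.

Hypothesis gram_nz : \det gram != 0.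

(** Left multiplication by [a] is adjoint to right multiplication by [a] for the trace form:
    [tr (a z y) = tr (z y a)]. *)
Lemma gram_LR a : Lm a *m gram = gram *m (Rm a)^T.
Proof.
suff h : gram *m (Lm a)^T = Rm a *m gram.
  by apply: trmx_inj; rewrite !trmx_mul gram_sym trmxK.
apply: Lm_inj_eq => z; apply/rowP => j.
have E (B : 'M[int]_e) : (z *m gram *m B^T) 0 j = tform ((delta_mx 0 j *m B) *m Lm z).
  by rewrite tform_gram trmx_mul mulmxA trmx_delta -colE [RHS]mxE.
rewrite mulmxA E mulmxA RmE.
have -> : (a *m Lm z *m gram) 0 j = tform (delta_mx 0 j *m Lm (a *m Lm z)).
  by rewrite tform_gram trmx_delta -colE [RHS]mxE.
by rewrite L_assoc mulmxA.
Qed.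

Lemma gram_inj (A B : 'M[int]_e) : gram *m A = gram *m B -> A = B.
Proof.
move=> /(congr1 (mulmx (\adj gram))); rewrite !mulmxA !mul_adj_mx !mul_scalar_mx => /matrixP h.
by apply/matrixP => i j; have := h i j; rewrite !mxE => /(mulfI gram_nz).
Qed.

Lemma adj_LR a : \adj gram *m Lm a = (Rm a)^T *m \adj gram.
Proof.
apply: gram_inj; rewrite !mulmxA mul_mx_adj mul_scalar_mx -gram_LR.
by rewrite -(mulmxA (Lm a)) mul_mx_adj mul_mx_scalar.
Qed.

Let dual i : 'rV[int]_e := row i (\adj gram).

Lemma tform_dual z i : tform (dual i *m Lm z) = \det gram * z 0 i.
Proof.
rewrite tform_gram /dual tr_row.
have adjT : (\adj gram)^T = \adj gram by rewrite -[in RHS]gram_sym trmx_adj.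
rewrite adjT colE mulmxA.
rewrite -(mulmxA z) mul_mx_adj mul_mx_scalar.
by rewrite -colE !mxE.
Qed.

Lemma tform_nondeg y : (forall i, tform (y *m Lb i) = 0) -> y = 0.
Proof.
move=> h; have g0 : gram *m y^T = 0.
  apply/matrixP => i j; rewrite [RHS]mxE (ord1 j) -(h i) -(Lm_delta i) tform_gram.
  by rewrite -rowE -row_mul [RHS]mxE.
have := mulmxA (\adj gram) gram y^T; rewrite g0 mulmx0 mul_adj_mx mul_scalar_mx => /matrixP D0.
apply/rowP => i; have /esym/eqP := D0 i 0.
by rewrite !mxE mulf_eq0 (negPf gram_nz) => /eqP.
Qed.

(** The rows of [\adj gram] are the dual basis, scaled by [\det gram] to be integral. Pairing the
    sum [c] of the products with [x] yields [\det gram] times the trace of [x], so nondegeneracy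
    identifies [c] with a multiple of the unit. *)
Lemma casimir_unit : \sum_i Lb i *m Lm (dual i) = (\det gram)%:M.
Proof.
pose c := \sum_i delta_mx 0 i *m Lm (dual i) : 'rV[int]_e.
have hsum (F : 'I_e -> 'rV[int]_e) : tform (\sum_i F i) = \sum_i tform (F i).
  elim/big_ind2: _ => [|a b c' d <- <-|//]; last by rewrite tformD.
  by have := tformZ 0 0; rewrite scale0r mul0r.
have key x : tform (c *m Lm x) = \det gram * tform x.
  rewrite /c mulmx_suml hsum [in RHS]/tform /mxtrace mulr_sumr; apply: eq_bigr => i _.
  rewrite -mulmxA -L_assoc tformC Lm_delta -mulmxA -(Lm_delta i) -L_assoc tform_dual.
  by rewrite Lm_delta [in RHS]mxE.
have cE : c = \det gram *: o.
  apply/eqP; rewrite -subr_eq0; apply/eqP/tform_nondeg => i.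
  rewrite -Lm_delta mulmxBl -scaleN1r tformD tformZ key -scalemxAl tformZ R_unit; ring.
have -> : \sum_i Lb i *m Lm (dual i) = Lm c.
  rewrite /c; have LmS (F : 'I_e -> 'rV[int]_e) : Lm (\sum_i F i) = \sum_i Lm (F i).
    elim/big_ind2: _ => [|a b c' d <- <-|//]; last by rewrite LmD.
    by have := LmZ 0 0; rewrite !scale0r.
  by rewrite LmS; apply: eq_bigr => i _; rewrite L_assoc Lm_delta.
by rewrite cE LmZ L_unit scalemx1.
Qed.

(* Averaging an arbitrary projection against the Casimir element gives an
   equivariant one, up to the factor [\det gram]. *)
Lemma gram_semisimple (J : Type) (z : J -> 'rV[int]_e) :
  (forall U : 'M[int]_e, (forall j, U *m Lm (z j) = U *m Lm (z j) *m U) ->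
     forall y, U *m Lm y = U *m Lm y *m U) ->
  semisimple (fun j => Lm (z j)).
Proof.
move=> gen U UU /gen UL.
pose D := \det gram.
pose P := \sum_i Lb i *m U *m Lm (dual i).
have UP : U *m P = D *: U.
  transitivity (U *m (\sum_i Lb i *m Lm (dual i))).
    rewrite /P !mulmx_sumr; apply: eq_bigr => i _.
    by rewrite !mulmxA -(Lm_delta i) -UL.
  by rewrite casimir_unit mul_mx_scalar.
have PU : P *m U = P.
  by rewrite /P mulmx_suml; apply: eq_bigr => i _; rewrite -!(mulmxA (Lb i)) -UL.
have PL a : P *m Lm a = Lm a *m P.
  have LL i : Lm a *m Lb i = \sum_k Rm a i k *: Lb k.
    rewrite -(Lm_delta i) -L_assoc -RmE -rowE /Lm; apply: eq_bigr => k _.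
    by rewrite mxE.
  have dL k : dual k *m Lm a = \sum_i Rm a i k *: dual i.
    by rewrite /dual -row_mul adj_LR row_mul mulmx_sum_row; apply: eq_bigr => i _; rewrite !mxE.
  rewrite /P mulmx_suml mulmx_sumr.
  transitivity (\sum_k \sum_i Rm a i k *: (Lb k *m U *m Lm (dual i))).
    apply: eq_bigr => k _; rewrite -mulmxA -L_assoc dL.
    have LmS (F : 'I_e -> 'rV[int]_e) : Lm (\sum_i F i) = \sum_i Lm (F i).
      elim/big_ind2: _ => [|x y c' d <- <-|//]; last by rewrite LmD.
      by have := LmZ 0 0; rewrite !scale0r.
    by rewrite LmS mulmx_sumr; apply: eq_bigr => i _; rewrite LmZ scalemxAr.
  rewrite exchange_big; apply: eq_bigr => i _.
  rewrite !mulmxA LL !mulmx_suml; apply: eq_bigr => k _.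
  by rewrite -!scalemxAl.
exists (D * D), (D *: P); split.
- by rewrite -expr2 exprn_even_gt0.
- by move=> j; rewrite -scalemxAl -scalemxAr PL.
- by rewrite -scalemxAr UP scalerA.
- by rewrite -scalemxAl PU.
Qed.
End Casimir.

(** * Lattices spanned by matrices, modulo the radicals of trace pairings *)

Definition ev d d' l (f : 'I_l -> 'M[int]_(d, d')) (u : 'rV[int]_l) := \sum_i u 0 i *: f i.

Lemma evD d d' l (f : 'I_l -> 'M[int]_(d, d')) u v : ev f (u + v) = ev f u + ev f v.
Proof. by rewrite /ev -big_split; apply: eq_bigr => i _; rewrite mxE scalerDl. Qed.
Lemma evZ d d' l (f : 'I_l -> 'M[int]_(d, d')) c u : ev f (c *: u) = c *: ev f u.
Proof. by rewrite /ev scaler_sumr; apply: eq_bigr => i _; rewrite mxE scalerA. Qed.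
Lemma evB d d' l (f : 'I_l -> 'M[int]_(d, d')) u v : ev f (u - v) = ev f u - ev f v.
Proof. by rewrite -scaleN1r evD evZ scaleN1r. Qed.
Lemma ev_delta d d' l (f : 'I_l -> 'M[int]_(d, d')) i : ev f (delta_mx 0 i) = f i.
Proof.
rewrite /ev (bigD1 i) //= big1 ?addr0 => [|j ji]; first by rewrite mxE !eqxx scale1r.
by rewrite mxE eqxx (negPf ji) scale0r.
Qed.
Lemma ev_sum d d' l (f : 'I_l -> 'M[int]_(d, d')) k (F : 'I_k -> 'rV[int]_l) :
  ev f (\sum_i F i) = \sum_i ev f (F i).
Proof.
elim/big_ind2: _ => [|x y a b <- <-|//]; last by rewrite evD.
by have := evZ f 0 0; rewrite !scale0r.
Qed.
Lemma ev_mulmx d d' l k (f : 'I_l -> 'M[int]_(d, d')) u (M : 'M[int]_(k, l)) :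
  ev f (u *m M) = ev (fun i => ev f (row i M)) u.
Proof. by rewrite mulmx_sum_row ev_sum; apply: eq_bigr => i _; rewrite evZ. Qed.
Lemma eq_ev d d' l (f g : 'I_l -> 'M[int]_(d, d')) u : f =1 g -> ev f u = ev g u.
Proof. by move=> fg; apply: eq_bigr => i _; rewrite fg. Qed.
Lemma ev_mull p d d' l (f : 'I_l -> 'M[int]_(d, d')) u (A : 'M[int]_(p, d)) :
  A *m ev f u = ev (fun i => A *m f i) u.
Proof. by rewrite mulmx_sumr; apply: eq_bigr => i _; rewrite scalemxAr. Qed.
Lemma ev_mulr p d d' l (f : 'I_l -> 'M[int]_(d, d')) u (A : 'M[int]_(d', p)) :
  ev f u *m A = ev (fun i => f i *m A) u.
Proof. by rewrite mulmx_suml; apply: eq_bigr => i _; rewrite scalemxAl. Qed.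
Definition pair_mx d d' l l' (f : 'I_l -> 'M[int]_(d, d')) (g : 'I_l' -> 'M[int]_(d', d)) :
  'M[int]_(l, l') := \matrix_(i, j) \tr (f i *m g j).

Lemma pair_mxE d d' l l' (f : 'I_l -> 'M[int]_(d, d')) (g : 'I_l' -> 'M[int]_(d', d)) u :
  u *m pair_mx f g = \row_j \tr (ev f u *m g j).
Proof.
apply/rowP => j; rewrite !mxE ev_mulr /ev raddf_sum; apply: eq_bigr => i _.
by rewrite mxE /= mxtraceZ.
Qed.

(* The quotient of a lattice by the radical of a trace pairing: the kernel of
   [T], with section [S]. *)
Definition is_quot d d' l l' e (f : 'I_l -> 'M[int]_(d, d')) (g : 'I_l' -> 'M[int]_(d', d))
    (S : 'M[int]_(e, l)) (T : 'M[int]_(l, e)) :=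
  S *m T = 1%:M /\ forall v : 'rV[int]_l, v *m pair_mx f g = 0 <-> v *m T = 0.

Section Quotient.
Variables (d d' l l' e : nat) (f : 'I_l -> 'M[int]_(d, d')) (g : 'I_l' -> 'M[int]_(d', d)).
Variables (S : 'M[int]_(e, l)) (T : 'M[int]_(l, e)).
Implicit Types u v : 'rV[int]_l.
Hypothesis qST : is_quot f g S T.

Lemma quot_eq0 u : (forall j, \tr (ev f u *m g j) = 0) -> u *m T = 0.
Proof.
move=> h; apply/(proj2 qST); rewrite pair_mxE; apply/rowP => j.
by rewrite !mxE h.
Qed.
Lemma quot_tr u y : u *m T = 0 -> \tr (ev f u *m ev g y) = 0.
Proof.
move=> /(proj2 qST); rewrite pair_mxE => /rowP h.
rewrite ev_mull /ev raddf_sum big1 // => j _ /=.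
by rewrite mxtraceZ; have := h j; rewrite !mxE => ->; rewrite mulr0.
Qed.
Lemma quot_ev u u' : ev f u = ev f u' -> u *m T = u' *m T.
Proof.
move=> uu; apply/eqP; rewrite -subr_eq0 -mulmxBl; apply/eqP/quot_eq0 => j.
by rewrite evB uu subrr mul0mx mxtrace0.
Qed.
Lemma quot_sect u : (u - u *m T *m S) *m T = 0.
Proof. by rewrite mulmxBl -[u *m T *m S *m T]mulmxA (proj1 qST) mulmx1 subrr. Qed.
Lemma quot_desc p (B : 'M[int]_(l, p)) : (forall u, u *m T = 0 -> u *m B = 0) ->
  T *m (S *m B) = B.
Proof.
move=> h; apply/row_matrixP => i; rewrite !rowE.
have := h _ (quot_sect (delta_mx 0 i)); rewrite mulmxBl => /eqP.
by rewrite subr_eq0 !mulmxA => /eqP <-.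
Qed.
Lemma quot_ev_mx p (B B' : 'M[int]_(p, l)) : (forall i, ev f (row i B) = ev f (row i B')) ->
  B *m T = B' *m T.
Proof. by move=> h; apply/row_matrixP => i; rewrite !row_mul; apply: quot_ev. Qed.
End Quotient.

(** [M k] is left multiplication by [ga k] in coordinates, and [X k] what it induces on the quotient
    by the radical of the matrix trace form. The aim is nondegeneracy of the regular trace form of
    the quotient ring, so that [gram_semisimple] applies. *)
Section Order.
Variables (d l e : nat) (ga : 'I_l -> 'M[int]_d) (M : 'I_l -> 'M[int]_l) (u1 : 'rV[int]_l).
Variables (S : 'M[int]_(e, l)) (T : 'M[int]_(l, e)).
Implicit Types (u v a : 'rV[int]_l) (z : 'rV[int]_e).
Hypothesis gaM : forall i j, ga i *m ga j = ev ga (row j (M i)).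
Hypothesis ga1 : ev ga u1 = 1%:M.
Hypothesis qST : is_quot ga ga S T.

Let X k := S *m M k *m T.
Let MM a := \sum_k a 0 k *: M k.
Let lm (a : 'rV[int]_l) := \sum_k a 0 k *: X k.

Lemma ev_left k u : ev ga (u *m M k) = ga k *m ev ga u.
Proof. by rewrite ev_mulmx ev_mull; apply: eq_ev => i; rewrite gaM. Qed.
Lemma ev_MM a v : ev ga (v *m MM a) = ev ga a *m ev ga v.
Proof.
rewrite /MM mulmx_sumr ev_sum ev_mulr; apply: eq_bigr => k _.
by rewrite -scalemxAr evZ ev_left.
Qed.
(** The radical is stable under left multiplication, since [tr (a u b) = tr (u b a)]. *)
Lemma order_desc k : T *m X k = M k *m T.
Proof.
rewrite /X -mulmxA; apply: (quot_desc qST) => u uT; rewrite mulmxA; apply: (quot_eq0 qST) => j.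
rewrite ev_left -mulmxA mxtrace_mulC -mulmxA gaM; exact: (quot_tr qST).
Qed.
Lemma order_lm v a : v *m T *m lm a = v *m MM a *m T.
Proof.
rewrite /lm /MM !mulmx_sumr mulmx_suml; apply: eq_bigr => k _.
by rewrite -!scalemxAr -scalemxAl -mulmxA order_desc mulmxA.
Qed.
Lemma lm_ext A B : (forall v, v *m T *m A = v *m T *m B) -> A = B :> 'M[int]_e.
Proof.
move=> h; apply/row_matrixP => i; have := h (row i S).
by rewrite -row_mul (proj1 qST) -!row_mul !mul1mx.
Qed.
Lemma lmB a b : lm (a - b) = lm a - lm b.
Proof. by rewrite /lm -sumrB; apply: eq_bigr => k _; rewrite !mxE scalerBl. Qed.
(** The radical is stable under right multiplication as well, so left multiplication on the quotient
    depends only on the class of [a]. *)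
Lemma lm_sect a : lm (a *m T *m S) = lm a.
Proof.
apply/esym/eqP; rewrite -subr_eq0 -lmB; apply/eqP/lm_ext => v.
rewrite order_lm mulmx0; apply: (quot_eq0 qST) => j.
rewrite ev_MM -mulmxA; have -> : ev ga v *m ga j = ev ga (delta_mx 0 j *m MM v).
  by rewrite ev_MM ev_delta.
by apply: (quot_tr qST); exact: (quot_sect qST).
Qed.

Let Lb i := lm (row i S).
Let o := u1 *m T.
Let LmE z : Lm Lb z = lm (z *m S).
Proof.
rewrite /Lm /Lb /lm; under eq_bigr do rewrite scaler_sumr.
rewrite exchange_big; apply: eq_bigr => k _; rewrite [in RHS]mxE scaler_suml.
by apply: eq_bigr => i _; rewrite mxE scalerA.
Qed.
Let LmT a : Lm Lb (a *m T) = lm a. Proof. by rewrite LmE lm_sect. Qed.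
Let onto z : z = z *m S *m T. Proof. by rewrite -mulmxA (proj1 qST) mulmx1. Qed.

Let L_assoc y z : Lm Lb (y *m Lm Lb z) = Lm Lb y *m Lm Lb z.
Proof.
rewrite (onto y) (onto z) !LmT order_lm LmT; apply: lm_ext => w.
rewrite mulmxA !order_lm; apply: (quot_ev qST).
by rewrite !ev_MM mulmxA.
Qed.
Let L_unit : Lm Lb o = 1%:M.
Proof.
by rewrite /o LmT; apply: lm_ext => w; rewrite order_lm mulmx1; apply: (quot_ev qST);
  rewrite ev_MM ga1 mul1mx.
Qed.
Let R_unit y : o *m Lm Lb y = y.
Proof.
by rewrite (onto y) LmT /o order_lm; apply: (quot_ev qST); rewrite ev_MM ga1 mulmx1.
Qed.

Let zpow z k := iter k (fun y => y *m Lm Lb z) o.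
Let wpow z k := iter k (fun w => w *m MM (z *m S)) u1.

Let wpowT z k : wpow z k *m T = zpow z k.
Proof. by elim: k => //= k IH; rewrite -order_lm IH LmE. Qed.
Let wpow_ev z k : ev ga (wpow z k) = mxpow (ev ga (z *m S)) k.
Proof. by elim: k => //= k IH; rewrite ev_MM IH. Qed.
Let Rm_zpow z k : Rm Lb (zpow z k) = mxpow (Rm Lb z) k.
Proof.
elim: k => [|k IH]; first by apply: Lm_inj_eq => y; rewrite RmE R_unit mulmx1.
by rewrite /= (Rm_assoc L_assoc) IH.
Qed.

(** By the regular trace form right multiplication by [z] is nilpotent, so a power of [z] vanishes
    in the quotient. The lift of that power lies in the radical of the matrix trace form; all its
    powers then have trace zero, and it is a nilpotent matrix. *)
Lemma order_nilp z : (forall y, tform Lb (y *m Lm Lb z) = 0) -> mxnilp (ev ga (z *m S)).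
Proof.
move=> h; have [N RN] : mxnilp (Rm Lb z).
  by apply: trace_pow_nilp => k; rewrite -Rm_zpow; exact: h.
have zN : zpow z N = 0.
  by rewrite -[LHS]mulmx1 -L_unit -RmE Rm_zpow RN mulmx0.
have [k xk] : mxnilp (mxpow (ev ga (z *m S)) N).
  apply: trace_pow_nilp => k; rewrite /mxpow /= -/(mxpow _ N) -/(mxpow (mxpow _ _) k) mxpowM
    -!wpow_ev.
  by apply: (quot_tr qST); rewrite wpowT.
by exists (N * k)%N; rewrite -mxpowM.
Qed.

(** If [v] is in the radical of the regular form, its multiples are nilpotent up to elements of the
    matrix radical. Their matrix traces vanish, so [v] itself belongs to that radical and is zero in
    the quotient. *)
Lemma order_gram_nz : \det (gram Lb) != 0.
Proof.
apply/negP => /det0P[v v0 vg]; case/negP: v0; apply/eqP.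
have hv y : tform Lb (y *m Lm Lb v) = 0 by rewrite tform_gram vg mul0mx mxE.
rewrite (onto v); apply: (quot_eq0 qST) => j.
pose w : 'rV[int]_l := delta_mx 0 j *m MM (v *m S).
have -> : ev ga (v *m S) *m ga j = ev ga w by rewrite /w ev_MM ev_delta.
pose z := w *m T.
have zE : z = delta_mx 0 j *m T *m Lm Lb v by rewrite /z -order_lm LmE.
have -> : ev ga w = ev ga (z *m S) + ev ga (w - z *m S) by rewrite evB addrC subrK.
rewrite mxtraceD nilp_trace ?add0r.
  by rewrite -[X in \tr X]mulmx1 -ga1; apply: (quot_tr qST); exact: (quot_sect qST).
apply: order_nilp => y; rewrite zE L_assoc mulmxA; exact: hv.
Qed.

Lemma order_semisimple : semisimple (fun k => S *m M k *m T).
Proof.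
have key := gram_semisimple L_assoc L_unit R_unit order_gram_nz (z := fun k => row k T).
have E k : Lm Lb (row k T) = S *m M k *m T.
  rewrite rowE LmT /lm (bigD1 k) //= big1 ?addr0 => [|j jk]; first by rewrite mxE !eqxx scale1r.
  by rewrite mxE eqxx (negPf jk) scale0r.
move=> U UU UX; have [||D [P [D0 PL UP PU]]] := key _ U UU.
- move=> U' h y; rewrite LmE /lm mulmx_sumr mulmx_suml; apply: eq_bigr => k _.
  by rewrite -scalemxAr -scalemxAl; congr (_ *: _); have := h k; rewrite E.
- by move=> k; rewrite E; exact: UX.
by exists D, P; split=> // k; rewrite -E.
Qed.
End Order.

Lemma expr_bounded : exists f, mfun f /\ forall s d d' l p
  (ga : 'I_l -> 'M[int]_(d, d')) (x : 'I_p -> 'M[int]_(d, d')),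
  (d <= s)%N -> (d' <= s)%N -> (l <= s)%N -> (p <= s)%N ->
  (forall i, mxle s (ga i)) -> (forall i, mxle s (x i)) ->
  (forall i, exists u, x i = ev ga u) ->
  exists M : 'M[int]_(p, l), mxle (f s) M /\ forall i, x i = ev ga (row i M).
Proof.
have [f [mf hf]] := lin_solve_mx.
pose h s := (s + s * s * s + s * s)%N.
exists (fun s => f (h s)); split; first by rewrite /h; mf_tac.
move=> s d d' l p ga x ds ds' ls ps sga sx hx.
have sh : (s <= h s)%N by rewrite /h -addnA leq_addr.
have [u hu] := fin_all_exists hx.
pose K : finType := ('I_p * 'I_d * 'I_d')%type.
pose phi (k : K) (A : 'M[int]_(p, l)) := ev ga (row k.1.1 A) k.1.2 k.2.
have [|||||||M [hM bM]] := hf (h s) p l K phi (fun k => x k.1.1 k.1.2 k.2) (\matrix_i u i).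
- exact: leq_trans ps sh.
- exact: leq_trans ls sh.
- rewrite /K !card_prod !card_ord /h.
  have : (p * d * d' <= s * s * s)%N by rewrite !leq_mul.
  by lia.
- move=> k A B; rewrite /phi; have -> : row k.1.1 (A + B) = row k.1.1 A + row k.1.1 B by rewrite
  linearD.
  by rewrite evD mxE.
- move=> k A A1; rewrite /phi /ev summxE; apply: leq_trans (absz_sum _ _ _) _.
  apply: (@leq_trans (\sum_(i < l) s)).
    apply: leq_sum => i _; rewrite !mxE abszM -[s]mul1n; apply: leq_mul; [exact: A1 | exact: sga].
  rewrite sum_nat_const card_ord /h.
  have : (l * s <= s * s)%N by rewrite leq_mul.
  by lia.
- by move=> k; apply: leq_trans (sx _ _ _) sh.
- by move=> k; rewrite /phi rowK -hu.
exists M; split=> // i; apply/matrixP => a b.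
by have := hM (i, a, b); rewrite /phi /=.
Qed.

Lemma nilp_unit n (A : 'M[int]_n) : mxnilp A -> 1%:M + A \in unitmx.
Proof.
move=> [k Ak]; pose S := \sum_(i < k) (-1) ^+ i *: mxpow A i.
suff h : (1%:M + A) *m S = 1%:M by have [] := mulmx1_unit h.
have key m : (1%:M + A) *m (\sum_(i < m) (-1) ^+ i *: mxpow A i) = 1%:M - (-1) ^+ m *: mxpow A m.
  elim: m => [|m IH]; first by rewrite big_ord0 mulmx0 expr0 scale1r subrr.
  rewrite big_ord_recr mulmxDr IH /= mulmxDl mul1mx -scalemxAr exprS mulN1r scaleNr opprK.
  by rewrite -/(mxpow A m.+1) addrA subrK.
by rewrite key Ak scaler0 subr0.
Qed.

Lemma ev_closed d d1 d2 l l1 l2 (f : 'I_l -> 'M[int]_(d, d1)) (g : 'I_l1 -> 'M[int]_(d1, d2))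
    (h : 'I_l2 -> 'M[int]_(d, d2)) :
  (forall i j, exists u, f i *m g j = ev h u) -> forall u v, exists w, ev f u *m ev g v = ev h w.
Proof.
move=> H u v.
have /fin_all_exists[W hW] i : exists w, f i *m ev g v = ev h w.
  have [w hw] := fin_all_exists (H i).
  exists (v *m \matrix_j w j); rewrite ev_mulmx ev_mull; apply: eq_ev => j.
  by rewrite rowK.
exists (u *m \matrix_i W i); rewrite ev_mulmx ev_mulr; apply: eq_ev => i.
by rewrite rowK.
Qed.

Lemma semisimple_ext (K : Type) N (X Y : K -> 'M[int]_N) : X =1 Y -> semisimple X -> semisimple Y.
Proof.
move=> XY sX U UU UY; have [|D [P [D0 PX UP PU]]] := sX U UU; first by move=> k; rewrite XY.
by exists D, P; split=> // k; rewrite -XY.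
Qed.

(* [ga] spans an order Gamma, [f] and [g] span lattices H and H' with
   H = Gamma alpha.  Modulo the radicals of the trace pairings, alpha becomes an
   isomorphism of semisimple Gamma-lattices, which [semisimple_iso_mod] makes
   bounded; any lift of a generator of H modulo its radical generates H. *)
Lemma lattice_iso : exists F, mfun F /\ forall s d l l1 l2 (ga : 'I_l -> 'M[int]_d)
    (f : 'I_l1 -> 'M[int]_d) (g : 'I_l2 -> 'M[int]_d) k a b,
  [/\ (d <= s)%N, (l <= s)%N, (l1 <= s)%N, (l2 <= s)%N & (0 < k <= s)%N] ->
  [/\ forall i, mxle s (ga i), forall i, mxle s (f i) & forall i, mxle s (g i)] ->
  (exists u, ev ga u = 1%:M) ->
  [/\ forall i j, exists u, ga i *m ga j = ev ga u,
      forall i j, exists u, ga i *m f j = ev f u,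
      forall i j, exists u, g i *m ga j = ev g u &
      forall i j, exists u, f i *m g j = ev ga u] ->
  ev f a *m ev g b = 1%:M ->
  exists a', [/\ mxle (F s) a', congm k a' a & ev f a' \in unitmx].
Proof.
have [fe [mfe hfe]] := expr_bounded.
have [fq [mfq hfq]] := lin_quot.
have [fs [mfs hfs]] := semisimple_iso_mod.
have [fl [mfl hfl]] := lin_solve_mx.
pose s1 s := (s + s * (s * s) + s * (s * (s * s)) + 1)%N.
pose s2 s := (s1 s + fe (s1 s) + fq (s1 s))%N.
pose s3 s := (s2 s + s2 s * (s2 s * (s2 s * (s2 s * s2 s))))%N.
pose s4 s := (s3 s + fs (s3 s) + s3 s * (s3 s * (s3 s * (s3 s * fs (s3 s)))) + s3 s * (s3 s * s3
  s))%N.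
pose s5 s := (s4 s + fl (s4 s) * s4 s)%N.
exists s5; split.
  have m1 : mfun s1 by rewrite /s1; mf_tac.
  have m2 : mfun s2 by rewrite /s2; mf_tac.
  have m3 : mfun s3 by rewrite /s3; mf_tac.
  have m4 : mfun s4 by rewrite /s4; mf_tac.
  by rewrite /s5; mf_tac.
move=> s d l l1 l2 ga f g k a b [ds ls l1s l2s /andP[k0 ks]] [sga sf sg] has1 [cgg cgf cga cfg] ab.
have e01 : (s <= s1 s)%N by rewrite /s1; lia.
have e12 : (s1 s <= s2 s)%N by rewrite /s2; lia.
have e12e : (fe (s1 s) <= s2 s)%N by rewrite /s2; lia.
have e12q : (fq (s1 s) <= s2 s)%N by rewrite /s2; lia.
have e23 : (s2 s <= s3 s)%N by rewrite /s3; lia.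
have e34 : (s3 s <= s4 s)%N by rewrite /s4; lia.
have prod_le p q r (A : 'M[int]_(p, q)) (B : 'M[int]_(q, r)) : (q <= s)%N -> mxle s A ->
  mxle s B -> mxle (s1 s) (A *m B).
  move=> qs sA sB; apply: (mxleW (mxle_mul sA sB)).
  have : (q * (s * s) <= s * (s * s))%N by rewrite leq_mul2r qs orbT.
  by rewrite /s1; lia.
have W1 p q (A : 'M[int]_(p, q)) : mxle s A -> mxle (s1 s) A by move=> h; exact: mxleW h e01.
have ds1 := leq_trans ds e01; have ls1 := leq_trans ls e01; have l1s1 := leq_trans l1s e01;
  have l2s1 := leq_trans l2s e01.
have [U1 [bU1 hU1]] : exists U : 'M[int]_(1, l), mxle (fe (s1 s)) U /\ forall i : 'I_1,
  1%:M = ev ga (row i U).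
  apply: hfe => //; first by rewrite /s1 addn1.
  - by move=> i; apply: W1.
  - by move=> i; apply: (mxleW (@mxle1 d)); rewrite /s1 addn1.
  - by move=> i; have [u hu] := has1; exists u.
pose u1 := row 0 U1; have gu1 : ev ga u1 = 1%:M by rewrite -(hU1 0).
have /fin_all_exists[MG hMG] i : exists M : 'M[int]_l, mxle (fe (s1 s)) M /\
    forall j, ga i *m ga j = ev ga (row j M).
  apply: hfe => // j; [exact: W1 | exact: prod_le].
have /fin_all_exists[MH hMH] i : exists M : 'M[int]_l1, mxle (fe (s1 s)) M /\
    forall j, ga i *m f j = ev f (row j M).
  apply: hfe => // j; [exact: W1 | exact: prod_le].
have pair_le p q (x : 'I_p -> 'M[int]_d) (y : 'I_q -> 'M[int]_d) : (forall i, mxle s (x i)) ->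
    (forall i, mxle s (y i)) -> mxle (s1 s) (pair_mx x y).
  move=> sx sy i j; rewrite mxE /mxtrace; apply: leq_trans (absz_sum _ _ _) _.
  apply: (@leq_trans (\sum_(t < d) d * (s * s))).
    by apply: leq_sum => t _; exact: mxle_mul.
  rewrite sum_nat_const card_ord.
  have : (d * (d * (s * s)) <= s * (s * (s * s)))%N by rewrite leq_mul // leq_mul2r ds orbT.
  by rewrite /s1; lia.
have [e [SG [TG [es bSG bTG STG kG]]]] := hfq (s1 s) l l _ ls1 ls1 (pair_le _ _ _ _ sga sga).
have [e' [SH [TH [es' bSH bTH STH kH]]]] := hfq (s1 s) l1 l2 _ l1s1 l2s1 (pair_le _ _ _ _ sf sg).
have qG : is_quot ga ga SG TG by split.
have qH : is_quot f g SH TH by split.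
pose al := ev f a; pose be := ev g b.
have ba : be *m al = 1%:M by rewrite (mulmx1C ab).
have /fin_all_exists[A hA] i : exists w, ga i *m al = ev f w.
  have [w hw] := ev_closed cgf (delta_mx 0 i) a.
  by exists w; rewrite -hw ev_delta.
have /fin_all_exists[A' hA'] i : exists w, f i *m be = ev ga w.
  have [w hw] := ev_closed cfg (delta_mx 0 i) b.
  by exists w; rewrite -hw ev_delta.
pose Am := \matrix_i A i; pose Am' := \matrix_i A' i.
have evA u : ev f (u *m Am) = ev ga u *m al.
  by rewrite ev_mulmx ev_mulr; apply: eq_ev => i; rewrite rowK.
have evA' u : ev ga (u *m Am') = ev f u *m be.
  by rewrite ev_mulmx ev_mulr; apply: eq_ev => i; rewrite rowK.
have evMG i u : ev ga (u *m MG i) = ga i *m ev ga u.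
  by rewrite ev_mulmx ev_mull; apply: eq_ev => j; rewrite (proj2 (hMG i)).
have evMH i u : ev f (u *m MH i) = ga i *m ev f u.
  by rewrite ev_mulmx ev_mull; apply: eq_ev => j; rewrite (proj2 (hMH i)).
(* The maps induced on the quotients by right multiplication with [al] and with its inverse [be]. *)
pose Om := SG *m (Am *m TH); pose Om' := SH *m (Am' *m TG).
have dA : TG *m Om = Am *m TH.
  apply: (quot_desc qG) => u uT; rewrite mulmxA; apply: (quot_eq0 qH) => j.
  rewrite evA -mulmxA; have [w hw] := ev_closed cfg a (delta_mx 0 j); rewrite ev_delta in hw.
  by rewrite hw; apply: (quot_tr qG).
have dA' : TH *m Om' = Am' *m TG.
  apply: (quot_desc qH) => u uT; rewrite mulmxA; apply: (quot_eq0 qG) => j.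
  rewrite evA' -mulmxA; have [w hw] := ev_closed cga b (delta_mx 0 j); rewrite ev_delta in hw.
  by rewrite hw; apply: (quot_tr qH).
pose XG i := SG *m MG i *m TG; pose XH i := SH *m MH i *m TH.
have dG i : TG *m XG i = MG i *m TG by apply: order_desc qG i => p q; exact: (proj2 (hMG p)).
have dH i : TH *m XH i = MH i *m TH.
  rewrite /XH -mulmxA; apply: (quot_desc qH) => u uT; rewrite mulmxA; apply: (quot_eq0 qH) => j.
  rewrite evMH -mulmxA mxtrace_mulC -mulmxA.
  by have [w hw] := cga j i; rewrite hw; apply: (quot_tr qH).
have OO' : Om *m Om' = 1%:M.
  rewrite /Om -!mulmxA dA' (mulmxA Am) (quot_ev_mx qG (B' := 1%:M)); first by rewrite mul1mx STG.
  by move=> i; rewrite row_mul evA' rowE evA -mulmxA ab mulmx1 row1.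
have O'O : Om' *m Om = 1%:M.
  rewrite /Om' -!mulmxA dA (mulmxA Am') (quot_ev_mx qH (B' := 1%:M)); first by rewrite mul1mx STH.
  by move=> i; rewrite row_mul evA rowE evA' -mulmxA ba mulmx1 row1.
have ee : e = e' by apply/eqP; rewrite eqn_leq (mulmx1_min OO') (mulmx1_min O'O).
subst e'.
have [uO _] := mulmx1_unit OO'; have [uO' _] := mulmx1_unit O'O.
have cO i : Om *m XH i = XG i *m Om.
  rewrite {1}/Om -!mulmxA dH dA; congr (_ *m _); rewrite !mulmxA.
  by apply: (quot_ev_mx qH) => j; rewrite !row_mul evMH evA rowK -hA -(proj2 (hMG i)) mulmxA.
have ssG : semisimple XG by apply: (order_semisimple (u1 := u1) _ gu1 qG) => i j;
  exact: (proj2 (hMG i)).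
have ssH : semisimple XH.
  apply: semisimple_ext (semisimple_conj uO' ssG) => i /=.
  have -> : invmx Om' = Om by rewrite -[Om]mul1mx -(mulVmx uO') -mulmxA O'O mulmx1.
  by rewrite -mulmxA -cO mulmxA O'O mul1mx.
have X_le p (q : nat) (SS : 'M[int]_(q, p)) (M : 'M[int]_p) (TT : 'M[int]_(p, q)) : (p <= s1 s)%N ->
    mxle (fq (s1 s)) SS -> mxle (fe (s1 s)) M -> mxle (fq (s1 s)) TT -> mxle (s3 s) (SS *m M *m TT).
  move=> ps bS bM bT; have ps2 := leq_trans ps e12.
  apply: (mxleW (mxle_mul (mxle_mul (mxleW bS e12q) (mxleW bM e12e)) (mxleW bT e12q))).
  apply: (@leq_trans (s2 s * (s2 s * (s2 s * s2 s) * s2 s))%N).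
    by apply: leq_mul => //; rewrite leq_mul2r; apply/orP; right; rewrite leq_mul2r ps2 orbT.
  by rewrite /s3; lia.
have [|||||h [uh bh ch [D hD]]] := hfs (s3 s) _ e XH XG Om k _ _ _ _ ssH uO cO.
- exact: leq_trans es (leq_trans e12 e23).
- by rewrite card_ord; apply: leq_trans ls1 (leq_trans e12 e23).
- by move=> i; apply: X_le => //; case: (hMH i).
- by move=> i; apply: X_le => //; case: (hMG i).
- by rewrite k0 /=; apply: leq_trans ks (leq_trans e01 (leq_trans e12 e23)).
(* [w] is the image of the unit under the bounded isomorphism [h], as [a *m TH] is its image under
   [Om]; the two agree modulo [k]. *)
pose w := u1 *m TG *m h; pose z := u1 *m TG *m D.
have aT : a *m TH = u1 *m TG *m Om.
  by rewrite -mulmxA dA mulmxA; apply: (quot_ev qH); rewrite evA gu1 mul1mx.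
have wE : w = a *m TH + k%:Z *: z by rewrite /w hD mulmxDr -aT scalemxAr.
pose r := map_mx (fun x => (x %% k%:Z)%Z) a.
have [a0 ra] : congm k a r := congm_mod k a.
have aE : a *m TH = r *m TH + k%:Z *: (a0 *m TH).
  by rewrite [in LHS]ra mulmxDl -scalemxAl.
have k3 : (k <= s3 s)%N by apply: leq_trans ks (leq_trans e01 (leq_trans e12 e23)).
have l3 : (l1 <= s3 s)%N by apply: leq_trans l1s1 (leq_trans e12 e23).
have q3 : (fq (s1 s) <= s3 s)%N by apply: leq_trans e12q e23.
have br : mxle k r.
  move=> i j; rewrite mxE; have := @ltz_pmod (a i j) k%:Z k0; have := @modz_ge0 (a i j) k%:Z.
  by case: (k) k0 => // k' _ /(_ isT); lia.
have bw : mxle (s3 s * (s3 s * (s3 s * (s3 s * fs (s3 s))))) w.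
  have bu : mxle (fe (s1 s)) u1 by move=> i j; rewrite mxE.
  apply: (mxleW (mxle_mul (mxle_mul bu bTG) bh)).
  apply: leq_mul; first exact: leq_trans es (leq_trans e12 e23).
  rewrite !mulnA leq_mul2r; apply/orP; right; apply: leq_mul; last exact: q3.
  by apply: leq_mul; [exact: leq_trans ls1 (leq_trans e12 e23) | exact: leq_trans e12e e23].
(* Lifts of [w] that are congruent to [a] have the form [r + k W], where [W] solves a linear system
   and can be taken bounded. *)
pose phi (j : 'I_e) (W : 'M[int]_(1, l1)) := (k%:Z *: (W *m TH)) 0 j.
have [|||||||W [hW bW]] := hfl (s4 s) 1%N l1 _ phi (fun j => (w - r *m TH) 0 j) (a0 + z *m SH).
- by apply: leq_trans e34; apply: leq_trans e23; apply: leq_trans e12; rewrite /s1 addn1.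
- exact: leq_trans l3 e34.
- by rewrite card_ord; apply: leq_trans es (leq_trans e12 (leq_trans e23 e34)).
- by move=> j B C; rewrite /phi mulmxDl scalerDr mxE.
- move=> j B B1; rewrite /phi mxE abszM.
  apply: (@leq_trans (s3 s * (s3 s * s3 s))%N); last by rewrite /s4; lia.
  apply: leq_mul => //; apply: leq_trans (mxle_mul B1 bTH _ _) _.
  by rewrite mul1n; apply: leq_mul.
- move=> j; apply: leq_trans (mxle_sub bw (mxle_mul br bTH) 0 j) _.
  have : (l1 * (k * fq (s1 s)) <= s3 s * (s3 s * s3 s))%N by apply: leq_mul => //; apply: leq_mul.
  by rewrite /s4; lia.
- move=> j; rewrite /phi; congr (fun_of_matrix _ 0 j).
  rewrite mulmxDl -mulmxA STH mulmx1 scalerDr wE aE.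
  by rewrite addrAC [r *m TH + _]addrC addrK.
pose a' := r + k%:Z *: W.
have a'T : a' *m TH = w.
  have e1 : k%:Z *: (W *m TH) = w - r *m TH by apply/rowP => j; exact: hW j.
  by rewrite mulmxDl -scalemxAl e1 addrC subrK.
exists a'; split.
- apply: (mxleW (mxle_add br (_ : mxle (k * fl (s4 s)) (k%:Z *: W)))).
    by move=> i j; rewrite mxE abszM leq_mul2l bW orbT.
  by rewrite /s5 mulnC; apply: leq_add; [exact: leq_trans k3 e34 |
    rewrite leq_mul2l (leq_trans k3 e34) orbT].
- by apply: congm_trans (congm_sym (congm_mod k a)); exists W.
(* As [h] is onto, some [y] in Gamma carries the class of the new generator back to that of [a]. *)
have [y yT] : exists y : 'rV[int]_l, y *m TG *m h = a *m TH.
  by exists (a *m TH *m invmx h *m SG); rewrite -(mulmxA _ SG) STG mulmx1 mulmxKV.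
pose MMH := \sum_i y 0 i *: MH i; pose MMG := \sum_i y 0 i *: MG i.
have evMMH v : ev f (v *m MMH) = ev ga y *m ev f v.
  rewrite /MMH mulmx_sumr ev_sum ev_mulr; apply: eq_bigr => i _.
  by rewrite -scalemxAr evZ evMH.
have evMMG v : ev ga (v *m MMG) = ev ga y *m ev ga v.
  rewrite /MMG mulmx_sumr ev_sum ev_mulr; apply: eq_bigr => i _.
  by rewrite -scalemxAr evZ evMG.
pose LG := \sum_i y 0 i *: XG i; pose LH := \sum_i y 0 i *: XH i.
have dLG : TG *m LG = MMG *m TG.
  rewrite /LG /MMG mulmx_sumr mulmx_suml; apply: eq_bigr => i _.
  by rewrite -scalemxAr dG -scalemxAl.
have dLH : TH *m LH = MMH *m TH.
  rewrite /LH /MMH mulmx_sumr mulmx_suml; apply: eq_bigr => i _.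
  by rewrite -scalemxAr dH -scalemxAl.
have hLL : h *m LH = LG *m h.
  rewrite /LG /LH mulmx_sumr mulmx_suml; apply: eq_bigr => i _.
  by rewrite -scalemxAr ch -scalemxAl.
have key : (a' *m MMH - a) *m TH = 0.
  rewrite mulmxBl -(mulmxA a') -dLH mulmxA a'T /w -mulmxA hLL mulmxA -(mulmxA u1) dLG.
  rewrite -yT mulmxA (quot_ev qG (u' := y)) ?subrr //.
  by rewrite evMMG gu1 mulmx1.
have evk : ev f (a' *m MMH - a) = ev ga y *m ev f a' - al by rewrite evB evMMH.
pose j := (ev ga y *m ev f a' - al) *m be.
have jE : exists u, j = ev ga u.
  have [u hu] := ev_closed cfg (a' *m MMH - a) b.
  by exists u; rewrite /j -evk hu.
have bj n : exists u, be *m mxpow j n = ev g u.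
  elim: n => [|n [u IH]]; first by exists b; rewrite mulmx1.
  rewrite mxpowSr mulmxA IH; have [v ->] := jE.
  exact: ev_closed cga u v.
have nj : mxnilp j.
  apply: trace_pow_nilp => n; rewrite /mxpow /= -/(mxpow j n) {1}/j -mulmxA.
  by have [u ->] := bj n; rewrite -evk; apply: (quot_tr qH).
have := nilp_unit nj.
have -> : 1%:M + j = ev ga y *m (ev f a' *m be) by rewrite /j mulmxBl ab addrC subrK mulmxA.
by case/mul_inv_det => _ /mul_inv_det[].
Qed.

(** * Modules with torsion *)

(* [R] and [X] present a module: the cokernel of [R] with operators [X]; the
   matrix [F] induces a homomorphism to the module presented by [R'], [X']. *)
Definition hom_mx (K : Type) m n m' n' (R : 'M[int]_(m, n)) (X : K -> 'M[int]_n)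
    (R' : 'M[int]_(m', n')) (X' : K -> 'M[int]_n') (F : 'M[int]_(n, n')) :=
  (exists C, R *m F = C *m R') /\ forall k, exists D, X k *m F - F *m X' k = D *m R'.

Lemma hom_mx_mul (K : Type) m n m' n' m'' n'' (R : 'M[int]_(m, n)) (X : K -> 'M[int]_n)
    (R' : 'M[int]_(m', n')) (X' : K -> 'M[int]_n') (R'' : 'M[int]_(m'', n'')) (X'' : K ->
      'M[int]_n'') F G :
  hom_mx R X R' X' F -> hom_mx R' X' R'' X'' G -> hom_mx R X R'' X'' (F *m G).
Proof.
move=> [[C hC] hD] [[C' hC'] hD']; split.
  by exists (C *m C'); rewrite mulmxA hC -mulmxA hC' mulmxA.
move=> k; have [D eD] := hD k; have [D' eD'] := hD' k.
exists (D *m C' + F *m D').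
have -> : X k *m (F *m G) - F *m G *m X'' k = (X k *m F - F *m X' k) *m G + F *m (X' k *m G - G
  *m X'' k).
  by rewrite mulmxBl mulmxBr !mulmxA addrA subrK.
by rewrite eD eD' -mulmxA hC' mulmxDl !mulmxA.
Qed.

Lemma hom_mx1 (K : Type) m n (R : 'M[int]_(m, n)) (X : K -> 'M[int]_n) : hom_mx R X R X 1%:M.
Proof.
split; first by exists 1%:M; rewrite mulmx1 mul1mx.
by move=> k; exists 0; rewrite mulmx1 mul1mx subrr mul0mx.
Qed.

Lemma hom_mx_ev (K : Type) m n m' n' (R : 'M[int]_(m, n)) (X : K -> 'M[int]_n)
    (R' : 'M[int]_(m', n')) (X' : K -> 'M[int]_n') l (f : 'I_l -> 'M[int]_(n, n')) u :
  (forall i, hom_mx R X R' X' (f i)) -> hom_mx R X R' X' (ev f u).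
Proof.
move=> hf; have /fin_all_exists[C hC] i : exists C, R *m f i = C *m R' by case: (hf i).
split; first by exists (ev C u); rewrite ev_mull ev_mulr; apply: eq_ev.
move=> k; have /fin_all_exists[D hD] i : exists D, X k *m f i - f i *m X' k = D *m R'.
  by have [_ /(_ k)] := hf i.
exists (ev D u); rewrite [RHS]ev_mulr -(eq_ev u hD) ev_mull ev_mulr /ev -sumrB.
by apply: eq_bigr => i _; rewrite scalerBr.
Qed.

Lemma hom_mx_gen : exists f, mfun f /\ forall s (K : finType) m n m' n' (R : 'M[int]_(m,
    n)) (X : K -> 'M[int]_n)
    (R' : 'M[int]_(m', n')) (X' : K -> 'M[int]_n'),
  [/\ (#|K| <= s)%N, (m <= s)%N, (n <= s)%N, (m' <= s)%N & (n' <= s)%N] ->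
  [/\ mxle s R, mxle s R', forall k, mxle s (X k) & forall k, mxle s (X' k)] ->
  exists l (e : 'I_l -> 'M[int]_(n, n')), [/\ (l <= f s)%N, forall a, mxle (f s) (e a),
    forall a, hom_mx R X R' X' (e a) & forall F, hom_mx R X R' X' F -> exists u, F = ev e u].
Proof.
have [f [mf hf]] := lin_gen.
pose h s := (s + s * s + s * s + s * s * s + 3 * (s * s))%N.
exists (fun s => f (h s) + h s)%N; split; first by rewrite /h; mf_tac.
move=> s K m n m' n' R X R' X' [Ks ms ns m's n's] [sR sR' sX sX'].
pose I : finType := ('I_n * 'I_n' + 'I_m * 'I_m' + K * 'I_n * 'I_m')%type.
pose J : finType := ('I_m * 'I_n' + K * 'I_n * 'I_n')%type.
pose Fx (x : {ffun I -> int}) := \matrix_(i, j) x (inl (inl (i, j))) : 'M[int]_(n, n').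
pose Cx (x : {ffun I -> int}) := \matrix_(i, j) x (inl (inr (i, j))) : 'M[int]_(m, m').
pose Dx (x : {ffun I -> int}) k := \matrix_(i, j) x (inr (k, i, j)) : 'M[int]_(n, m').
have FxD x y : Fx (x + y) = Fx x + Fx y by apply/matrixP => i j; rewrite !mxE ffunE.
have CxD x y : Cx (x + y) = Cx x + Cx y by apply/matrixP => i j; rewrite !mxE ffunE.
have DxD x y k : Dx (x + y) k = Dx x k + Dx y k by apply/matrixP => i j; rewrite !mxE ffunE.
pose phi (k : J) x := match k with
  | inl (i, j) => (R *m Fx x - Cx x *m R') i j
  | inr (k, i, j) => (X k *m Fx x - Fx x *m X' k - Dx x k *m R') i j end.
have mul_le p q r (A : 'M[int]_(p, q)) (B : 'M[int]_(q, r)) t t' : (q <= s)%N -> mxle t A ->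
  mxle t' B -> (t * t' = s)%N ->
    mxle (s * s) (A *m B).
  by move=> qs hA hB tt; apply: (mxleW (mxle_mul hA hB)); rewrite tt leq_mul2r qs orbT.
have [||||l [e [ls e0 be ge]]] := hf (h s) I J phi.
- rewrite /I !card_sum !card_prod !card_ord /h.
  have h1 : (n * n' <= s * s)%N by rewrite leq_mul.
  have h2 : (m * m' <= s * s)%N by rewrite leq_mul.
  have h3 : (#|K| * n * m' <= s * s * s)%N by rewrite !leq_mul.
  by lia.
- rewrite /J !card_sum !card_prod !card_ord /h.
  have h1 : (m * n' <= s * s)%N by rewrite leq_mul.
  have h3 : (#|K| * n * n' <= s * s * s)%N by rewrite !leq_mul.
  by lia.
- have addE p q (A B : 'M[int]_(p, q)) i j : A i j + B i j = (A + B) i j by rewrite mxE.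
  case=> [[i j]|[[k i] j]] x y /=; rewrite addE; congr (fun_of_matrix _ i j).
    by rewrite FxD CxD mulmxDr mulmxDl opprD addrACA.
  by rewrite FxD DxD mulmxDr !mulmxDl !opprD !addrA; apply/matrixP => a b; rewrite !mxE; ring.
- have hx1 (x : {ffun I -> int}) : (forall i, (`|x i| <= 1)%N) -> [/\ mxle 1 (Fx x),
  mxle 1 (Cx x) & forall k, mxle 1 (Dx x k)].
    by move=> h1; split=> [i j|i j|k i j]; rewrite mxE.
  case=> [[i j]|[[k i] j]] x /hx1[h1 h2 h3] /=.
    apply: leq_trans (mxle_sub (mul_le _ _ _ _ _ _ _ ns sR h1 (muln1 s)) (mul_le _ _ _ _ _ _ _
      m's h2 sR' (mul1n s)) i j) _.
    by rewrite /h; lia.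
  apply: leq_trans (mxle_sub (mxle_sub (mul_le _ _ _ _ _ _ _ ns (sX k) h1 (muln1 s)) (mul_le _ _
    _ _ _ _ _ n's h1 (sX' k) (mul1n s)))
    (mul_le _ _ _ _ _ _ _ m's (h3 k) sR' (mul1n s)) i j) _.
  by rewrite /h; lia.
exists l, (fun a => Fx (e a)); split.
- by apply: leq_trans ls (leq_addl _ _).
- by move=> a i j; rewrite mxE; apply: leq_trans (be _ _) (leq_addr _ _).
- move=> a; split.
    exists (Cx (e a)); apply/eqP; rewrite -subr_eq0; apply/eqP/matrixP => i j.
    by have := e0 a (inl (i, j)); rewrite /= => ->; rewrite mxE.
  move=> k; exists (Dx (e a) k); apply/eqP; rewrite -subr_eq0; apply/eqP/matrixP => i j.
  by have := e0 a (inr (k, i, j)); rewrite /= => ->; rewrite mxE.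
move=> F [[C hC] hD]; have [D {}hD] := fin_all_exists hD.
pose x : {ffun I -> int} := [ffun t => match t with inl (inl (i, j)) => F i j
  | inl (inr (i, j)) => C i j | inr (k, i, j) => D k i j end].
have [|z xz] := ge x.
  have FE : Fx x = F by apply/matrixP => i j; rewrite mxE ffunE.
  have CE : Cx x = C by apply/matrixP => i j; rewrite mxE ffunE.
  have DE k : Dx x k = D k by apply/matrixP => i j; rewrite mxE ffunE.
  by case=> [[i j]|[[k i] j]] /=; rewrite FE ?CE ?DE ?hC ?hD subrr mxE.
exists (\row_a z a); apply/matrixP => i j.
have := congr1 (fun y : {ffun I -> int} => y (inl (inl (i, j)))) xz.
rewrite ffunE /= => ->; rewrite sum_ffunE summxE; apply: eq_bigr => a _.
by rewrite ffun_mulz !mxE.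
Qed.

(** Homomorphisms preserve torsion: a vector killed by [T] has a multiple among the relations, which
    [F1] maps to relations and [T1] to zero. Hence [F1] descends to the torsion-free quotients. *)
Lemma hom_desc (K : Type) m n d k (R : 'M[int]_(m, n)) (X : K -> 'M[int]_n) (S : 'M[int]_(d,
    n)) (T : 'M[int]_(n, d)) :
  (0 < k)%N -> S *m T = 1%:M -> (forall v : 'rV[int]_n, v *m T = 0 -> exists c : 'rV[int]_m,
    k%:Z *: v = c *m R) ->
  forall m1 n1 d1 (R1 : 'M[int]_(m1, n1)) (X1 : K -> 'M[int]_n1) (S1 : 'M[int]_(d1,
    n1)) (T1 : 'M[int]_(n1, d1)) (F1 : 'M[int]_(n, n1)),
  S1 *m T1 = 1%:M -> R1 *m T1 = 0 -> hom_mx R X R1 X1 F1 -> T *m (S *m F1 *m T1) = F1 *m T1.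
Proof.
move=> k0 ST kT m1 n1 d1 R1 X1 S1 T1 F1 ST1 RT1 [[C hC] _]; apply/eqP; rewrite -subr_eq0; apply/eqP.
have -> : T *m (S *m F1 *m T1) - F1 *m T1 = (T *m S - 1%:M) *m F1 *m T1.
  by rewrite !mulmxBl mul1mx !mulmxA.
apply/row_matrixP => i; rewrite row0 !row_mul.
have [|c hc] := kT (row i (T *m S - 1%:M)).
  by rewrite -row_mul mulmxBl mul1mx -mulmxA ST mulmx1 subrr row0.
apply/rowP => j; rewrite [RHS]mxE; apply: (mulfI (_ : k%:Z != 0)).
  by rewrite eqz_nat -lt0n.
have E (A : 'rV[int]_d1) : k%:Z * A 0 j = (k%:Z *: A) 0 j by rewrite mxE.
by rewrite mulr0 E !scalemxAl hc -(mulmxA c) hC -!mulmxA RT1 !mulmx0 mxE.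
Qed.

Definition iso_mx m n m' n' (R : 'M[int]_(m, n)) (R' : 'M[int]_(m', n')) (F : 'M[int]_(n, n')) :=
  (forall v c, v *m F = c *m R' -> exists c', v = c' *m R :> 'rV_n) /\
  (forall w : 'rV[int]_n', exists v c, w = v *m F + c *m R').

(** [lattice_iso] is applied to the lattices that End(A), Hom(A, B) and Hom(B, A) induce on the
    torsion-free quotients, with [k] annihilating the torsion of A. The resulting [H] differs from
    [F] by [k] times a homomorphism, so it agrees with [F] on the torsion, and it is invertible on
    the quotient. *)
Lemma module_iso_bounded : exists f, mfun f /\ forall s (K : finType) m n m' n'
    (R : 'M[int]_(m, n)) (X : K -> 'M[int]_n) (R' : 'M[int]_(m', n')) (X' : K -> 'M[int]_n') F G,
  [/\ (#|K| <= s)%N, (m <= s)%N, (n <= s)%N, (m' <= s)%N & (n' <= s)%N] ->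
  [/\ mxle s R, mxle s R', forall k, mxle s (X k) & forall k, mxle s (X' k)] ->
  hom_mx R X R' X' F -> hom_mx R' X' R X G ->
  (exists E, F *m G = 1%:M + E *m R) -> (exists E, G *m F = 1%:M + E *m R') ->
  exists H, [/\ mxle (f s) H, hom_mx R X R' X' H & iso_mx R R' H].
Proof.
have [fg [mfg hfg]] := hom_mx_gen.
have [ft [mft hft]] := lin_torsion.
have [fl [mfl hfl]] := lattice_iso.
pose s1 s := (s + fg s + ft s)%N.
pose s2 s := (s1 s + s1 s * (s1 s * (s1 s * s1 s) * s1 s))%N.
exists (fun s => s2 s * (fl (s2 s) * s2 s))%N; split.
  have m1 : mfun s1 by rewrite /s1; mf_tac.
  have m2 : mfun s2 by rewrite /s2; mf_tac.
  by mf_tac.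
move=> s K m n m' n' R X R' X' F G [Ks ms ns m's n's] [sR sR' sX sX'] hF hG [E1 FG] [E2 GF].
have e01 : (s <= s1 s)%N by rewrite /s1 -addnA leq_addr.
have e01g : (fg s <= s1 s)%N by rewrite /s1; lia.
have e01t : (ft s <= s1 s)%N by rewrite /s1; lia.
have e12 : (s1 s <= s2 s)%N by rewrite /s2 leq_addr.
have [d [S [T [k [[ds bS bT /andP[k0 kb]] ST RT kT]]]]] := hft s m n R ms ns sR.
have [d' [S' [T' [k' [[d's bS' bT' /andP[k'0 k'b]] ST' RT' kT']]]]] := hft s m' n' R' m's n's sR'.
have [lc [ga [blc bga hga gga]]] := hfg s K m n m n R X R X (And5 Ks ms ns ms ns) (And4 sR sR sX
  sX).
have [lf [f [blf bf hf gf]]] := hfg s K m n m' n' R X R' X' (And5 Ks ms ns m's n's) (And4 sR sR'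
  sX sX').
have [lg [g [blg bg hg gg]]] := hfg s K m' n' m n R' X' R X (And5 Ks m's n's ms ns) (And4 sR' sR
  sX' sX).
have desc0 m1 n1 d1 (R1 : 'M[int]_(m1, n1)) (X1 : K -> 'M[int]_n1) S1 (T1 : 'M[int]_(n1,
  d1)) (F1 : 'M[int]_(n, n1)) :
    S1 *m T1 = 1%:M -> R1 *m T1 = 0 -> hom_mx R X R1 X1 F1 -> T *m (S *m F1 *m T1) = F1 *m T1.
  by move=> h1 h2; exact: (hom_desc k0 ST kT h1 h2).
have desc1 m1 n1 d1 (R1 : 'M[int]_(m1, n1)) (X1 : K -> 'M[int]_n1) S1 (T1 : 'M[int]_(n1,
  d1)) (F1 : 'M[int]_(n', n1)) :
    S1 *m T1 = 1%:M -> R1 *m T1 = 0 -> hom_mx R' X' R1 X1 F1 -> T' *m (S' *m F1 *m T1) = F1 *m T1.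
  by move=> h1 h2; exact: (hom_desc k'0 ST' kT' h1 h2).
have FB : (S *m F *m T') *m (S' *m G *m T) = 1%:M.
  rewrite -mulmxA (desc1 _ _ _ _ _ _ _ _ ST RT hG) mulmxA -(mulmxA S) FG mulmxDr mulmxDl mulmx1 ST.
  by rewrite -!mulmxA RT !mulmx0 addr0.
have GB : (S' *m G *m T) *m (S *m F *m T') = 1%:M.
  rewrite -mulmxA (desc0 _ _ _ _ _ _ _ _ ST' RT' hF) mulmxA -(mulmxA S') GF mulmxDr mulmxDl
    mulmx1 ST'.
  by rewrite -!mulmxA RT' !mulmx0 addr0.
have dd : d = d' by apply/eqP; rewrite eqn_leq (mulmx1_min FB) (mulmx1_min GB).
subst d'.
pose gab i := S *m ga i *m T; pose fb i := S *m f i *m T'; pose gb i := S' *m g i *m T.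
have evfb u : ev fb u = S *m ev f u *m T' by rewrite ev_mull ev_mulr.
have evgb u : ev gb u = S' *m ev g u *m T by rewrite ev_mull ev_mulr.
have evgab u : ev gab u = S *m ev ga u *m T by rewrite ev_mull ev_mulr.
have [a Fa] := gf F hF; have [b Gb] := gg G hG.
have sandwich p q (S0 : 'M[int]_(p, q)) q1 (A : 'M_(q, q1)) d1 (T1 : 'M_(q1, d1)) (S1 : 'M_(d1,
  q1)) r (B : 'M_(q1, r)) r1 (T2 : 'M_(r, r1)) :
    T1 *m (S1 *m B *m T2) = B *m T2 -> S0 *m A *m T1 *m (S1 *m B *m T2) = S0 *m (A *m B) *m T2.
  by move=> h; rewrite -(mulmxA (S0 *m A)) h !mulmxA.
have bar_le p q p' q' (SS : 'M[int]_(p, q)) (M : 'M[int]_(q, q')) (TT : 'M[int]_(q', p')) :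
    (q <= s)%N -> (q' <= s)%N -> mxle (ft s) SS -> mxle (fg s) M -> mxle (ft s) TT ->
      mxle (s2 s) (SS *m M *m TT).
  move=> qs q's b1 b2 b3.
  apply: (mxleW (mxle_mul (mxle_mul b1 b2) b3)); apply: leq_trans (leq_addl _ _).
  apply: leq_mul; first exact: leq_trans q's e01.
  apply: leq_mul => //; apply: leq_mul; first exact: leq_trans qs e01.
  exact: leq_mul.
have [||||| a' [ba' [z az] ua']] := hfl (s2 s) d lc lf lg gab fb gb k a b.
- split; [exact: leq_trans ds (leq_trans e01 e12) | | | |].
  + exact: leq_trans blc (leq_trans e01g e12).
  + exact: leq_trans blf (leq_trans e01g e12).
  + exact: leq_trans blg (leq_trans e01g e12).
  + by rewrite k0 (leq_trans kb) // (leq_trans e01t).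
- by split=> i; apply: bar_le.
- by have [u hu] := gga _ (hom_mx1 R X); exists u; rewrite evgab -hu mulmx1 ST.
- split=> i j.
  + have [u hu] := gga _ (hom_mx_mul (hga i) (hga j)); exists u.
    by rewrite evgab -hu; apply: sandwich; exact: desc0 ST RT (hga j).
  + have [u hu] := gf _ (hom_mx_mul (hga i) (hf j)); exists u.
    by rewrite evfb -hu; apply: sandwich; exact: desc0 ST' RT' (hf j).
  + have [u hu] := gg _ (hom_mx_mul (hg i) (hga j)); exists u.
    by rewrite evgb -hu; apply: sandwich; exact: desc0 ST RT (hga j).
  + have [u hu] := gga _ (hom_mx_mul (hf i) (hg j)); exists u.
    by rewrite evgab -hu; apply: sandwich; exact: desc1 ST RT (hg j).
- by rewrite evfb evgb -Fa -Gb.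
pose H := ev f a'; have hH : hom_mx R X R' X' H by exact: hom_mx_ev.
exists H; split=> //.
  move=> i j; rewrite summxE; apply: leq_trans (absz_sum _ _ _) _.
  apply: (@leq_trans (\sum_(t < lf) fl (s2 s) * s2 s)%N).
    apply: leq_sum => t _; rewrite mxE abszM; apply: leq_mul; first exact: ba'.
    by apply: leq_trans (bf _ _ _) (leq_trans e01g e12).
  rewrite sum_nat_const card_ord leq_mul2r; apply/orP; right.
  exact: leq_trans blf (leq_trans e01g e12).
pose Phi := ev f z; have hN : hom_mx R X R X (Phi *m G) by apply: hom_mx_mul hG; exact: hom_mx_ev.
have HE : H = F + k%:Z *: Phi by rewrite /H az evD evZ -Fa.
pose P := H *m G; have hP : hom_mx R X R X P by exact: hom_mx_mul hG.
have [C0 hC0] := proj1 hN; have [CG hCG] := proj1 hG; have [CF hCF] := proj1 hF; have [CH hCH] :=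
  proj1 hH.
pose Pb := S *m P *m T.
have dP : T *m Pb = P *m T by exact: desc0 ST RT hP.
have uPb : Pb \in unitmx.
  have -> : Pb = ev fb a' *m (S' *m G *m T).
    by rewrite evfb -mulmxA (desc1 _ _ _ _ _ _ _ _ ST RT hG) /Pb /P !mulmxA.
  by rewrite unitmx_mul ua'; have [] := mulmx1_unit FB.
(* On the torsion [k *: Phi] acts as zero, so [H *m G] acts there as [F *m G], the identity. *)
have torsP (v : 'rV[int]_n) : v *m T = 0 -> exists c, v *m P = v + c *m R.
  move=> vT; have [c hc] := kT v vT.
  exists (v *m E1 + c *m C0).
  have -> : P = 1%:M + E1 *m R + k%:Z *: (Phi *m G) by rewrite /P HE mulmxDl FG scalemxAl.
  rewrite !mulmxDr mulmx1 -scalemxAr scalemxAl hc -(mulmxA c) hC0 [in RHS]mulmxDl.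
  by rewrite !mulmxA addrA.
split.
  move=> v c vH; have vP : v *m P = c *m CG *m R.
    by rewrite /P mulmxA vH -mulmxA hCG mulmxA.
  have vT : v *m T = 0.
    have uPb' : v *m T *m Pb = 0 by rewrite -mulmxA dP mulmxA vP -mulmxA RT mulmx0.
    by rewrite -(mulmxK uPb (v *m T)) uPb' mul0mx.
  have [c' hc'] := torsP v vT; exists (c *m CG - c').
  by rewrite mulmxBl -vP hc' addrK.
(* A preimage of [w *m G] under [P]: [v0] is one on the torsion-free quotient, and the error [t] is
   torsion, where [P] is the identity. *)
move=> w; pose v0 := w *m G *m T *m invmx Pb *m S.
pose t := w *m G - v0 *m P.
have tT : t *m T = 0.
  rewrite mulmxBl -(mulmxA v0) -dP mulmxA -(mulmxA _ S T) ST mulmx1 mulmxKV //.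
  by rewrite subrr.
have [c hc] := torsP t tT.
have e1 : (v0 + t) *m P = w *m G + c *m R.
  by rewrite mulmxDl hc /t addrA [v0 *m P + _]addrC subrK.
have e2 : ((v0 + t) *m H - w) *m G = c *m R.
  by rewrite mulmxBl -mulmxA e1 addrAC subrr add0r.
have e3 : (v0 + t) *m H - w = (c *m CF - ((v0 + t) *m H - w) *m E2) *m R'.
  have := congr1 (mulmx^~ F) e2; rewrite -mulmxA GF mulmxDr mulmx1 -(mulmxA c) hCF => h.
  by rewrite mulmxBl -(mulmxA c) -h mulmxA addrK.
exists (v0 + t), (- (c *m CF - ((v0 + t) *m H - w) *m E2)).
by rewrite mulNmx -e3 opprB addrC subrK.
Qed.

Lemma lin_rsolve : exists f, mfun f /\ forall s m n p (B : 'M[int]_(n, p)) (C : 'M[int]_(m, p)),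
  [/\ (m <= s)%N, (n <= s)%N & (p <= s)%N] -> mxle s B -> mxle s C ->
  (exists W, W *m B = C) -> exists W, W *m B = C /\ mxle (f s) W.
Proof.
have [f [mf hf]] := lin_solve_mx; exists (fun s => f (s + s * s)%N); split; first by mf_tac.
move=> s m n p B C [ms ns ps] sB sC [W WB].
have ss : (s <= s + s * s)%N by exact: leq_addr.
pose phi (k : 'I_m * 'I_p) (A : 'M[int]_(m, n)) := (A *m B) k.1 k.2.
have [|||||||Y [hY bY]] := hf (s + s * s)%N m n _ phi (fun k => C k.1 k.2) W.
- exact: leq_trans ms ss.
- exact: leq_trans ns ss.
- by rewrite card_prod !card_ord; apply: leq_trans (leq_addl _ _); exact: leq_mul.
- by move=> k A A'; rewrite /phi mulmxDl mxE.
- move=> k A A1; apply: leq_trans (leq_addl _ _).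
  by apply: leq_trans (mxle_mul A1 sB _ _) _; rewrite mul1n leq_mul2r ns orbT.
- by move=> k; apply: leq_trans (sC _ _) ss.
- by move=> k; rewrite /phi WB.
by exists Y; split=> //; apply/matrixP => i j; exact: hY (i, j).
Qed.

(** * Quiver representations *)

Section Blocks.
Variable V : finType.
Implicit Types a b c : V -> nat.

Definition bdim a := #|{: {v : V & 'I_(a v)}}|.

(* The inclusion of the summand of index [v] in the direct sum. *)
Definition inc a v : 'M[int]_(a v, bdim a) :=
  \matrix_(i, t) (enum_val t == Tagged (fun u => 'I_(a u)) i)%:R.

Lemma inc_tr a v : inc a v *m (inc a v)^T = 1%:M.
Proof.
apply/matrixP => i j; rewrite !mxE (bigD1 (enum_rank (Tagged (fun u => 'I_(a u)) i))) //=.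
rewrite !mxE enum_rankK eqxx mul1r eq_Tagged /= big1 ?addr0 // => t nt; rewrite !mxE.
have -> : (enum_val t == Tagged (fun u => 'I_(a u)) i) = false; last by rewrite mul0r.
by apply/negbTE; apply: contra nt => /eqP <-; rewrite enum_valK.
Qed.

Lemma inc_tr0 a v w : v != w -> inc a v *m (inc a w)^T = 0.
Proof.
move=> vw; apply/matrixP => i j; rewrite !mxE big1 // => t _; rewrite !mxE.
have [->|_] := eqVneq (enum_val t) _; last by rewrite mul0r.
rewrite mul1r; have -> // : (Tagged (fun u => 'I_(a u)) i == Tagged (fun u => 'I_(a u)) j) = false.
by apply/negbTE; apply: contra vw => /eqP/(congr1 tag) /= ->.
Qed.

Lemma inc_sum a : \sum_v (inc a v)^T *m inc a v = 1%:M.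
Proof.
apply/matrixP => s t; rewrite summxE !mxE.
under eq_bigr do rewrite mxE.
rewrite (sig_big_dep xpredT (fun _ _ => true) (fun v i => (inc a v)^T s i * inc a v i t)) /=.
have TK (u : {v : V & 'I_(a v)}) : Tagged (fun v => 'I_(a v)) (tagged u) = u by case: u.
rewrite (bigD1 (enum_val s)) //= !mxE TK eqxx mul1r (inj_eq enum_val_inj) eq_sym.
rewrite big1 ?addr0 // => u ns.
by rewrite !mxE TK eq_sym (negPf ns) mul0r.
Qed.

Definition blk a b (A : forall v, 'M[int]_(a v, b v)) := \sum_v (inc a v)^T *m A v *m inc b v.

Lemma inc_blk a b (A : forall v, 'M[int]_(a v, b v)) v : inc a v *m blk A = A v *m inc b v.
Proof.
rewrite mulmx_sumr (bigD1 v) //= !mulmxA inc_tr mul1mx big1 ?addr0 // => w wv.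
by rewrite !mulmxA inc_tr0 1?eq_sym // !mul0mx.
Qed.

Lemma blk_inc a b (A : forall v, 'M[int]_(a v, b v)) v : blk A *m (inc b v)^T = (inc a v)^T *m A v.
Proof.
rewrite mulmx_suml (bigD1 v) //= -!mulmxA inc_tr mulmx1 big1 ?addr0 // => w wv.
by rewrite -!mulmxA inc_tr0 // !mulmx0.
Qed.

Lemma blk_mul a b c (A : forall v, 'M[int]_(a v, b v)) (B : forall v, 'M[int]_(b v, c v)) :
  blk A *m blk B = blk (fun v => A v *m B v).
Proof.
by rewrite {1}/blk mulmx_suml; apply: eq_bigr => v _; rewrite -!mulmxA inc_blk.
Qed.

Lemma blk1 a : blk (fun v => 1%:M : 'M_(a v)) = 1%:M.
Proof. by rewrite -[RHS]inc_sum; apply: eq_bigr => v _; rewrite mulmx1. Qed.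

Lemma blkD a b (A B : forall v, 'M[int]_(a v, b v)) : blk A + blk B = blk (fun v => A v + B v).
Proof. by rewrite -big_split; apply: eq_bigr => v _; rewrite mulmxDr mulmxDl. Qed.

Lemma eq_blk a b (A B : forall v, 'M[int]_(a v, b v)) : (forall v, A v = B v) -> blk A = blk B.
Proof. by move=> E; apply: eq_bigr => v _; rewrite E. Qed.

Lemma mxle_inc a v : mxle 1 (inc a v).
Proof. by move=> i j; rewrite mxE; case: eqP. Qed.

Lemma mxle_tr s m n (A : 'M[int]_(m, n)) : mxle s A -> mxle s A^T.
Proof. by move=> h i j; rewrite mxE. Qed.

Lemma mxle_sblk s a b v w (A : 'M[int]_(a v, b w)) :
  (a v <= s)%N -> (b w <= s)%N -> mxle s A -> mxle (s * (s * s)) ((inc a v)^T *m A *m inc b w).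
Proof.
move=> avs bws sA; apply: (mxleW (mxle_mul (mxle_mul (mxle_tr (@mxle_inc a v)) sA) (@mxle_inc b
  w))).
by rewrite mul1n muln1; apply: leq_mul => //; apply: leq_mul.
Qed.

Lemma mxle_blk s a b (A : forall v, 'M[int]_(a v, b v)) :
  (#|V| <= s)%N -> (forall v, (a v <= s)%N) -> (forall v, (b v <= s)%N) ->
  (forall v, mxle s (A v)) -> mxle (s * (s * (s * s))) (blk A).
Proof.
move=> Vs as_ bs sA i j; rewrite summxE; apply: leq_trans (absz_sum _ _ _) _.
apply: (@leq_trans (\sum_(v : V) s * (s * s))%N).
  by apply: leq_sum => v _; exact: mxle_sblk.
by rewrite sum_nat_const leq_mul2r Vs orbT.
Qed.

Lemma bdim_le s a : (#|V| <= s)%N -> (forall v, (a v <= s)%N) -> (bdim a <= s * s)%N.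
Proof.
move=> Vs as_; rewrite /bdim card_tagged sumnE big_map big_enum /=.
apply: (@leq_trans (\sum_(v : V) s)%N); last by rewrite sum_nat_const leq_mul2r Vs orbT.
by apply: leq_sum => v _; rewrite card_ord.
Qed.
End Blocks.

Section QuiverData.
Variable Q : quiver.
Implicit Types p q : zdata Q.

Definition qhom p q (F : forall v, 'M[int]_(ngen p v, ngen q v)) :=
  (forall v, exists C, rels p v *m F v = C *m rels q v) /\
  (forall e, exists D, img p e *m F (tgt e) - F (src e) *m img q e = D *m rels q (tgt e)).

Arguments qhom p q F : clear implicits.

Definition qinv p q (F : forall v, 'M[int]_(ngen p v, ngen q v)) (G : forall v,
    'M[int]_(ngen q v, ngen p v)) :=
  forall v, exists E, F v *m G v = 1%:M + E *m rels p v.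

Definition qop p (k : arrow Q + vertex Q) : 'M[int]_(bdim (ngen p)) :=
  match k with
  | inl e => (inc (ngen p) (src e))^T *m img p e *m inc (ngen p) (tgt e)
  | inr v => (inc (ngen p) v)^T *m 1%:M *m inc (ngen p) v end.

Lemma qhom_blk p q F : qhom p q F -> hom_mx (blk (rels p)) (qop p) (blk (rels q)) (qop q) (blk F).
Proof.
case=> [hC hD]; split.
  have [C hC'] := @fin_all_exists _ _ _ hC.
  by exists (blk C); rewrite !blk_mul; exact: eq_blk.
case=> [e|v] /=.
  have [D hD'] := hD e; exists ((inc (ngen p) (src e))^T *m D *m inc (nrel q) (tgt e)).
  rewrite -(mulmxA _ _ (blk F)) inc_blk -(mulmxA _ _ (blk (rels q))) inc_blk.
  rewrite !mulmxA blk_inc -mulmxBl -!(mulmxA (inc (ngen p) (src e))^T) -mulmxBr hD'.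
  by rewrite !mulmxA.
exists 0; rewrite mul0mx -(mulmxA _ _ (blk F)) inc_blk !mulmxA blk_inc mulmx1.
by rewrite mulmx1 subrr.
Qed.

Lemma qinv_blk p q F G : @qinv p q F G -> exists E, blk F *m blk G = 1%:M + E *m blk (rels p).
Proof.
move=> h; have [E hE] := @fin_all_exists _ _ _ h.
by exists (blk E); rewrite !blk_mul -blk1 blkD; exact: eq_blk.
Qed.

(** Because [H] commutes with the projections on the vertices modulo the relations, it is block
    diagonal modulo the relations, and its diagonal blocks inherit bijectivity. *)
Lemma hom_mx_qhom p q H : hom_mx (blk (rels p)) (qop p) (blk (rels q)) (qop q) H ->
  iso_mx (blk (rels p)) (blk (rels q)) H ->
  let F v := inc (ngen p) v *m H *m (inc (ngen q) v)^T in
  qhom p q F /\ forall v, iso_mx (rels p v) (rels q v) (F v).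
Proof.
move=> [[C hC] hD] [injH surH] F; split; first split.
- move=> v; exists (inc (nrel p) v *m C *m (inc (nrel q) v)^T).
  by rewrite /F !mulmxA -(inc_blk (rels p)) -(mulmxA _ _ H) hC !mulmxA -!(mulmxA _ _ (inc (ngen
    q) v)^T) blk_inc !mulmxA.
- move=> e; have [D /= eD] := hD (inl e).
  exists (inc (ngen p) (src e) *m D *m (inc (nrel q) (tgt e))^T).
  rewrite -mulmxA -(blk_inc (rels q)) mulmxA -(mulmxA _ D) -eD mulmxBr mulmxBl.
  rewrite !mulmxA inc_tr mul1mx -!mulmxA inc_tr mulmx1 /F.
  by [].
move=> v; have [D /= eD] := hD (inr v); rewrite !mulmx1 in eD.
have h1 : inc (ngen p) v *m H = F v *m inc (ngen q) v + inc (ngen p) v *m D *m blk (rels q).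
  by rewrite -mulmxA -eD mulmxBr !mulmxA inc_tr mul1mx addrC subrK.
have h2 : H *m (inc (ngen q) v)^T = (inc (ngen p) v)^T *m F v - D *m (inc (nrel q) v)^T *m rels q v.
  rewrite -mulmxA -(blk_inc (rels q)) mulmxA -eD mulmxBl opprB -!mulmxA inc_tr mulmx1.
  by rewrite /F !mulmxA addrC subrK.
split=> [x c xF|w].
  have [|c' hc'] := injH (x *m inc (ngen p) v) (c *m inc (nrel q) v + x *m inc (ngen p) v *m D).
    by rewrite -mulmxA h1 mulmxDr (mulmxA x (F v)) xF mulmxDl -!mulmxA inc_blk.
  exists (c' *m (inc (nrel p) v)^T).
  by rewrite -mulmxA -(blk_inc (rels p)) mulmxA -hc' -mulmxA inc_tr mulmx1.
have [x [c hw]] := surH (w *m inc (ngen q) v).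
have := congr1 (mulmx^~ (inc (ngen q) v)^T) hw.
rewrite -mulmxA inc_tr mulmx1 mulmxDl -!mulmxA h2 blk_inc => ->.
exists (x *m (inc (ngen p) v)^T), (c *m (inc (nrel q) v)^T - x *m (D *m (inc (nrel q) v)^T)).
by rewrite mulmxBr mulmxBl !mulmxA addrA addrAC.
Qed.

Definition dsize s p := [/\ forall v, (ngen p v <= s)%N, forall v, (nrel p v <= s)%N,
  forall v, mxle s (rels p v) & forall e, mxle s (img p e)].
End QuiverData.
Arguments qhom {Q} p q F.

Lemma rows_span k m n (M : 'M[int]_(k, n)) (R : 'M[int]_(m, n)) :
  (forall i, exists c, row i M = c *m R) -> exists C, M = C *m R.
Proof.
move=> /fin_all_exists[c hc]; exists (\matrix_i c i).
by apply/row_matrixP => i; rewrite row_mul rowK.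
Qed.

Lemma iso_mx_inv m n m' n' (R : 'M[int]_(m, n)) (R' : 'M[int]_(m', n')) F :
  iso_mx R R' F -> exists G E, G *m F + E *m R' = 1%:M.
Proof.
move=> [_ sur].
have /fin_all_exists[v] (i : 'I_n') := sur (row i 1%:M).
move=> /fin_all_exists[c h]; exists (\matrix_i v i), (\matrix_i c i).
by apply/row_matrixP => i; rewrite linearD /= !row_mul !rowK.
Qed.

Lemma iso_mx_invK m n m' n' (R : 'M[int]_(m, n)) (R' : 'M[int]_(m', n')) F G E :
  iso_mx R R' F -> G *m F + E *m R' = 1%:M ->
  (exists C, R' *m G = C *m R) /\ exists E', F *m G = 1%:M + E' *m R.
Proof.
move=> [inj _] GF; have GF' : G *m F = 1%:M - E *m R' by rewrite -GF addrK.
have inj' k (v : 'M_(k, n)) c : v *m F = c *m R' -> exists c', v = c' *m R.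
  move=> h; apply: rows_span => i.
  by apply: (inj _ (row i c)); rewrite -!row_mul h.
split.
  by apply: (inj' _ _ (1%:M - R' *m E)); rewrite -mulmxA GF' mulmxBr mulmxBl mul1mx mulmx1 mulmxA.
have [|E' hE'] := inj' _ (F *m G - 1%:M) (- (F *m E)).
  by rewrite mulmxBl -mulmxA GF' mul1mx mulmxBr mulmx1 addrAC subrr add0r mulNmx mulmxA.
by exists E'; rewrite -hE' addrC subrK.
Qed.

(** The matrices besides [F] and [G] witness membership in spans of relations, which turns all
    conditions into equations. Compatibility of [G] with the arrows is left out, as it follows from
    that of its inverse [F]. *)
Definition qcert (Q : quiver) (p q : zdata Q) F G C C' D E E' :=
  [/\ forall v, rels p v *m F v = C v *m rels q v,
      forall v, rels q v *m G v = C' v *m rels p v,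
      forall v, F v *m G v = 1%:M + E v *m rels p v,
      forall v, G v *m F v = 1%:M + E' v *m rels q v &
      forall e, img p e *m F (tgt e) = F (src e) *m img q e + D e *m rels q (tgt e)].

(** Only [F] is taken from the bounded isomorphism of the direct sums. Once it is fixed, the other
    matrices solve linear systems one after the other, and each can be chosen bounded. *)
Lemma qcert_bounded : exists f, mfun f /\ forall s (Q : quiver) (p q : zdata Q) F G,
  (#|vertex Q| <= s)%N -> (#|arrow Q| <= s)%N -> dsize s p -> dsize s q ->
  qhom p q F -> qhom q p G -> qinv F G -> qinv G F ->
  exists F G C C' D E E', @qcert Q p q F G C C' D E E' /\
   [/\ [/\ forall v, mxle (f s) (F v), forall v, mxle (f s) (G v), forall v,
     mxle (f s) (C v) & forall v, mxle (f s) (C' v)],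
       forall v, mxle (f s) (E v), forall v, mxle (f s) (E' v) & forall e, mxle (f s) (D e)].
Proof.
have [fm [mfm hfm]] := module_iso_bounded.
have [fr [mfr hfr]] := lin_rsolve.
pose s1 s := (s + s + s * s + s * (s * (s * s)))%N.
pose s2 s := (s1 s * (s1 s * fm (s1 s)))%N.
pose s3 s := (s + s + 1 + s * (s * s2 s) + (s2 s + s))%N.
pose s4 s := (fr (s3 s) + s3 s)%N.
pose s5 s := (s4 s + s4 s * (s4 s * s4 s) + s4 s * (s4 s * s4 s))%N.
exists (fun s => fr (s5 s) + s5 s)%N.
have ms1 : mfun s1 by rewrite /s1; mf_tac.
have ms2 : mfun s2 by rewrite /s2; mf_tac.
have ms3 : mfun s3 by rewrite /s3; mf_tac.
have ms4 : mfun s4 by rewrite /s4; mf_tac.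
have ms5 : mfun s5 by rewrite /s5; mf_tac.
split; first by mf_tac.
move=> s Q p q F0 G0 Vs As [pn pm pr pi] [qn qm qr qi] hF hG FG GF.
have e01 : (s <= s1 s)%N by rewrite /s1 -!addnA leq_addr.
have e02 : (s * s <= s1 s)%N by rewrite /s1; lia.
have e03 : (s * (s * (s * s)) <= s1 s)%N by rewrite /s1; lia.
have e04 : (s * (s * s) <= s1 s)%N.
  apply: leq_trans e03; case: (posnP s) => [->//|s0].
  by rewrite -{1}[(s * (s * s))%N]mul1n leq_mul2r s0 orbT.
have ops r : (forall v, (ngen r v <= s)%N) -> (forall e, mxle s (img r e)) -> forall k,
  mxle (s1 s) (@qop Q r k).
  move=> rn ri [e|v] /=; refine (mxleW (mxle_sblk _ _ _) e04) => //.
  case: (posnP s) => [s0|s0]; last exact: mxleW (@mxle1 _) s0.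
  by move=> i; have := leq_trans (ltn_ord i) (rn v); rewrite s0.
have [||H [bH hH iH]] := hfm (s1 s) (arrow Q + vertex Q)%type _ _ _ _ _ (qop p) _ (qop q) _ _ _ _
  (qhom_blk hF) (qhom_blk hG) (qinv_blk FG) (qinv_blk GF).
- split; try by apply: leq_trans (bdim_le _ _) e02.
  by rewrite card_sum; apply: leq_trans (leq_add As Vs) _; rewrite /s1 -!addnA leq_add2l leq_addr.
- by split; [exact: (mxleW (mxle_blk _ _ _ _) e03) | exact: (mxleW (mxle_blk _ _ _ _) e03) |
  exact: ops | exact: ops].
have [] := hom_mx_qhom hH iH; set F := fun v => _ => qF iF.
have bF v : mxle (s2 s) (F v).
  refine (mxleW (mxle_mul (mxle_mul (@mxle_inc _ _ v) bH) (mxle_tr (@mxle_inc _ _ v))) _).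
  rewrite mul1n muln1 /s2; apply: leq_mul; first exact: leq_trans (bdim_le _ _) e02.
  by apply: leq_mul => //; exact: leq_trans (bdim_le _ _) e02.
have s23 : (s2 s <= s3 s)%N by rewrite /s3 addnA; lia.
have l3 : (s <= s3 s)%N by rewrite /s3; lia.
have s34 : (s3 s <= s4 s)%N by exact: leq_addl.
have s45 : (s4 s <= s5 s)%N by rewrite /s5 -addnA leq_addr.
have s56 : (s5 s <= fr (s5 s) + s5 s)%N by exact: leq_addl.
have r56 : (fr (s5 s) <= fr (s5 s) + s5 s)%N by exact: leq_addr.
have /fin_all_exists[G hGE] v : exists G, mxle (s4 s) G /\ exists E,
  G *m F v + E *m rels q v = 1%:M.
  have [G [E GE]] := iso_mx_inv (iF v).
  have [||||W [hW bW]] := hfr (s3 s) _ _ _ (col_mx (F v) (rels q v)) (1%:M).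
  - split; try exact: leq_trans (qn v) l3.
    by apply: leq_trans (leq_add (pn v) (qm v)) _; rewrite /s3 -!addnA leq_add2l leq_addr.
  - by move=> i j; rewrite mxE; case: split => k; [exact: leq_trans (bF _ _ _) s23 |
    exact: leq_trans (qr _ _ _) l3].
  - by refine (mxleW (@mxle1 _) _); rewrite /s3; lia.
  - by exists (row_mx G E); rewrite mul_row_col.
  exists (lsubmx W); split; last by exists (rsubmx W); rewrite -mul_row_col hsubmxK.
  by move=> i j; rewrite mxE; apply: leq_trans (bW _ _) _; exact: leq_addr.
have bF4 v : mxle (s4 s) (F v) := mxleW (bF v) (leq_trans s23 s34).
have n4 v : (ngen p v <= s4 s)%N := leq_trans (pn v) (leq_trans l3 s34).
have n4' v : (ngen q v <= s4 s)%N := leq_trans (qn v) (leq_trans l3 s34).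
have m4 v : (nrel p v <= s4 s)%N := leq_trans (pm v) (leq_trans l3 s34).
have m4' v : (nrel q v <= s4 s)%N := leq_trans (qm v) (leq_trans l3 s34).
have bR4 v : mxle (s4 s) (rels p v) := mxleW (pr v) (leq_trans l3 s34).
have bR4' v : mxle (s4 s) (rels q v) := mxleW (qr v) (leq_trans l3 s34).
have bX4 e : mxle (s4 s) (img p e) := mxleW (pi e) (leq_trans l3 s34).
have bX4' e : mxle (s4 s) (img q e) := mxleW (qi e) (leq_trans l3 s34).
have b1 k : mxle (s4 s) (1%:M : 'M[int]_k).
  by refine (mxleW (@mxle1 _) _); apply: leq_trans s34; rewrite /s3; lia.
have mul5 a b c (A : 'M_(a, b)) (B : 'M_(b, c)) : (b <= s4 s)%N -> mxle (s4 s) A ->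
  mxle (s4 s) B -> mxle (s4 s * (s4 s * s4 s)) (A *m B).
  by move=> bs hA hB; refine (mxleW (mxle_mul hA hB) _); apply: leq_mul.
have two5 : (s4 s * (s4 s * s4 s) + s4 s * (s4 s * s4 s) <= s5 s)%N by rewrite /s5 -addnA leq_addl.
have one5 : (s4 s * (s4 s * s4 s) <= s5 s)%N by apply: leq_trans (leq_addr _ _) two5.
have oned5 : (s4 s * (s4 s * s4 s) + s4 s <= s5 s)%N by rewrite /s5 addnC leq_addr.
have solve a b c (B : 'M[int]_(b, c)) (C : 'M_(a, c)) : (a <= s4 s)%N -> (b <= s4 s)%N ->
  (c <= s4 s)%N ->
    mxle (s4 s) B -> mxle (s5 s) C -> (exists W, C = W *m B) -> exists W,
      C = W *m B /\ mxle (fr (s5 s) + s5 s) W.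
  move=> as_ bs cs hB hC [W WB].
  have [||||W' [hW' bW']] := hfr (s5 s) _ _ _ B C.
  - by split; apply: leq_trans s45.
  - exact: mxleW hB s45.
  - by [].
  - by exists W.
  by exists W'; split=> //; exact: mxleW bW' r56.
have /fin_all_exists[E' hE'] v : exists E', G v *m F v = 1%:M + E' *m rels q v /\ mxle (fr (s5 s)
  + s5 s) E'.
  have [_ [E GE]] := hGE v.
  have [||W [hW bW]] := solve _ _ _ (rels q v) (G v *m F v - 1%:M) (n4' v) (m4' v) (n4' v) (bR4' v).
  - by refine (mxleW (mxle_add (mul5 _ _ _ _ _ (n4 v) (proj1 (hGE v)) (bF4 v)) (mxle_opp (b1 _)))
    oned5).
  - by exists (- E); rewrite -GE mulNmx opprD addrA subrr add0r.
  by exists W; rewrite -hW addrC subrK.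
have iG v : (exists C, rels q v *m G v = C *m rels p v) /\ exists E,
  F v *m G v = 1%:M + E *m rels p v.
  by have [_ [E GE]] := hGE v; exact: iso_mx_invK (iF v) GE.
have /fin_all_exists[E hE] v : exists E, F v *m G v = 1%:M + E *m rels p v /\ mxle (fr (s5 s) +
  s5 s) E.
  have [_ [E hE]] := iG v.
  have [||W [hW bW]] := solve _ _ _ (rels p v) (F v *m G v - 1%:M) (n4 v) (m4 v) (n4 v) (bR4 v).
  - by refine (mxleW (mxle_add (mul5 _ _ _ _ _ (n4' v) (bF4 v) (proj1 (hGE v))) (mxle_opp (b1
    _))) oned5).
  - by exists E; rewrite hE addrC addKr.
  by exists W; rewrite -hW addrC subrK.
have /fin_all_exists[C hC] v : exists C, rels p v *m F v = C *m rels q v /\ mxle (fr (s5 s) + s5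
  s) C.
  apply: solve (m4 v) (m4' v) (n4' v) (bR4' v) _ (proj1 qF v).
  exact: mxleW (mul5 _ _ _ _ _ (n4 v) (bR4 v) (bF4 v)) one5.
have /fin_all_exists[C' hC'] v : exists C, rels q v *m G v = C *m rels p v /\ mxle (fr (s5 s) +
  s5 s) C.
  apply: solve (m4' v) (m4 v) (n4 v) (bR4 v) _ (proj1 (iG v)).
  exact: mxleW (mul5 _ _ _ _ _ (n4' v) (bR4' v) (proj1 (hGE v))) one5.
have /fin_all_exists[D hD] e : exists D,
    img p e *m F (tgt e) - F (src e) *m img q e = D *m rels q (tgt e) /\ mxle (fr (s5 s) + s5 s) D.
  apply: solve (n4 (src e)) (m4' (tgt e)) (n4' (tgt e)) (bR4' _) _ (proj2 qF e).
  apply: (mxleW _ two5); refine (mxle_add _ (mxle_opp _)).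
    exact: mul5 (n4 _) (bX4 e) (bF4 _).
  exact: mul5 (n4' _) (bF4 _) (bX4' e).
have s46 : (s4 s <= fr (s5 s) + s5 s)%N := leq_trans s45 s56.
exists F, G, C, C', D, E, E'; split; first split.
- by move=> v; have [] := hC v.
- by move=> v; have [] := hC' v.
- by move=> v; have [] := hE v.
- by move=> v; have [] := hE' v.
- by move=> e; have [<- _] := hD e; rewrite addrC subrK.
split; first split.
- by move=> v; exact: mxleW (bF4 v) s46.
- by move=> v; exact: mxleW (proj1 (hGE v)) s46.
- by move=> v; have [] := hC v.
- by move=> v; have [] := hC' v.
- by move=> v; have [] := hE v.
- by move=> v; have [] := hE' v.
- by move=> e; have [] := hD e.
Qed.

(** * Homomorphisms of presented groups as matrices *)

Section Lincomb.
Variable A : zmodType.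

Lemma lincombB n (x : 'I_n -> A) c d : lincomb x (c - d) = lincomb x c - lincomb x d.
Proof. by rewrite /lincomb -sumrB; apply: eq_bigr => i _; rewrite !mxE mulrzBr. Qed.

Lemma lincombD n (x : 'I_n -> A) c d : lincomb x (c + d) = lincomb x c + lincomb x d.
Proof. by rewrite /lincomb -big_split; apply: eq_bigr => i _; rewrite !mxE mulrzDr. Qed.

Lemma lincomb1 n (x : 'I_n -> A) i : lincomb x (row i 1%:M) = x i.
Proof.
rewrite /lincomb (bigD1 i) //= big1 ?addr0 => [|j ji]; rewrite !mxE ?eqxx ?mulr1z //.
by rewrite eq_sym (negPf ji) mulr0z.
Qed.

Lemma lincomb_mul m n (x : 'I_n -> A) (y : 'I_m -> A) (F : 'M[int]_(m, n)) c :
  (forall i, y i = lincomb x (row i F)) -> lincomb y c = lincomb x (c *m F).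
Proof.
move=> h; rewrite /lincomb; under eq_bigr => i _ do rewrite h /lincomb mulrz_suml.
rewrite exchange_big; apply: eq_bigr => j _; rewrite !mxE mulrz_sumr.
by apply: eq_bigr => i _; rewrite mxE -mulrzA mulrC.
Qed.

Lemma raddf_lincomb (B : zmodType) (f : {additive A -> B}) n (x : 'I_n -> A) c :
  f (lincomb x c) = lincomb (fun i => f (x i)) c.
Proof. by rewrite raddf_sum; apply: eq_bigr => i _; rewrite raddfMz. Qed.
End Lincomb.

Lemma represents_lincomb (A B : zmodType) m n (f : {additive A -> B}) (x : 'I_m ->
    A) (y : 'I_n -> B) F :
  (forall i, f (x i) = lincomb y (row i F)) -> forall c, f (lincomb x c) = lincomb y (c *m F).
Proof. by move=> h c; rewrite raddf_lincomb; exact: lincomb_mul. Qed.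

Section Presented.
Variables (A B : zmodType) (m n m' n' : nat) (R : 'M[int]_(m, n)) (R' : 'M[int]_(m', n')).
Variables (x : 'I_n -> A) (y : 'I_n' -> B).
Hypotheses (px : presents_group R x) (py : presents_group R' y).

Lemma lincomb_rel d : lincomb x (d *m R) = 0.
Proof. by apply/(proj2 px); exists d. Qed.

Lemma additive_mx (f : {additive A -> B}) : exists F, forall i, f (x i) = lincomb y (row i F).
Proof.
have /fin_all_exists[c hc] i := proj1 py (f (x i)).
by exists (\matrix_i c i) => i; rewrite rowK.
Qed.

Lemma additive_mx_rel (f : {additive A -> B}) F :
  (forall i, f (x i) = lincomb y (row i F)) -> exists C, R *m F = C *m R'.
Proof.
move=> fF; apply: rows_span => i; apply/(proj2 py).
by rewrite row_mul -(represents_lincomb fF) rowE lincomb_rel raddf0.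
Qed.

Lemma mx_additive (F : 'M[int]_(n, n')) : (exists C, R *m F = C *m R') ->
  exists f : {additive A -> B}, forall i, f (x i) = lincomb y (row i F).
Proof.
move=> [C RF].
(* A coordinate vector of each [a] is picked by the choice operator of integer row vectors; the
   relations make the image independent of the pick. *)
have ex a : exists c, a == lincomb x c by have [c ->] := proj1 px a; exists c.
pose f a := lincomb y (xchoose (ex a) *m F).
have fE c : f (lincomb x c) = lincomb y (c *m F).
  have /eqP := xchooseP (ex (lincomb x c)); rewrite /f; set d := xchoose _ => cd.
  have /(proj2 px)[u hu] : lincomb x (c - d) = 0 by rewrite lincombB -cd subrr.
  apply/eqP; rewrite eq_sym -subr_eq0 -lincombB -mulmxBl hu; apply/eqP/(proj2 py).
  by exists (u *m C); rewrite -!mulmxA RF.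
have fB : zmod_morphism f.
  move=> a b; have [c ->] := proj1 px a; have [d ->] := proj1 px b.
  by rewrite -lincombB !fE mulmxBl lincombB.
pose g : {additive A -> B} := HB.pack f (GRing.isZmodMorphism.Build _ _ f fB).
by exists g => i; rewrite /= -(lincomb1 x i) fE rowE mulmx1 -rowE.
Qed.
End Presented.

Lemma zrep_hom_qhom (Q : quiver) (A B : zrep Q) (p q : zdata Q) (x : forall v, 'I_(ngen p v) ->
    zgrp A v) (y : forall v, 'I_(ngen q v) -> zgrp B v)
    (f : zrep_hom A B) (F : forall v, 'M_(ngen p v, ngen q v)) :
  (forall v, presents_group (rels p v) (x v)) -> (forall v, presents_group (rels q v) (y v)) ->
  (forall e i, zmap A e (x (src e) i) = lincomb (x (tgt e)) (row i (img p e))) ->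
  (forall e i, zmap B e (y (src e) i) = lincomb (y (tgt e)) (row i (img q e))) ->
  (forall v i, hom_at f v (x v i) = lincomb (y v) (row i (F v))) -> qhom p q F.
Proof.
move=> px py xe ye fF; split=> [v|e]; first exact: (additive_mx_rel (px v) (py v) (fF v)).
apply: rows_span => i; apply/(proj2 (py (tgt e))).
rewrite linearB /= lincombB !row_mul -(represents_lincomb (fF _)) -xe.
by rewrite -(represents_lincomb (ye e)) -fF hom_comm subrr.
Qed.

Lemma zrep_iso_qhom (Q : quiver) (A B : zrep Q) (p q : zdata Q) : presents p A -> presents q B ->
    zrep_iso A B ->
  exists F G, [/\ qhom p q F, qhom q p G, qinv F G & qinv G F].
Proof.
move=> [x [px xe]] [y [py ye]] [f [g fg]].
have /fin_all_exists[F hF] v := additive_mx (x v) (py v) (hom_at f v).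
have /fin_all_exists[G hG] v := additive_mx (y v) (px v) (hom_at g v).
have inv m n m' n' (C D : zmodType) (R : 'M[int]_(m, n)) (R' : 'M[int]_(m', n')) (z : 'I_n ->
  C) (w : 'I_n' -> D)
    (h : {additive C -> D}) (k : {additive D -> C}) H K : presents_group R z ->
    (forall i, h (z i) = lincomb w (row i H)) -> (forall i, k (w i) = lincomb z (row i K)) ->
    cancel h k -> exists E, H *m K = 1%:M + E *m R.
  move=> pz hH kK hk; have [|E hE] := @rows_span _ _ _ (H *m K - 1%:M) R.
    move=> i; apply/(proj2 pz).
    by rewrite linearB /= lincombB row_mul lincomb1 -(represents_lincomb kK) -hH hk subrr.
  by exists E; rewrite -hE addrC subrK.
exists F, G; split.
- exact: (zrep_hom_qhom px py xe ye hF).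
- exact: (zrep_hom_qhom py px ye xe hG).
- by move=> v; apply: inv (px v) (hF v) (hG v) (proj1 (fg v)).
- by move=> v; apply: inv (py v) (hG v) (hF v) (proj2 (fg v)).
Qed.

Lemma qcert_zrep_iso (Q : quiver) (A B : zrep Q) (p q : zdata Q) F G C C' D E E' :
  presents p A -> presents q B -> @qcert Q p q F G C C' D E E' -> zrep_iso A B.
Proof.
move=> [x [px xe]] [y [py ye]] [hC hC' hE hE' hD].
have /fin_all_exists[f hf] v := mx_additive (px v) (py v) (ex_intro _ _ (hC v)).
have /fin_all_exists[g hg] v := mx_additive (py v) (px v) (ex_intro _ _ (hC' v)).
have fg v : cancel (f v) (g v).
  move=> a; have [c ->] := proj1 (px v) a.
  rewrite (represents_lincomb (hf v)) (represents_lincomb (hg v)) -mulmxA hE.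
  by rewrite mulmxDr mulmx1 mulmxA lincombD (lincomb_rel (px v)) addr0.
have gf v : cancel (g v) (f v).
  move=> a; have [c ->] := proj1 (py v) a.
  rewrite (represents_lincomb (hg v)) (represents_lincomb (hf v)) -mulmxA hE'.
  by rewrite mulmxDr mulmx1 mulmxA lincombD (lincomb_rel (py v)) addr0.
have fc e a : f (tgt e) (zmap A e a) = zmap B e (f (src e) a).
  have [c ->] := proj1 (px (src e)) a.
  rewrite (represents_lincomb (xe e)) !(represents_lincomb (hf _)) (represents_lincomb (ye e)).
  by rewrite -!mulmxA hD mulmxDr lincombD !mulmxA (lincomb_rel (py _)) addr0.
have gc e b : g (tgt e) (zmap B e b) = zmap A e (g (src e) b).
  by rewrite -{1}(gf (src e) b) -fc fg.
by exists (ZRepHom fc), (ZRepHom gc).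
Qed.

(** * The decision procedure *)

Definition zrec1 (f : nat -> int) := zrecf 1 (fun e => f (nth 0%N e 0)).

Lemma zrecf_app1 k f F : zrec1 f -> recf k F -> zrecf k (fun e => f (F e)).
Proof.
move=> [P [N [hP hN E]]] hF; exists (fun e => P [:: F e]), (fun e => N [:: F e]).
by split; [exact: recf_comp1 hP hF | exact: recf_comp1 hN hF | move=> e; rewrite -E].
Qed.

Definition decode_int (c : nat) : int := if odd c then Negz c./2 else Posz c./2.

Lemma code_intK : cancel code_int decode_int.
Proof. by case=> n; rewrite /decode_int /= odd_double ?doubleK //= uphalf_double. Qed.

Lemma zrec1_decode_int : zrec1 decode_int.
Proof.
have rhalf : rec1 half.
  apply: recf_ext (recf_iteri (N := fun e => nth 0%N e 0) (F := fun=> 0%N) (G :=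
    fun i z _ => i - z)%N _ _ _) _; try recf_tac.
  by move=> e _; elim: (nth 0%N e 0) => //= n ->; rewrite uphalfE; lia.
have rodd : rec1 (fun n => odd n : nat).
  apply: (@recf_ext 1 (fun e => nth 0 e 0 - 2 * (nth 0 e 0)./2)%N).
    by rewrite /rec1 in rhalf; recf_tac.
  by move=> e _; lia.
exists (fun e => (1 - odd (nth 0 e 0)) * (nth 0 e 0)./2)%N, (fun e => odd (nth 0 e 0) * (nth 0 e
  0)./2.+1)%N.
split; first by recf_tac.
  by recf_tac.
by move=> e; rewrite /decode_int; case: odd; rewrite ?NegzE; lia.
Qed.

(** [code_mx] lists the two dimensions before the entries in row-major order, hence the offset [.+2]
    and the row length [nthc M 1]. *)
Definition entry M i j := decode_int (nthc M (i * nthc M 1 + j).+2).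

Lemma zrecf_entry k M I J : recf k M -> recf k I -> recf k J ->
  zrecf k (fun e => entry (M e) (I e) (J e)).
Proof.
move=> hM hI hJ; have h := rec2_nthc.
apply: (@zrecf_app1 k decode_int); first exact: zrec1_decode_int.
apply: (@recf_app2 k nthc) => //; apply/recf_succ/recf_succ/recf_add => //; apply: recf_mul => //.
by apply: (@recf_app2 k nthc) => //; exact: recf_const.
Qed.

Lemma nth_allpairs (S T U : Type) (x0 : S) (y0 : T) (z0 : U) (f : S -> T -> U) s t i j :
  (i < size s)%N -> (j < size t)%N ->
  nth z0 [seq f x y | x <- s, y <- t] (i * size t + j) = f (nth x0 s i) (nth y0 t j).
Proof.
move=> + jt; elim: s i => [//|x s IH] [|i] /= hi; rewrite nth_cat size_map.
  by rewrite jt (nth_map y0).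
by rewrite mulSn -addnA ltnNge leq_addr /= addKn IH.
Qed.

Definition decodes c m n (M : 'M[int]_(m, n)) :=
  forall (i : 'I_m) (j : 'I_n), entry c i j = M i j.

Lemma decodes_code_mx m n (M : 'M[int]_(m, n)) : decodes (code_mx M) M.
Proof.
move=> i j; rewrite /entry /code_mx !nthc_code /= -[n in (i * n)%N]size_enum_ord.
by rewrite (nth_allpairs i j) ?size_enum_ord // !nth_ord_enum code_intK.
Qed.

Lemma nthc_map (T : finType) (f : T -> nat) x : nthc (CodeSeq.code [seq f y |
    y <- enum T]) (enum_rank x) = f x.
Proof. by rewrite nthc_code (nth_map x) ?nth_enum_rank // -cardE ltn_ord. Qed.

(** A single test that fits every equation of [qcert]: [z] is [0] or [1] according to whether the
    identity occurs, and a missing product is given inner dimension [0]. *)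
Definition eq_prod m n p q r z A B C D E F : bool :=
  all (fun i => all (fun j =>
    \sum_(0 <= k < p) entry A i k * entry B k j ==
    (z * (i == j))%N%:Z + \sum_(0 <= k < q) entry C i k * entry D k j + \sum_(0 <= k < r) entry E
      i k * entry F k j)
    (iota 0 n)) (iota 0 m).

Lemma recf_eq_prod : recf 12 (fun e => let x := nth 0%N e in
  eq_prod (x 0) (x 1) (x 2) (x 3) (x 4) (x 5) (x 6) (x 7) (x 8) (x 9) (x 10) (x 11) : nat).
Proof.
rewrite /eq_prod /=.
apply: recf_all; first by recf_var_tac.
apply: recf_all; first by recf_var_tac.
apply: recf_eqz; last (apply: zrecf_add; first apply: zrecf_add).
- by apply: zrecf_sum; [recf_var_tac | apply: zrecf_mul; apply: zrecf_entry; recf_var_tac].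
- by apply: zrecf_nat; apply: recf_mul; [recf_var_tac | apply: recf_eqn; recf_var_tac].
- by apply: zrecf_sum; [recf_var_tac | apply: zrecf_mul; apply: zrecf_entry; recf_var_tac].
by apply: zrecf_sum; [recf_var_tac | apply: zrecf_mul; apply: zrecf_entry; recf_var_tac].
Qed.

Lemma all_iotaP n (P : nat -> bool) : reflect (forall i : 'I_n, P i) (all P (iota 0 n)).
Proof.
apply: (iffP allP) => [h i|h i]; first by apply: h; rewrite mem_iota ltn_ord.
by rewrite mem_iota => /= hi; exact: (h (Ordinal hi)).
Qed.

Lemma eq_prodP m n p q r (z : bool) cA cB cC cD cE cF (A : 'M[int]_(m, p)) (B : 'M[int]_(p, n))
    (C : 'M[int]_(m, q)) (D : 'M[int]_(q, n)) (E : 'M[int]_(m, r)) (F : 'M[int]_(r,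
      n)) (Z : 'M[int]_(m, n)) :
  decodes cA A -> decodes cB B -> decodes cC C -> decodes cD D -> decodes cE E -> decodes cF F ->
  (forall (i : 'I_m) (j : 'I_n), (z * (i == j :> nat))%N%:Z = Z i j) ->
  reflect (A *m B = Z + C *m D + E *m F) (eq_prod m n p q r z cA cB cC cD cE cF).
Proof.
move=> hA hB hC hD hE hF hZ.
have sumE s cX cY (X : 'M_(m, s)) (Y : 'M_(s, n)) (i : 'I_m) (j : 'I_n) : decodes cX X ->
  decodes cY Y ->
    \sum_(0 <= k < s) entry cX i k * entry cY k j = (X *m Y) i j.
  by move=> hX hY; rewrite big_mkord mxE; apply: eq_bigr => k _; rewrite hX hY.
apply: (iffP (all_iotaP _ _)) => [h|h i].
  apply/matrixP => i j; have /all_iotaP/(_ j)/eqP := h i.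
  by rewrite hZ (sumE _ _ _ A B) // (sumE _ _ _ C D) // (sumE _ _ _ E F) // => ->; rewrite !mxE.
apply/all_iotaP => j; apply/eqP.
by rewrite hZ (sumE _ _ _ A B) // (sumE _ _ _ C D) // (sumE _ _ _ E F) // h !mxE.
Qed.

(* [w] codes the list of the seven families of matrices of a [qcert], in the
   order [F], [G], [C], [C'], [E], [E'], [D]. *)
Definition qcheck_vertex p q w v : bool :=
  let rel x := nthc (nthc x 0) v in let mat t := nthc (nthc w t) v in
  let m := nthc (rel p) 0 in let n := nthc (rel p) 1 in
  let m' := nthc (rel q) 0 in let n' := nthc (rel q) 1 in
  [&& eq_prod m n' n m' 0 0 (rel p) (mat 0) (mat 2) (rel q) 0 0,
      eq_prod m' n n' m 0 0 (rel q) (mat 1) (mat 3) (rel p) 0 0,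
      eq_prod n n n' m 0 1 (mat 0) (mat 1) (mat 4) (rel p) 0 0 &
      eq_prod n' n' n m' 0 1 (mat 1) (mat 0) (mat 5) (rel q) 0 0]%N.

(** Position [0] in the code of a quiver holds the number of vertices, so arrow [e] is found at
    [e.+1]. *)
Definition qcheck_arrow Q p q w e : bool :=
  let s := nthc (nthc Q e.+1) 0 in let t := nthc (nthc Q e.+1) 1 in
  let rel x v := nthc (nthc x 0) v in let mat t v := nthc (nthc w t) v in
  let dim x v := nthc (rel x v) 1 in
  eq_prod (dim p s) (dim q t) (dim p t) (dim q s) (nthc (rel q t) 0) 0
    (nthc (nthc p 1) e) (mat 0 t) (mat 0 s) (nthc (nthc q 1) e) (mat 6 e) (rel q t).

(* The number of arrows is not part of the code of a quiver; beyond it the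
   decoding yields [0], which is not the code of an arrow. *)
Definition qcheck Q p q w : bool :=
  all (qcheck_vertex p q w) (iota 0 (nthc Q 0)) &&
  all (fun e => (nthc Q e.+1 == 0) || qcheck_arrow Q p q w e)%N (iota 0 Q).

Lemma recf_eq_prod_comp k m n p q r z A B C D E F :
  recf k m -> recf k n -> recf k p -> recf k q -> recf k r -> recf k z ->
  recf k A -> recf k B -> recf k C -> recf k D -> recf k E -> recf k F ->
  recf k (fun e => eq_prod (m e) (n e) (p e) (q e) (r e) (z e) (A e) (B e) (C e) (D e) (E e) (F
    e) : nat).
Proof.
move=> *; pose l := [:: m; n; p; q; r; z; A; B; C; D; E; F].
apply: recf_ext (recf_comp (G := fun i : 'I_12 => nth m l i) recf_eq_prod _) _ => [i|e _].
  case: i => i hi /=; do 12! [case: i hi => [_|i hi] //=].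
by rewrite !enum_ordSl; case: (enum 'I_0) (size_enum_ord 0).
Qed.

Lemma recf_nthc k F G : recf k F -> recf k G -> recf k (fun e => nthc (F e) (G e)).
Proof. by apply: recf_app2; exact: rec2_nthc. Qed.

Ltac recf_nthc_tac :=
  lazymatch goal with
  | |- recf _ (fun e => nthc _ _) => apply: recf_nthc; recf_nthc_tac
  | |- recf _ (fun e => S _) => apply: recf_succ; recf_nthc_tac
  | |- recf _ (fun e => nth _ _ _) => recf_var_tac
  | |- _ => exact: recf_const
  end.

Lemma recf_qcheck : recf 4 (fun e => qcheck (nth 0 e 0) (nth 0 e 1) (nth 0 e 2) (nth 0 e 3) :
    nat)%N.
Proof.
apply: recf_andb.
  apply: recf_all; first recf_nthc_tac.
  by rewrite /qcheck_vertex /=; do 3! [apply: recf_andb; first by apply: recf_eq_prod_comp;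
    recf_nthc_tac];
    apply: recf_eq_prod_comp; recf_nthc_tac.
apply: recf_all; first recf_nthc_tac.
apply: (@recf_ext _ (fun e => ~~ (~~ (nthc (nth 0 (drop 1 e) 0) (nth 0 e 0).+1 == 0) &&
   ~~ qcheck_arrow (nth 0 (drop 1 e) 0) (nth 0 (drop 1 e) 1) (nth 0 (drop 1 e) 2) (nth 0 (drop 1
     e) 3) (nth 0 e 0)))%N); last first.
  by move=> e _; rewrite negb_and !negbK.
apply/recf_neg/recf_andb; first by apply/recf_neg/recf_eqn; recf_nthc_tac.
by apply: recf_neg; rewrite /qcheck_arrow /=; apply: recf_eq_prod_comp; recf_nthc_tac.
Qed.

Lemma nthc_code_quiver0 (Q : quiver) : nthc (code_quiver Q) 0 = #|vertex Q|.
Proof. by rewrite nthc_code. Qed.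

Lemma nthc_code_quiver (Q : quiver) (e : arrow Q) :
  nthc (code_quiver Q) (enum_rank e).+1 = CodeSeq.code [:: nat_of_ord (enum_rank (src e));
    nat_of_ord (enum_rank (tgt e))].
Proof. by rewrite nthc_code /= (nth_map e) ?nth_enum_rank // -cardE ltn_ord. Qed.

Lemma nthc_code_mx m n (M : 'M[int]_(m, n)) : nthc (code_mx M) 0 = m /\ nthc (code_mx M) 1 = n.
Proof. by rewrite /code_mx !nthc_code. Qed.

Lemma mem_code x s : x \in s -> (x < CodeSeq.code s)%N.
Proof. by move=> xs; have /allP := CodeSeq.ltn_code s; exact. Qed.

Lemma size_code s : (size s <= CodeSeq.code s)%N.
Proof.
elim: s => //= x s IH; apply: (@leq_trans (1 * (CodeSeq.code s).*2.+1)%N); first lia.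
by rewrite leq_mul2r expn_gt0.
Qed.

Section Check.
Variables (Q : quiver) (p q : zdata Q).
Let cQ := code_quiver Q.
Let cp := code_zdata p.
Let cq := code_zdata q.

Lemma nthc_rels (r : zdata Q) v : nthc (nthc (code_zdata r) 0) (enum_rank v) = code_mx (rels r v).
Proof. by rewrite /code_zdata nthc_code /= nthc_map. Qed.

Lemma nthc_img (r : zdata Q) e : nthc (nthc (code_zdata r) 1) (enum_rank e) = code_mx (img r e).
Proof. by rewrite /code_zdata nthc_code /= nthc_map. Qed.

(** Nothing is asked of [w] except that decoding its parts yields the given matrices. So the lemma
    serves both for the code of a certificate and for whatever number the search returns. *)
Lemma qcheckP w F G C C' D E E' :
  (forall v, decodes (nthc (nthc w 0) (enum_rank v)) (F v)) ->
  (forall v, decodes (nthc (nthc w 1) (enum_rank v)) (G v)) ->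
  (forall v, decodes (nthc (nthc w 2) (enum_rank v)) (C v)) ->
  (forall v, decodes (nthc (nthc w 3) (enum_rank v)) (C' v)) ->
  (forall v, decodes (nthc (nthc w 4) (enum_rank v)) (E v)) ->
  (forall v, decodes (nthc (nthc w 5) (enum_rank v)) (E' v)) ->
  (forall e, decodes (nthc (nthc w 6) (enum_rank e)) (D e)) ->
  qcheck cQ cp cq w <-> @qcert Q p q F G C C' D E E'.
Proof.
move=> hF hG hC hC' hE hE' hD.
have no0 cX m (X : 'M[int]_(m, 0)) : decodes cX X by move=> i [].
have no0' cX m (X : 'M[int]_(0, m)) : decodes cX X by case.
have Z0 m n (i : 'I_m) (j : 'I_n) : (0 * (i == j :> nat))%N%:Z = (0 : 'M[int]_(m,
  n)) i j by rewrite mxE mul0n.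
have Z1 m (i : 'I_m) (j : 'I_m) : (1 * (i == j :> nat))%N%:Z = (1%:M : 'M[int]_m) i j by rewrite
  mxE mul1n -val_eqE; case: eqP.
have V v : qcheck_vertex cp cq w (enum_rank v) <->
    [/\ rels p v *m F v = C v *m rels q v, rels q v *m G v = C' v *m rels p v,
        F v *m G v = 1%:M + E v *m rels p v & G v *m F v = 1%:M + E' v *m rels q v].
  rewrite /qcheck_vertex !nthc_rels !(proj1 (nthc_code_mx _)) !(proj2 (nthc_code_mx _)).
  have e1 := eq_prodP (z := false) (decodes_code_mx (rels p v)) (hF v) (hC v) (decodes_code_mx
    (rels q v)) (no0 0%N _ 0) (no0' 0%N _ 0) (Z0 _ _).
  have e2 := eq_prodP (z := false) (decodes_code_mx (rels q v)) (hG v) (hC' v) (decodes_code_mx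
    (rels p v)) (no0 0%N _ 0) (no0' 0%N _ 0) (Z0 _ _).
  have e3 := eq_prodP (z := true) (hF v) (hG v) (hE v) (decodes_code_mx (rels p v)) (no0 0%N _ 0)
    (no0' 0%N _ 0) (Z1 _).
  have e4 := eq_prodP (z := true) (hG v) (hF v) (hE' v) (decodes_code_mx (rels q v)) (no0 0%N _
    0) (no0' 0%N _ 0) (Z1 _).
  rewrite !mul0mx !add0r !addr0 in e1 e2 e3 e4.
  by split=> [/and4P[/e1 ? /e2 ? /e3 ? /e4 ?]|[? ? ? ?]] //; apply/and4P; split; [apply/e1 |
    apply/e2 | apply/e3 | apply/e4].
have A e : qcheck_arrow cQ cp cq w (enum_rank e) <->
    img p e *m F (tgt e) = F (src e) *m img q e + D e *m rels q (tgt e).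
  rewrite /qcheck_arrow !nthc_code_quiver !(nthc_code [:: nat_of_ord (enum_rank (src e));
    _]) /= !nthc_rels !nthc_img !(proj1 (nthc_code_mx _)) !(proj2 (nthc_code_mx _)).
  have := eq_prodP (z := false) (decodes_code_mx (img p e)) (hF (tgt e)) (hF (src e))
    (decodes_code_mx (img q e)) (hD e) (decodes_code_mx (rels q (tgt e))) (Z0 _ _).
  by rewrite add0r => e1; split=> /e1.
have -> : qcheck cQ cp cq w <-> (forall v : vertex Q, qcheck_vertex cp cq w (enum_rank v)) /\
  (forall e : arrow Q, qcheck_arrow cQ cp cq w (enum_rank e)).
  split=> [/andP[/all_iotaP h1 /allP h2]|[h1 h2]].
    split=> [v|e].
      by have := h1 (cast_ord (esym (nthc_code_quiver0 Q)) (enum_rank v)).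
    have := h2 (enum_rank e); rewrite mem_iota /= add0n.
    have -> : (enum_rank e < cQ)%N.
      apply: leq_trans (ltn_ord _) _; apply: leq_trans (size_code _).
      by rewrite /= size_map -cardE.
    move=> /(_ isT); rewrite nthc_code_quiver.
    by rewrite [_ == _ :> nat]gtn_eqF //; apply: leq_ltn_trans (leq0n _) (mem_code (mem_head _ _)).
  apply/andP; split.
    apply/all_iotaP => i; have := h1 (enum_val (cast_ord (nthc_code_quiver0 Q) i)).
    by rewrite enum_valK.
  apply/allP => e _; have [he|he] := ltnP e #|arrow Q|.
    by have := h2 (enum_val (Ordinal he)); rewrite enum_valK => ->; rewrite orbT.
  by rewrite nthc_code nth_default //= size_map -cardE.
split=> [[h1 h2]|[h1 h2 h3 h4 h5]].
  by split=> [v|v|v|v|e]; [case: ((V v).1 (h1 v)) | case: ((V v).1 (h1 v)) |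
    case: ((V v).1 (h1 v)) | case: ((V v).1 (h1 v)) | exact/A].
by split=> [v|e]; [apply/V | apply/A].
Qed.
End Check.

Lemma absz_code_int z : (`|z| <= code_int z <= `|z|.*2)%N.
Proof. by case: z => n /=; lia. Qed.

Lemma code_mx_ge m n (M : 'M[int]_(m, n)) :
  [/\ (m < code_mx M)%N, (n < code_mx M)%N & mxle (code_mx M) M].
Proof.
split; [by apply: mem_code; rewrite !inE eqxx | by apply: mem_code; rewrite !inE eqxx orbT |].
move=> i j; have /andP[h _] := absz_code_int (M i j); apply: leq_trans h (ltnW _).
by apply: mem_code; rewrite !inE (allpairs_f (fun i j => code_int (M i j))) ?mem_enum ?orbT.
Qed.

Lemma code_mx_lt b m n (M : 'M[int]_(m, n)) : (m <= b)%N -> (n <= b)%N -> mxle b M ->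
  (code_mx M < maxcode (b.*2.+1) (b * b).+2)%N.
Proof.
move=> mb nb bM; apply: code_lt_max.
  by rewrite /= size_allpairs !size_enum_ord !ltnS; exact: leq_mul.
rewrite /=; apply/and3P; split; try lia.
apply/allP => _ /allpairsP[[i j] [_ _ ->]] /=.
have /andP[_ h] := absz_code_int (M i j); rewrite ltnS; apply: leq_trans h _.
by rewrite leq_double.
Qed.

Definition code_family (V : finType) m n (M : forall v : V, 'M[int]_(m v, n v)) :=
  CodeSeq.code [seq code_mx (M v) | v <- enum V].

Lemma code_family_lt b (V : finType) m n (M : forall v : V, 'M[int]_(m v, n v)) :
  (#|V| <= b)%N -> (forall v, (m v <= b)%N) -> (forall v, (n v <= b)%N) -> (forall v,
    mxle b (M v)) ->
  (code_family M < maxcode (maxcode (b.*2.+1) (b * b).+2) b)%N.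
Proof.
move=> Vb mb nb bM; apply: code_lt_max; first by rewrite size_map -cardE.
by apply/allP => _ /mapP[v _ ->]; exact: code_mx_lt.
Qed.

(** The code of a list exceeds each of its entries, so one number majorizes all dimensions and
    coefficients of the input. *)
Lemma code_zdata_dsize (Q : quiver) (p : zdata Q) s : (code_zdata p <= s)%N -> dsize s p.
Proof.
move=> ps.
have hr v : (code_mx (rels p v) <= s)%N.
  apply: leq_trans ps; apply: ltnW (ltn_trans (mem_code _) (mem_code (mem_head _ _))).
  by apply/mapP; exists v; rewrite ?mem_enum.
have hi e : (code_mx (img p e) <= s)%N.
  apply: leq_trans ps; apply: ltnW; apply: ltn_trans (mem_code (_ : CodeSeq.code [seq code_mx
    (img p e) | e <- enum (arrow Q)] \in _)); last by rewrite !inE eqxx orbT.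
  by apply: mem_code; apply/mapP; exists e; rewrite ?mem_enum.
split=> x; first [have [h1 h2 h3] := code_mx_ge (rels p x) | have [_ _ h3] := code_mx_ge (img p x)].
- exact: leq_trans (ltnW h2) (hr x).
- exact: leq_trans (ltnW h1) (hr x).
- exact: mxleW h3 (hr x).
- exact: mxleW h3 (hi x).
Qed.

Lemma code_quiver_ge (Q : quiver) : (#|vertex Q| <= code_quiver Q)%N /\ (#|arrow Q|
    <= code_quiver Q)%N.
Proof.
split; first exact: ltnW (mem_code (mem_head _ _)).
by apply: leq_trans (size_code _); rewrite /= size_map -cardE.
Qed.

Theorem theorem4p1 :
  exists f : recfun 3,
  forall (Q : quiver) (A B : zrep Q) (p q : zdata Q),
    presents p A -> presents q B ->
    decides f [tuple code_quiver Q; code_zdata p; code_zdata q] (zrep_iso A B).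
Proof.
have [g [mg hg]] := qcert_bounded.
pose b s := (g s + s)%N.
(* Three nested lists: the entries of a matrix, the matrices of a family, and the seven families of
   a certificate. *)
pose bound s := maxcode (maxcode (maxcode (b s).*2.+1 (b s * b s).+2) (b s)) 7.
have rmax k F G : recf k F -> recf k G -> recf k (fun e => maxcode (F e) (G e)).
  by apply: recf_app2; exact: rec2_maxcode.
have rb : rec1 b by exact: (proj1 (mf_add mg mf_id)).
have rbound : rec1 bound.
  apply: (rmax _ _ _ _ (recf_const _ _)); apply: (rmax _ _ _ _ rb); apply: rmax.
    by apply: recf_succ; apply: (recf_ext (recf_add rb rb)) => e _; rewrite addnn.
  by apply/recf_succ/recf_succ; exact: (recf_mul rb rb).
pose x (e : seq nat) i := nth 0%N e i.
have [f hf] : recf 3 (fun e => has (qcheck (x e 0) (x e 1) (x e 2))%N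
    (iota 0 (bound (x e 0 + x e 1 + x e 2)))%N : nat).
  apply: recf_has.
    by apply: (recf_app1 rbound); apply: recf_add; [apply: recf_add |]; exact: recf_nth.
  (* The search variable stands at the head of the environment, whereas [qcheck] takes it last. *)
  pose y (i : 'I_4) (e : seq nat) := nth 0%N e (nth 0%N [:: 1; 2; 3; 0]%N i).
  apply: recf_ext (recf_comp (G := y) recf_qcheck _) _ => [i|e _].
    by apply: recf_nth; case: i => -[|[|[|[]]]].
  by rewrite !enum_ordSl /y /x /= !nth_drop.
exists f => Q A B p q pA qB.
pose s := (code_quiver Q + code_zdata p + code_zdata q)%N.
have dp : dsize s p by apply: code_zdata_dsize; rewrite /s; lia.
have dq : dsize s q by apply: code_zdata_dsize; rewrite /s; lia.
have Vs : (#|vertex Q| <= s)%N by apply: leq_trans (proj1 (code_quiver_ge Q)) _; rewrite /s; lia.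
have As : (#|arrow Q| <= s)%N by apply: leq_trans (proj2 (code_quiver_ge Q)) _; rewrite /s; lia.
have iff : zrep_iso A B <-> has (qcheck (code_quiver Q) (code_zdata p) (code_zdata q)) (iota 0
  (bound s)).
  split=> [AB|/hasP[w _ hw]].
    have [F0 [G0 [hF hG hFG hGF]]] := zrep_iso_qhom pA qB AB.
    have [F [G [C [C' [D [E [E' [cert [[bF bG bC bC'] bE bE' bD]]]]]]]]] :=
      hg s Q p q F0 G0 Vs As dp dq hF hG hFG hGF.
    pose w := CodeSeq.code [:: code_family F; code_family G; code_family C; code_family C';
      code_family E; code_family E'; code_family D].
    have sb : (s <= b s)%N by exact: leq_addl.
    have gb : (g s <= b s)%N by exact: leq_addr.
    have [pn pm _ _] := dp; have [qn qm _ _] := dq.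
    apply/hasP; exists w.
      rewrite mem_iota /=; apply: code_lt_max => //=.
      do ![apply/andP; split] => //; apply: code_family_lt => *;
        solve [exact: leq_trans sb | eapply leq_trans; last exact: sb; by [] | eapply mxleW;
          last exact: gb; by [] ].
    by apply/(@qcheckP Q p q w F G C C' D E E') => // v i j; rewrite nthc_code /= nthc_map
      decodes_code_mx.
  (* Decoding is total: any [w] that passes the test yields matrices of the right dimensions,
     whether or not it is a well-formed code. *)
  pose M t m n (v : nat) := \matrix_(i < m, j < n) entry (nthc (nthc w t) v) i j : 'M[int]_(m, n).
  have hM t m n v : decodes (nthc (nthc w t) v) (M t m n v) by move=> i j; rewrite mxE.
  have := (@qcheckP Q p q w (fun v => M 0%N _ _ (enum_rank v)) (fun v => M 1%N _ _ (enum_rank v))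
    (fun v => M 2%N _ _ (enum_rank v))
    (fun v => M 3%N _ _ (enum_rank v)) (fun e => M 6%N _ _ (enum_rank e)) (fun v => M 4%N _ _
      (enum_rank v)) (fun v => M 5%N _ _ (enum_rank v))
    (fun v => hM _ _ _ _) (fun v => hM _ _ _ _) (fun v => hM _ _ _ _) (fun v => hM _ _ _ _) (fun
      v => hM _ _ _ _) (fun v => hM _ _ _ _) (fun v => hM _ _ _ _)).1 hw.
  exact: qcert_zrep_iso.
have := hf [tuple code_quiver Q; code_zdata p; code_zdata q]; rewrite /x /= -/s => h.
split=> [/iff|nAB]; first by move: h; case: has.
by move: h; have [/iff|] := boolP (has _ _).
Qed.
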